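(* Let $N\in\{2,3\}$, let $\alpha\in\mathbb{R}$ if $N=2$ and $\alpha<0$ if $N=3$, and let $1<p<\infty$ if $N=2$ and $1<p<2$ if $N=3$. Let $\lambda>0$. The operator $-\Delta_\alpha$ admits an extension $-\widetilde{\Delta}_\alpha$ to $X_0$ in the sense of bilinear (sesquilinear) forms, namely $$-\widetilde{\Delta}_\alpha\colon X_0\to X_0^*,\qquad u\mapsto \langle -\widetilde{\Delta}_\alpha u,\cdot\rangle_{X_0^*,X_0},$$ where $$\langle -\widetilde{\Delta}_\alpha u,v\rangle_{X_0^*,X_0}:=\langle\nabla f_\lambda,\nabla g_\lambda\rangle+\bigl(\alpha+\beta(\lambda)+\lambda\|G_\lambda\|_{L^2}^2\bigr)c\,\overline{d}-\lambda\overline{d}\,\langle u,G_\lambda\rangle-\lambda c\,\overline{\langle v,G_\lambda\rangle}$$ for every $u=f_\lambda+cG_\lambda$ and $v=g_\lambda+dG_\lambda$ in $X_0$ (with $f_\lambda,g_\lambda\in (L^{p+1}\cap\dot H^1)(\mathbb{R}^N)$ and $c,d\in\mathbb{C}$). In particular, for all $u,v\in H^1_\alpha(\mathbb{R}^N)$, $$\langle -\widetilde{\Delta}_\alpha u,v\rangle_{X_0^*,X_0}=\langle-\Delta_\alpha u,v\rangle .$$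
   Context: All functions are complex valued and $\langle u,v\rangle=\int_{\mathbb{R}^N}u\overline{v}\,dx$. For $\lambda>0$, $G_\lambda\in L^2(\mathbb{R}^N)$ is the solution of $(\lambda-\Delta)G_\lambda=\delta_0$ in $\mathcal{D}'$. Set $\beta(\lambda)=\frac{1}{2\pi}\bigl(\gamma+\log\frac{\sqrt\lambda}{2}\bigr)$ if $N=2$ ($\gamma$ the Euler–Mascheroni constant) and $\beta(\lambda)=\frac{\sqrt\lambda}{4\pi}$ if $N=3$. $-\Delta_\alpha$ is the self-adjoint Laplacian with point interaction at the origin: its domain consists of $u=f+cG_\lambda$ with $f\in H^2(\mathbb{R}^N)$, $c\in\mathbb{C}$, $(\alpha+\beta(\lambda))c=f(0)$, and $(\lambda-\Delta_\alpha)u=(\lambda-\Delta)f$ (independent of $\lambda>0$). Its form domain is $H^1_\alpha(\mathbb{R}^N)=\{f+cG_\lambda : f\in H^1(\mathbb{R}^N),\,c\in\mathbb{C}\}$, and for $u=f+cG_\lambda$, $v=g+dG_\lambda$ in $H^1_\alpha(\mathbb{R}^N)$ its form is $\langle-\Delta_\alpha u,v\rangle=\langle\nabla f,\nabla g\rangle+\lambda\langle f,g\rangle+(\alpha+\beta(\lambda))c\overline d-\lambda\langle u,v\rangle$. $(L^{p+1}\cap\dot H^1)(\mathbb{R}^N)=\{f\in L^{p+1}(\mathbb{R}^N): \nabla f\in L^2(\mathbb{R}^N)\}$, and $X_0=\{f+cG_\lambda : f\in(L^{p+1}\cap\dot H^1)(\mathbb{R}^N),\,c\in\mathbb{C}\}$,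 which does not depend on $\lambda>0$, with norm $\|u\|_{X_0}=\|\nabla f\|_{L^2}+|c|+\|u\|_{L^{p+1}}$ for $u=f+cG_\lambda$ (different $\lambda$ give equivalent norms). $X_0^*$ is the dual space of $X_0$; since the pairing is conjugate-linear in its second argument, its elements are understood as continuous conjugate-linear functionals on $X_0$. The pairing $\langle u,G_\lambda\rangle$ for $u\in X_0$ is the convergent integral ($u\in L^{p+1}$, $G_\lambda\in L^{(p+1)/p}$). *)

(* Defs.v *)
From HB Require Import structures.
From mathcomp Require Import all_boot all_order all_algebra.
From mathcomp Require Import all_classical all_reals all_analysis.
From mathcomp Require Import complex.
Set Implicit Arguments.
Unset Strict Implicit.
Unset Printing Implicit Defensive.
Import Order.TTheory GRing.Theory Num.Theory.
Import numFieldNormedType.Exports.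

Local Open Scope classical_set_scope.
Local Open Scope ring_scope.
Local Open Scope complex_scope.

(* R^n is the type of row vectors, with the sigma-algebra generated by the
   coordinates (the Borel sets) and, below, the n-fold product [volume n] of
   the one-dimensional Lebesgue measure. *)
Section row_measurable.
Context {R : realType}.
Variable n : nat.

Definition row_coord (i : 'I_n) (x : 'rV[R]_n) : measurableTypeR R := x ord0 i.

Let row_set0 : g_sigma_preimage row_coord set0.
Proof. exact: sigma_algebra0. Qed.

Let row_setC A : g_sigma_preimage row_coord A ->
  g_sigma_preimage row_coord (~` A).
Proof. exact: sigma_algebraC. Qed.

Let row_bigcup (F : _^nat) : (forall i, g_sigma_preimage row_coord (F i)) ->
  g_sigma_preimage row_coord (\bigcup_i (F i)).
Proof. exact: sigma_algebra_bigcup. Qed.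

HB.instance Definition _ := @isMeasurable.Build
  (measure_tuple_display (R.-ocitv.-measurable).-sigma) 'rV[R]_n
  (g_sigma_preimage row_coord) row_set0 row_setC row_bigcup.

Lemma measurable_row_coord i : measurable_fun setT (row_coord i).
Proof.
move=> _ Y mY; rewrite setTI; apply: sub_sigma_algebra => /=.
rewrite -bigcup_seq/=; exists i => /=; first by rewrite mem_index_enum.
by exists Y => //; rewrite setTI.
Qed.

End row_measurable.

Lemma measurable_fun_rowP {R : realType} d (T : measurableType d) n
    (f : T -> 'rV[R]_n) :
  (forall i, measurable_fun setT (row_coord i \o f)) -> measurable_fun setT f.
Proof.
move=> mf _ A mA; rewrite setTI.
suff : g_sigma_preimage (@row_coord R n) `<=` [set B | measurable (f @^-1` B)].
  exact.
apply: smallest_sub.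
  split => //=.
  - by rewrite preimage_set0.
  - by move=> B mB; rewrite setTD preimage_setC; exact: measurableC.
  - by move=> F mF; rewrite preimage_bigcup; exact: bigcup_measurable.
rewrite -bigcup_seq => B [i _] [C mC <-] /=.
by rewrite setTI -comp_preimage -[X in measurable X]setTI; exact: mf.
Qed.

(* The library's sigma-finite instance on product measures is shadowed by the
   subprobability one. *)
Lemma sigma_finite_prod d1 d2 (T1 : measurableType d1) (T2 : measurableType d2)
    (R : realType) (m1 : {sigma_finite_measure set T1 -> \bar R})
    (m2 : {sigma_finite_measure set T2 -> \bar R}) :
  sigma_finite setT (m1 \x m2)%E.
Proof.
have /sigma_finiteP[F [TF ndF Foo]] := sigma_finiteT m1.
have /sigma_finiteP[G [TG ndG Goo]] := sigma_finiteT m2.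
exists (fun n => F n `*` G n).
  rewrite -setXTT TF TG predeqE => -[x y]; split.
    move=> [/= [n _ Fnx] [k _ Gky]]; exists (maxn n k) => //; split.
    - by move: x Fnx; exact/subsetPset/ndF/leq_maxl.
    - by move: y Gky; exact/subsetPset/ndG/leq_maxr.
  by move=> [n _ []/= ? ?]; split; exists n.
move=> k; have [? ?] := Foo k; have [? ?] := Goo k.
split; first exact: measurableX.
by rewrite product_measure1E// lte_mul_pinfty// ge0_fin_numE.
Qed.

Section row_cons.
Context {R : realType}.
Variable n : nat.

Definition row_cons (x : measurableTypeR R * 'rV[R]_n) : 'rV[R]_n.+1 :=
  row_mx (const_mx x.1 : 'rV_1) x.2.

Definition row_uncons (x : 'rV[R]_n.+1) : measurableTypeR R * 'rV[R]_n :=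
  (x ord0 ord0, rsubmx (x : 'rV_(1 + n))).

Lemma row_consK : cancel row_cons row_uncons.
Proof.
move=> [a x]; rewrite /row_cons /row_uncons /=; congr pair; last first.
  by rewrite row_mxKr.
have aE : row_mx (const_mx a : 'rV_1) x ord0 (lshift n (ord0 : 'I_1)) = a.
  by rewrite row_mxEl mxE.
by rewrite -[RHS]aE; congr (fun_of_matrix _ _ _); apply: val_inj.
Qed.

Lemma measurable_row_cons : measurable_fun setT row_cons.
Proof.
apply: measurable_fun_rowP => i.
case: (split_ordP (i : 'I_(1 + n))) => j ->.
- rewrite (_ : _ \o _ = fst) //.
  apply/funext => x.
  by apply: etrans (row_mxEl (const_mx x.1 : 'rV_1) x.2 ord0 j) _; rewrite mxE.
- rewrite (_ : _ \o _ = row_coord j \o snd).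
    apply: measurableT_comp => //; exact: measurable_row_coord.
  apply/funext => x.
  exact: (row_mxEr (const_mx x.1 : 'rV_1) x.2 ord0 j).
Qed.

Lemma measurable_row_uncons : measurable_fun setT row_uncons.
Proof.
apply: measurable_fun_pair; first exact: measurable_row_coord.
apply: measurable_fun_rowP => i.
rewrite (_ : _ \o _ = @row_coord R n.+1 (rshift 1 i)).
  exact: measurable_row_coord.
by apply/funext => x; rewrite /row_coord /= mxE.
Qed.


Variable m : {sigma_finite_measure set 'rV[R]_n -> \bar R}.

Definition volume_step : set 'rV[R]_n.+1 -> \bar R :=
  pushforward (@lebesgue_measure R \x m)%E row_cons.

Let volume_step0 : volume_step set0 = 0%E.
Proof. by rewrite /volume_step /pushforward preimage_set0 measure0. Qed.

Let volume_step_ge0 A : (0 <= volume_step A)%E.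
Proof. by rewrite /volume_step /pushforward; exact: measure_ge0. Qed.

Let volume_step_sigma_additive : semi_sigma_additive volume_step.
Proof.
move=> F mF tF mUF; rewrite /volume_step /pushforward preimage_bigcup.
apply: measure_semi_sigma_additive.
- by move=> k; rewrite -[X in measurable X]setTI; exact: measurable_row_cons.
- apply/trivIsetP => /= i j _ _ ij; rewrite -preimage_setI.
  by move/trivIsetP : tF => /(_ _ _ _ _ ij) ->//; rewrite preimage_set0.
- by rewrite -preimage_bigcup -[X in measurable X]setTI;
    exact: measurable_row_cons.
Qed.

HB.instance Definition _ := isMeasure.Build _ _ _ volume_step
  volume_step0 volume_step_ge0 volume_step_sigma_additive.

Let volume_step_sigma_finite : sigma_finite setT volume_step.
Proof.
have [F TF mF] := sigma_finite_prod (@lebesgue_measure R) m.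
exists (fun k => row_uncons @^-1` F k).
  by rewrite -preimage_bigcup -TF preimage_setT.
move=> k; have [mFk Fkoo] := mF k; split.
  by rewrite -[X in measurable X]setTI; exact: measurable_row_uncons.
rewrite /volume_step /pushforward -comp_preimage.
by rewrite (_ : row_uncons \o row_cons = id) //; apply/funext/row_consK.
Qed.

HB.instance Definition _ := Measure_isSigmaFinite.Build _ _ _ volume_step
  volume_step_sigma_finite.

End row_cons.

Fixpoint volume {R : realType} (n : nat) :
    {sigma_finite_measure set 'rV[R]_n -> \bar R} :=
  if n is k.+1 then volume_step (volume k) else \d_(0 : 'rV[R]_0).

Section function_spaces.
Context {R : realType} {N : nat}.
Local Notation C := R[i].
Local Notation E := 'rV[R]_N.
Local Notation normc := ComplexField.Normc.normc.

Definition cmeasurable (f : E -> C) : Prop :=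
  measurable_fun setT (fun x => complex.Re (f x)) /\
  measurable_fun setT (fun x => complex.Im (f x)).

Definition cintegral (f : E -> C) : C :=
  (\int[volume N]_x complex.Re (f x))%R +i* (\int[volume N]_x complex.Im (f x))%R.

Definition inner (f g : E -> C) : C := cintegral (fun x => f x * (g x)^*).

Definition cLnorm (q : R) (f : E -> C) : \bar R :=
  Lnorm (volume N) q%:E (fun x => (normc (f x))%:E).

Definition in_Lp (q : R) (f : E -> C) : Prop :=
  cmeasurable f /\ (cLnorm q f < +oo)%E.

Definition Lp_norm (q : R) (f : E -> C) : R := fine (cLnorm q f).

Definition loc_integrable (f : E -> C) : Prop :=
  cmeasurable f /\ forall K : set E, compact K ->
    (\int[volume N]_(x in K) (normc (f x))%:E < +oo)%E.

Definition base_vec (j : 'I_N) : E := delta_mx ord0 j.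

Definition pderiv (j : 'I_N) (f : E -> R) : E -> R :=
  fun x => 'D_(base_vec j) f x.

Definition cpderiv (j : 'I_N) (f : E -> C) : E -> C :=
  fun x => pderiv j (fun y => complex.Re (f y)) x +i* pderiv j (fun y => complex.Im (f y)) x.

Definition smooth (f : E -> R) : Prop := forall s : seq 'I_N,
  continuous (foldr pderiv f s) /\
  forall j x, derivable (foldr pderiv f s) x (base_vec j).

Definition test_function (phi : E -> C) : Prop :=
  [/\ smooth (fun x => complex.Re (phi x)), smooth (fun x => complex.Im (phi x))
    & compact (closure [set x | phi x != 0])].

(* [h] is the weak (distributional) derivative of [f] along coordinate [j]. *)
Definition is_wpd (j : 'I_N) (f h : E -> C) : Prop :=
  [/\ loc_integrable f, loc_integrable h
    & forall phi, test_function phi ->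
        cintegral (fun x => f x * cpderiv j phi x) =
        - cintegral (fun x => h x * phi x)].

(* A weak derivative is unique up to a null set; one is chosen. *)
Definition wpd (j : 'I_N) (f : E -> C) : E -> C :=
  xget (fun=> 0) [set h | is_wpd j f h].

Definition grad_in_L2 (f : E -> C) : Prop :=
  forall j, exists2 h, is_wpd j f h & in_Lp 2 h.

Definition grad_inner (f g : E -> C) : C :=
  \sum_(j < N) inner (wpd j f) (wpd j g).

Definition grad_norm (f : E -> C) : R :=
  Num.sqrt (\sum_(j < N) Lp_norm 2 (wpd j f) ^+ 2).

Definition weak_laplacian (f : E -> C) : E -> C :=
  fun x => \sum_(j < N) wpd j (wpd j f) x.

Definition in_H1 (f : E -> C) : Prop := in_Lp 2 f /\ grad_in_L2 f.

Definition in_H2 (f : E -> C) : Prop := in_H1 f /\ forall j, in_H1 (wpd j f).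

Definition in_Lp_dotH1 (q : R) (f : E -> C) : Prop := in_Lp q f /\ grad_in_L2 f.

End function_spaces.

Section point_interaction.
Context {R : realType} {N : nat}.
Local Notation C := R[i].
Local Notation E := 'rV[R]_N.
Local Notation normc := ComplexField.Normc.normc.

(* G in L^2 solves (lam - Delta) G = delta_0 in the sense of distributions. *)
Definition is_green (lam : R) (G : E -> C) : Prop :=
  in_Lp 2 G /\ forall phi, test_function phi ->
    cintegral (fun x =>
      G x * (lam%:C * phi x - \sum_(j < N) cpderiv j (cpderiv j phi) x)) =
    phi 0.

Definition euler_gamma : R :=
  limn (fun n : nat => \sum_(1 <= k < n.+1) (k%:R)^-1 - ln n%:R : R).

(* Meaningful for N = 2 and N = 3 only. *)
Definition beta_pt (lam : R) : R :=
  if N == 2 then (2 * pi)^-1 * (euler_gamma + ln (Num.sqrt lam / 2))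
  else Num.sqrt lam / (4 * pi).

(* u = f + c G almost everywhere, with f in the class S. *)
Definition decomp (S : (E -> C) -> Prop) (G u f : E -> C) (c : C) : Prop :=
  [/\ S f, cmeasurable u & {ae volume N, forall x, u x = f x + c * G x}].

Definition in_X0 (p : R) (G u : E -> C) : Prop :=
  exists f c, decomp (in_Lp_dotH1 (p + 1)) G u f c.

(* The norm of u = f + c G in X_0, for a given decomposition. *)
Definition X0_norm (p : R) (u f : E -> C) (c : C) : R :=
  grad_norm f + normc c + Lp_norm (p + 1) u.

(* Continuous conjugate-linear functionals on X_0. *)
Definition in_X0_dual (p : R) (G : E -> C) (L : (E -> C) -> C) : Prop :=
  (forall a v w, in_X0 p G v -> in_X0 p G w ->
     L (fun x => a * v x + w x) = a^* * L v + L w) /\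
  exists K : R, forall v g d, decomp (in_Lp_dotH1 (p + 1)) G v g d ->
    normc (L v) <= K * X0_norm p v g d.

Definition in_H1alpha (G u : E -> C) : Prop :=
  exists f c, decomp in_H1 G u f c.

(* Graph of -Delta_alpha: w = -Delta_alpha u, that is
   lam u + w = (lam - Delta) f.  The value f(0) of f in H^2 is that of its
   continuous representative, hence the continuity requirement on f. *)
Definition Lap_alpha (alpha lam : R) (G u w : E -> C) : Prop :=
  exists f c,
    [/\ decomp in_H2 G u f c,
        continuous (fun x => complex.Re (f x)) /\ continuous (fun x => complex.Im (f x)),
        (alpha + beta_pt lam)%:C * c = f 0,
        cmeasurable w
      & {ae volume N, forall x,
          lam%:C * u x + w x = lam%:C * f x - weak_laplacian f x}].

(* The form of -Delta_alpha at u = f + c G, v = g + d G in H^1_alpha. *)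
Definition form_alpha (alpha lam : R) (u f : E -> C) (c : C)
    (v g : E -> C) (d : C) : C :=
  grad_inner f g + lam%:C * inner f g + (alpha + beta_pt lam)%:C * c * d^*
  - lam%:C * inner u v.

End point_interaction.
Arguments beta_pt {R} N lam.

(* Main.v *)
(* The right-hand side defines a bounded sesquilinear form on X_0 by the
   Cauchy-Schwarz and Hoelder inequalities, provided that G_lambda is in
   L^(p+1) and in L^((p+1)/p) and that u determines c and f.  As G is given only
   by its distributional equation, it is first identified with
   g = int_0^oo e^(-lambda t) heat(t, .) dt: the difference W is in L^2 and
   satisfies (lambda - Delta) W = 0, and mollifying W and pairing with the
   mollification itself gives W = 0.  Since
   g(x) <= C prod_i min(|x_i|^(-2 th), |x_i|^(-2)) for suitable small th > 0, the
   function g has the required integrability.  The decomposition is unique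
   because the gradient of g is not in L^2: test functions concentrating at the
   origin with fixed value there converge weakly to 0 in the homogeneous H^1
   norm when N >= 2, whereas (lambda - Delta) g = delta_0.  The inclusion of
   H^1_alpha in X_0 is the Sobolev embedding of H^1 in L^(p+1).  Finally
   <(lambda - Delta) f, G> = f(0) for f in H^2, by differentiating the pairing
   of f with the heat kernel in time; combined with the boundary condition
   (alpha + beta) c = f(0) and an integration by parts, this identifies the
   form with that of the operator. *)
From HB Require Import structures.
Require Import Defs.
From mathcomp Require Import all_boot all_order all_algebra.
From mathcomp Require Import all_classical all_reals all_analysis.
From mathcomp Require Import complex.
From mathcomp Require Import measurable_realfun ring lra.
Set Implicit Arguments.
Unset Strict Implicit.
Unset Printing Implicit Defensive.
Import Order.TTheory GRing.Theory Num.Theory.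
Import numFieldNormedType.Exports.

Local Open Scope classical_set_scope.
Local Open Scope ring_scope.
Local Open Scope complex_scope.

(** * Integration on row vectors *)

(** Translations along the axes do the work usually given to the Fourier transform. If h is the weak
    derivative of f along e_j and lies in L^2, then f(x + s e_j) - f(x) = int_0^s h(x + t e_j) dt
    for almost every x ([rwpd_line]). This identity gives integration by parts without approximation
    by smooth functions. It also gives the L^2 bound on increments from which the embedding into
    L^(p+1) follows by estimating level sets. The exponent th trades time against space: e^(-z) <=
    z^(-th), applied in each coordinate, turns t^(-N/2) into t^(-N(1/2 - th)) at the cost of a
    singularity |x_i|^(-2 th). Integrability at t = 0 asks for th > 1/2 - 1/N, and the bound lies in
    L^(p+1) near the axes if th < 1/(2(p+1)). For N = 3 both can be met exactly when p < 2. Elements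
    of X_0 are functions given up to null sets and weak derivatives are chosen, so the form is
    evaluated on a chosen decomposition. Its value does not depend on the choice: c is determined,
    and f is determined almost everywhere. *)

Section lebesgue_translation.
Context {R : realType}.
Local Open Scope ereal_scope.

(** Lebesgue measure is determined by its values on half-open intervals, and a translation preserves
    their lengths. *)
Lemma lebesgue_measure_shift (a : R) (A : set (measurableTypeR R)) :
  measurable A ->
  pushforward (@lebesgue_measure R) ((fun x => x + a)%R : measurableTypeR R -> measurableTypeR R) A = lebesgue_measure A.
Proof.
move=> mA.
have ms : measurable_fun setT ((fun x => x + a)%R : measurableTypeR R -> measurableTypeR R).
  exact: measurable_funD.
pose f : {mfun (measurableTypeR R) >-> (measurableTypeR R)} :=
  HB.pack (fun x : measurableTypeR R => (x + a)%R) (isMeasurableFun.Build _ _ _ _ _ ms).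
apply/esym; apply: (@lebesgue_measure_unique R (pushforward (@lebesgue_measure R) f)) => //= _ [[b c]] _ <-.
rewrite /pushforward.
have -> : f @^-1` `]b, c]%classic = (`](b - a)%R, (c - a)%R])%classic.
  by apply/seteqP; split=> x /=; rewrite !in_itv/= ltrBlDr lerBrDr.
rewrite !lebesgue_measure_itv/= !lte_fin ltrD2r; case: ifP => // _.
rewrite -!EFinD; congr EFin; ring.
Qed.

Lemma ge0_integral_shift (a : R) (f : measurableTypeR R -> \bar R) :
  measurable_fun setT f -> (forall x, 0 <= f x) ->
  \int[lebesgue_measure]_x f (x + a)%R = \int[lebesgue_measure]_x f x.
Proof.
move=> mf f0.
have ms : measurable_fun setT ((fun x => x + a)%R : measurableTypeR R -> measurableTypeR R).
  exact: measurable_funD.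
pose s : {mfun (measurableTypeR R) >-> (measurableTypeR R)} :=
  HB.pack (fun x : measurableTypeR R => (x + a)%R) (isMeasurableFun.Build _ _ _ _ _ ms).
transitivity (\int[pushforward (@lebesgue_measure R) s]_x f x).
  rewrite ge0_integral_pushforward//.
by apply: eq_measure_integral => //= A mA _; exact: lebesgue_measure_shift.
Qed.

End lebesgue_translation.

Section volume_basics.
Context {R : realType}.
Local Open Scope ereal_scope.

Lemma row_eqP n (x y : 'rV[R]_n) : (forall j, x ord0 j = y ord0 j) -> x = y.
Proof. by move=> h; apply/rowP => j; exact: h. Qed.

Lemma row_consE n (x : measurableTypeR R * 'rV[R]_n) (j : 'I_n.+1) :
  row_cons x ord0 j = if unlift ord0 j is Some i then x.2 ord0 i else x.1.
Proof.
case: unliftP => [i ->|->].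
  rewrite (_ : lift ord0 i = @rshift 1 n i); last exact/val_inj.
  exact: row_mxEr.
rewrite (_ : ord0 = @lshift 1 n ord0); last exact/val_inj.
by apply: etrans (row_mxEl _ _ _ _) _; rewrite mxE.
Qed.

Lemma row_cons0 n (x : measurableTypeR R * 'rV[R]_n) : row_cons x ord0 ord0 = x.1.
Proof. by rewrite row_consE unlift_none. Qed.

Lemma row_consS n (x : measurableTypeR R * 'rV[R]_n) i :
  row_cons x ord0 (lift ord0 i) = x.2 ord0 i.
Proof. by rewrite row_consE liftK. Qed.

(** Tonelli after unfolding [volume] as a pushforward along [row_cons]. It is the induction step for
    every computation in dimension n. *)
Lemma ge0_integral_volumeS n (F : 'rV[R]_n.+1 -> \bar R) :
  measurable_fun setT F -> (forall x, 0 <= F x) ->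
  \int[volume n.+1]_x F x =
  \int[lebesgue_measure]_a \int[volume n]_x F (row_cons (a, x)).
Proof.
move=> mF F0.
transitivity (\int[(lebesgue_measure \x volume n)]_z F (row_cons z)).
  have mr := @measurable_row_cons R n.
  pose s : {mfun (measurableTypeR R * 'rV[R]_n)%type >-> 'rV[R]_n.+1} :=
    HB.pack (@row_cons R n) (isMeasurableFun.Build _ _ _ _ _ mr).
  transitivity (\int[pushforward (lebesgue_measure \x volume n) s]_x F x).
    exact: eq_measure_integral.
  by rewrite ge0_integral_pushforward.
rewrite fubini_tonelli1//.
by apply: measurableT_comp => //; exact: measurable_row_cons.
Qed.

Lemma measurable_fun_rowD n :
  measurable_fun setT (fun z : 'rV[R]_n * 'rV[R]_n => (z.1 + z.2)%R).
Proof.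
apply: measurable_fun_rowP => i.
rewrite (_ : _ \o _ = (fun z : 'rV[R]_n * 'rV[R]_n => row_coord i z.1 + row_coord i z.2)%R); last first.
  by apply/funext => z; rewrite /row_coord /= mxE.
by apply: measurable_funD; apply: measurableT_comp => //; exact: measurable_row_coord.
Qed.

Lemma measurable_fun_rowZ n :
  measurable_fun setT (fun z : measurableTypeR R * 'rV[R]_n => (z.1 *: z.2)%R).
Proof.
apply: measurable_fun_rowP => i.
rewrite (_ : _ \o _ = (fun z : measurableTypeR R * 'rV[R]_n => z.1 * row_coord i z.2)%R); last first.
  by apply/funext => z; rewrite /row_coord /= mxE.
by apply: measurable_funM => //; apply: measurableT_comp => //; exact: measurable_row_coord.
Qed.

Lemma measurable_fun_rowDr n (y : 'rV[R]_n) : measurable_fun setT (fun x : 'rV[R]_n => (x + y)%R).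
Proof. exact: (measurableT_comp (@measurable_fun_rowD n) (measurable_pair2 y)). Qed.

(** Induction on the dimension: the inner integral absorbs the shift of the last n coordinates, and
    one-dimensional invariance absorbs that of the first. *)
Lemma ge0_integral_translate n (F : 'rV[R]_n -> \bar R) (y : 'rV[R]_n) :
  measurable_fun setT F -> (forall x, 0 <= F x) ->
  \int[volume n]_x F (x + y)%R = \int[volume n]_x F x.
Proof.
elim: n F y => [|n IH] F y mF F0.
  by apply: eq_integral => x _; rewrite (_ : y = 0%R) ?addr0//; apply/rowP => -[].
rewrite (ge0_integral_volumeS mF F0).
have mFy : measurable_fun setT (fun x : 'rV[R]_n.+1 => F (x + y)%R).
  exact: (measurableT_comp mF (measurable_fun_rowDr y)).
rewrite (ge0_integral_volumeS mFy (fun=> F0 _)).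
transitivity (\int[lebesgue_measure]_a \int[volume n]_x F (row_cons ((a + y ord0 ord0)%R : measurableTypeR R, x))).
  apply: eq_integral => a _.
  rewrite -(IH (fun x => F (row_cons ((a + y ord0 ord0)%R : measurableTypeR R, x))) (row_uncons y).2)//; last first.
    apply: (measurableT_comp mF).
    exact: (measurableT_comp (@measurable_row_cons R n)).
  apply: eq_integral => x _; congr F.
  apply: row_eqP => j.
  rewrite mxE !row_consE; case: unliftP => [i ->|->] //=; rewrite !mxE.
  by congr (_ + y _ _)%R; exact/val_inj.
apply: (@ge0_integral_shift _ _ (fun a => \int[volume n]_x F (row_cons (a, x)))).
  have := @measurable_fun_fubini_tonelli_F _ _ (measurableTypeR R) _ R (volume n) (F \o @row_cons R n).
  move=> H; apply: H => [|x]; last exact: F0.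
  exact: (measurableT_comp mF (@measurable_row_cons R n)).
by move=> a; apply: integral_ge0.
Qed.

Lemma measurable_fun_prodr d (T : measurableType d) (I : Type) (r : seq I) (P : pred I) (m : I -> T -> R) :
  (forall i, measurable_fun setT (m i)) ->
  measurable_fun setT (fun x => \prod_(i <- r | P i) m i x)%R.
Proof.
move=> mm; elim: r => [|i r IHr].
  rewrite (_ : (fun _ => _) = cst 1%R); first exact: measurable_cst.
  by apply/funext => x; rewrite big_nil.
rewrite (_ : (fun _ => _) =
    if P i then (m i \* (fun x => \prod_(i <- r | P i) m i x))%R else (fun x => \prod_(i <- r | P i) m i x)%R); last first.
  by apply/funext => x; rewrite big_cons; case: (P i).
by case: (P i) => //; apply: measurable_funM.
Qed.

Lemma measurable_tensor n (m : 'I_n -> R -> R) :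
  (forall i, measurable_fun setT (m i : measurableTypeR R -> R)) ->
  measurable_fun setT (fun x : 'rV[R]_n => \prod_i m i (x ord0 i))%R.
Proof.
move=> mm; apply: measurable_fun_prodr => i.
exact: (measurableT_comp (mm i) (@measurable_row_coord R n i)).
Qed.

(** It yields the volumes of boxes, the Gaussian integrals, the null hyperplanes and the
    integrability of the kernel bounds. In dimension 0 the Dirac mass matches the empty product. *)
Lemma ge0_integral_tensor n (m : 'I_n -> R -> R) :
  (forall i, measurable_fun setT (m i : measurableTypeR R -> R)) -> (forall i x, 0 <= m i x)%R ->
  \int[volume n]_x (\prod_i m i (x ord0 i))%:E = \prod_i \int[lebesgue_measure]_x (m i x)%:E.
Proof.
elim: n m => [|n IH] m mm m0.
  rewrite big_ord0 /=; under eq_integral do rewrite big_ord0.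
  by rewrite integral_dirac//= diracE in_setT mul1e.
have mF : measurable_fun setT (fun x : 'rV[R]_n.+1 => (\prod_i m i (x ord0 i))%:E).
  by apply/measurable_EFinP; exact: measurable_tensor.
have P0 k (q : 'I_k -> R -> R) (x : 'rV[R]_k) : (forall i x, 0 <= q i x)%R -> 0 <= (\prod_i q i (x ord0 i))%:E.
  by move=> q0; rewrite lee_fin prodr_ge0.
rewrite (ge0_integral_volumeS mF (fun=> P0 _ _ _ m0)) big_ord_recl -IH//.
transitivity (\int[lebesgue_measure]_a ((m ord0 a)%:E * \int[volume n]_x (\prod_(i < n) m (lift ord0 i) (x ord0 i))%:E)).
  apply: eq_integral => a _.
  rewrite -ge0_integralZl_EFin//; last 2 first.
  - by move=> x _; exact: (P0 n (fun i => m (lift ord0 i))).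
  - by apply/measurable_EFinP; exact: (measurable_tensor (m := fun i => m (lift ord0 i))).
  apply: eq_integral => x _.
  by rewrite -EFinM big_ord_recl row_cons0/=; under eq_bigr do rewrite row_consS.
rewrite ge0_integralZr//.
- exact/measurable_EFinP.
- by move=> x _; rewrite lee_fin.
- by apply: integral_ge0 => x _; exact: (P0 n (fun i => m (lift ord0 i))).
Qed.

Lemma compact_row_bounded n (K : set 'rV[R]_n) : compact K ->
  exists2 M : R, (0 < M)%R & forall x, K x -> forall i, (- M < x ord0 i < M)%R.
Proof.
move=> cK; have /compact_bounded[M [Mr MK]] := cK.
exists (`|M| + 2)%R; first by rewrite ltr_wpDl.
move=> x Kx i.
have : (`|x| <= `|M| + 1)%R.
  by apply: MK => //; rewrite (le_lt_trans (ler_norm M))// ltrDl.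
have : (`|x ord0 i| <= `|x|)%R.
  rewrite [leRHS]/Num.norm /= mx_normrE; apply/bigmax_geP; right => /=.
  by exists (ord0, i).
move=> h1 h2; rewrite -ltr_norml (le_lt_trans (le_trans h1 h2))// ltrD2l.
by rewrite ltr1n.
Qed.

Lemma open_row_box n (U : set 'rV[R]_n) (x : 'rV[R]_n) : open U -> U x ->
  exists2 e : R, (0 < e)%R & forall y : 'rV[R]_n, (forall i, `|x ord0 i - y ord0 i| < e)%R -> U y.
Proof.
move=> oU Ux; have /nbhs_ballP[e /= e0 He] := open_nbhs_nbhs (conj oU Ux).
exists e => // y xy; apply: He; split=> // i j.
by rewrite (ord1 i); exact: xy.
Qed.

Lemma measurable_forall_ord d (T : measurableType d) n (A : 'I_n -> set T) :
  (forall i, measurable (A i)) -> measurable [set x | forall i, A i x].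
Proof.
move=> mA; rewrite [X in measurable X](_ : _ = \bigcap_(i in [set: 'I_n]) A i).
  by apply: fin_bigcap_measurable => //; exact: finite_finset.
by apply/seteqP; split=> x /= h i; [move=> _|]; exact: h.
Qed.

(** The sigma-algebra is generated by the coordinates, so openness has to be linked to it: an open
    set is the union of the rational cubes that it contains, and these are countably many. *)
Lemma open_row_measurable n (U : set 'rV[R]_n) : open U -> measurable U.
Proof.
move=> oU.
pose B (z : 'rV[rat]_n * rat) : set 'rV[R]_n := [set x | forall i, `|ratr (z.1 ord0 i) - x ord0 i| < ratr z.2]%R.
have mB z : measurable (B z).
  apply: measurable_forall_ord => i.
  rewrite [X in measurable X](_ : _ = @row_coord R n i @^-1` (ball (ratr (z.1 ord0 i) : R) (ratr z.2)))//.
  rewrite -[X in measurable X]setTI; apply: measurable_row_coord => //.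
  exact: measurable_ball.
have -> : U = \bigcup_z (if pselect (B z `<=` U) then B z else set0).
  apply/seteqP; split=> [x Ux|x [z _]]; last by case: pselect => // zU; exact: zU.
  have [e e0 He] := open_row_box oU Ux.
  (* With radius q < e / 2 and a rational centre within q of x, every point of the cube is within e
     of x. *)
  have [q qe] : exists q : rat, (ratr q : R) \in `]0%R, (e / 2)%R[.
    by apply: rat_in_itvoo; rewrite divr_gt0.
  move: qe; rewrite in_itv/= => /andP[q0 qe].
  have /choice[z Hz] : forall i, exists q' : rat, (ratr q' : R) \in `](x ord0 i - ratr q)%R, (x ord0 i + ratr q)%R[.
    by move=> i; apply: rat_in_itvoo; lra.
  have zx i : (`|ratr (z i) - x ord0 i| < ratr q)%R.
    by move: (Hz i); rewrite in_itv/= ltr_norml => /andP[h1 h2]; apply/andP; split; lra.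
  exists (\row_i z i, q) => //=; case: pselect => [_ i|BU]; first by rewrite /= mxE.
  exfalso; apply: BU => y By; apply: He => i.
  have := By i; rewrite /= mxE => h; have := zx i; move: h; rewrite !ltr_norml => /andP[? ?] /andP[? ?].
  by apply/andP; split; lra.
apply: countable_bigcupT_measurable => [|z]; first exact: countableP.
case: (pselect _) => _ /=; [exact: mB|exact: measurable0].
Qed.

Lemma continuous_row_measurable n (f : 'rV[R]_n -> R) : continuous f -> measurable_fun setT f.
Proof.
move=> cf; apply: (measurability _ (RGenOpens.measurableE R)) => //.
move=> /= _ [_ [a [b ->]] <-]; rewrite setTI.
apply: open_row_measurable; apply: open_comp => //.
Qed.

Lemma closed_row_measurable n (U : set 'rV[R]_n) : closed U -> measurable U.
Proof. by move=> cU; rewrite -[U]setCK; apply: measurableC; apply: open_row_measurable; exact: closed_openC. Qed.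

Lemma compact_row_measurable n (U : set 'rV[R]_n) : compact U -> measurable U.
Proof. by move=> cU; apply: closed_row_measurable; apply: compact_closed => //; exact: norm_hausdorff. Qed.

Definition box n (a b : 'I_n -> R) : set 'rV[R]_n := [set x | forall i, (a i < x ord0 i < b i)%R].

Lemma measurable_box n (a b : 'I_n -> R) : measurable (box a b).
Proof.
apply: measurable_forall_ord => i.
rewrite [X in measurable X](_ : _ = @row_coord R n i @^-1` `]a i, b i[%classic).
  by rewrite -[X in measurable X]setTI; apply: measurable_row_coord.
by apply/seteqP; split=> x; rewrite /row_coord/= in_itv.
Qed.

Lemma indic_box n (a b : 'I_n -> R) (x : 'rV[R]_n) :
  (\1_(box a b) x = \prod_i \1_(`]a i, b i[%classic : set R) (x ord0 i) :> R)%R.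
Proof.
have [xb|xb] := pselect (box a b x).
  rewrite indicE mem_set// big1// => i _; rewrite indicE mem_set//= in_itv; exact: xb.
rewrite indicE memNset//; move/existsNP : xb => [i xi].
by rewrite (bigD1 i)//= indicE memNset ?mul0r//= in_itv.
Qed.

Lemma volume_box n (a b : 'I_n -> R) : (forall i, a i <= b i)%R ->
  volume n (box a b) = (\prod_i (b i - a i))%:E.
Proof.
move=> ab; rewrite -(setIT (box a b)) -(integral_indic _ measurableT (measurable_box a b)).
under eq_integral do rewrite indic_box.
rewrite (@ge0_integral_tensor n (fun i x => \1_(`]a i, b i[%classic : set R) x))//; last first.
  by move=> i; apply: measurable_indic.
rewrite (big_morph EFin EFinM (erefl _)); apply: eq_bigr => i _.
rewrite integral_indic// setIT.
apply: etrans (lebesgue_measure_itv `](a i), (b i)[) _; rewrite /= lte_fin.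
by case: ltgtP (ab i) => // -> _; rewrite subrr.
Qed.

End volume_basics.

Lemma ge0_quadratic_discr (R : realFieldType) (A B C : R) : 0 <= A ->
  (forall s, 0 <= s ^+ 2 * A + 2 * s * B + C) -> B ^+ 2 <= A * C.
Proof.
move=> A0 q; have [A_eq0|A_neq0] := eqVneq A 0.
  rewrite A_eq0 mul0r; have [->|B0] := eqVneq B 0; first by rewrite expr0n.
  (* For A = 0 and this s the quadratic takes the value -1. *)
  have := q (- (C + 1) / (2 * B)); rewrite A_eq0 mulr0 add0r.
  have -> : 2 * (- (C + 1) / (2 * B)) * B = - (C + 1) by field.
  by move=> h; lra.
have A_gt0 : 0 < A by rewrite lt_def A_neq0.
have := q (- B / A).
have -> : (- B / A) ^+ 2 * A + 2 * (- B / A) * B + C = C - B ^+ 2 / A by field.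
by rewrite subr_ge0 ler_pdivrMr// mulrC.
Qed.

(** * Integrable and square-integrable real functions *)

Section real_integrals.
Context d (T : measurableType d) (R : realType) (mu : {measure set T -> \bar R}).
Implicit Types f g h : T -> R.

Definition igr f := mu.-integrable setT (EFin \o f).

Lemma igr_measurable f : igr f -> measurable_fun setT f.
Proof. by move=> /measurable_int/measurable_EFinP. Qed.

Lemma igrP f : measurable_fun setT f ->
  igr f <-> (\int[mu]_x (`|f x|)%:E < +oo)%E.
Proof.
move=> mf; split=> [/integrableP[]//|foo]; apply/integrableP; split => //.
exact/measurable_EFinP.
Qed.

Lemma eq_igr f g : f =1 g -> igr f -> igr g.
Proof. by move=> /funext ->. Qed.

Lemma igrD f g : igr f -> igr g -> igr (fun x => f x + g x).
Proof. by move=> /integrableD => /[apply]; apply. Qed.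

Lemma igrZ k f : igr f -> igr (fun x => k * f x).
Proof. by move=> /(integrableZl measurableT k). Qed.

Lemma igrN f : igr f -> igr (fun x => - f x).
Proof. by move=> /(igrZ (-1)); apply: eq_igr => x; rewrite mulN1r. Qed.

Lemma igrB f g : igr f -> igr g -> igr (fun x => f x - g x).
Proof. by move=> f_ /igrN; exact: igrD. Qed.

Lemma igr_sum (I : Type) (s : seq I) (P : pred I) (f : I -> T -> R) :
  (forall i, igr (f i)) -> igr (fun x => \sum_(i <- s | P i) f i x).
Proof.
move=> fi; elim: s => [|i s IH].
  apply: (@eq_igr (cst 0)); first by move=> x; rewrite big_nil.
  exact: integrable0.
apply: (@eq_igr (fun x => (if P i then f i x else 0) + \sum_(i <- s | P i) f i x)).
  by move=> x; rewrite big_cons; case: (P i); rewrite ?add0r.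
apply: igrD => //; case: (P i); first exact: fi.
exact: integrable0.
Qed.

Lemma le_igr f g : measurable_fun setT f -> (forall x, `|f x| <= g x) ->
  igr g -> igr f.
Proof.
move=> mf fg ig; apply: le_integrable ig => //; first exact/measurable_EFinP.
by move=> x _ /=; rewrite lee_fin (le_trans (fg x))// ler_norm.
Qed.

Lemma igr_norm f : igr f -> igr (fun x => `|f x|).
Proof. by move=> fi; apply: integrable_norm. Qed.

Lemma igr_ae f g : measurable_fun setT g -> {ae mu, forall x, f x = g x} ->
  igr f -> igr g.
Proof.
move=> mg fg fi; apply/igrP => //.
have mf := igr_measurable fi.
rewrite -(@ge0_ae_eq_integral _ _ _ mu setT (fun x => (`|f x|)%:E)).
- exact/igrP.
- exact: measurableT.
- by apply/measurable_EFinP; exact: measurableT_comp.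
- by apply/measurable_EFinP; exact: measurableT_comp.
- by move=> x _; rewrite lee_fin.
- by move=> x _; rewrite lee_fin.
- by apply: filterS fg => x -> .
Qed.

Lemma Rint_ae f g : measurable_fun setT f -> measurable_fun setT g ->
  {ae mu, forall x, f x = g x} ->
  \int[mu]_x f x = \int[mu]_x g x.
Proof.
move=> mf mg fg; congr fine; apply: ae_eq_integral => //; try exact/measurable_EFinP.
by apply: filterS fg => x ->.
Qed.

Lemma eq_Rint f g : f =1 g -> \int[mu]_x f x = \int[mu]_x g x.
Proof. by move=> /funext ->. Qed.

Lemma RintD f g : igr f -> igr g ->
  \int[mu]_x (f x + g x) = \int[mu]_x f x + \int[mu]_x g x.
Proof. exact: RintegralD. Qed.

Lemma RintB f g : igr f -> igr g ->
  \int[mu]_x (f x - g x) = \int[mu]_x f x - \int[mu]_x g x.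
Proof. exact: RintegralB. Qed.

Lemma RintZ k f : igr f -> \int[mu]_x (k * f x) = k * \int[mu]_x f x.
Proof. exact: RintegralZl. Qed.

Lemma RintN f : igr f -> \int[mu]_x (- f x) = - \int[mu]_x f x.
Proof.
by move=> fi; rewrite -[RHS]mulN1r -RintZ//; apply: eq_Rint => x; rewrite mulN1r.
Qed.

Lemma Rint0 : \int[mu]_x (0 : R) = 0.
Proof. by rewrite /Rintegral integral0. Qed.

Lemma Rint_sum (I : Type) (s : seq I) (P : pred I) (f : I -> T -> R) :
  (forall i, igr (f i)) ->
  \int[mu]_x (\sum_(i <- s | P i) f i x) = \sum_(i <- s | P i) \int[mu]_x f i x.
Proof.
move=> fi; elim: s => [|i s IH].
  by rewrite big_nil -[RHS]Rint0; apply: eq_Rint => x; rewrite big_nil.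
rewrite big_cons -IH; case: ifPn => Pi.
  rewrite -RintD//; last exact: igr_sum.
  by apply: eq_Rint => x; rewrite big_cons Pi.
by apply: eq_Rint => x; rewrite big_cons (negbTE Pi).
Qed.

Lemma Rint_ge0 f : (forall x, 0 <= f x) -> 0 <= \int[mu]_x f x.
Proof. by move=> f0; apply: Rintegral_ge0. Qed.

Lemma le_Rint f g : igr f -> igr g -> (forall x, f x <= g x) ->
  \int[mu]_x f x <= \int[mu]_x g x.
Proof. by move=> fi gi fg; apply: le_Rintegral. Qed.

Lemma le_norm_Rint f g : igr f -> igr g -> (forall x, `|f x| <= g x) ->
  `|\int[mu]_x f x| <= \int[mu]_x g x.
Proof.
move=> fi gi fg; apply: (le_trans (le_normr_Rintegral measurableT fi)).
by apply: le_Rint => //; exact: igr_norm.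
Qed.

Lemma EFin_Rint f : igr f -> (\int[mu]_x f x)%:E = (\int[mu]_x (f x)%:E)%E.
Proof. by move=> fi; rewrite fineK//; apply: integrable_fin_num. Qed.

Lemma ge0_igr f : measurable_fun setT f -> (forall x, 0 <= f x) ->
  (\int[mu]_x (f x)%:E < +oo)%E -> igr f.
Proof.
move=> mf f0 foo; apply/igrP => //.
by under eq_integral do rewrite ger0_norm//.
Qed.

Definition L2 f := measurable_fun setT f /\ (\int[mu]_x ((f x) ^+ 2)%:E < +oo)%E.

Lemma L2_igr f : L2 f -> igr (fun x => f x ^+ 2).
Proof.
move=> [mf foo]; apply: ge0_igr => //; last by move=> x; exact: sqr_ge0.
exact: measurable_funX.
Qed.

Lemma L2P f : measurable_fun setT f -> igr (fun x => f x ^+ 2) -> L2 f.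
Proof.
move=> mf fi; split => //; rewrite -EFin_Rint//; exact: ltry.
Qed.

Lemma L2M f g : L2 f -> L2 g -> igr (fun x => f x * g x).
Proof.
move=> Lf Lg; apply: (@le_igr _ (fun x => f x ^+ 2 + g x ^+ 2)).
- by apply: measurable_funM; [case: Lf|case: Lg].
- move=> x; rewrite normrM -(real_normK (num_real (f x))) -(real_normK (num_real (g x))).
  have := sqr_ge0 (`|f x| - `|g x|); have := mulr_ge0 (normr_ge0 (f x)) (normr_ge0 (g x)).
  by nra.
- by apply: igrD; exact: L2_igr.
Qed.

Lemma L2Z k f : L2 f -> L2 (fun x => k * f x).
Proof.
move=> Lf; apply: L2P; first by apply: measurable_funM => //; case: Lf.
by apply: (eq_igr _ (igrZ (k ^+ 2) (L2_igr Lf))) => x; rewrite exprMn.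
Qed.

Lemma L2D f g : L2 f -> L2 g -> L2 (fun x => f x + g x).
Proof.
move=> Lf Lg; apply: L2P; first by apply: measurable_funD; [case: Lf|case: Lg].
apply: (@eq_igr (fun x => f x ^+ 2 + (2 * (f x * g x) + g x ^+ 2))).
  by move=> x; ring.
apply: igrD; [exact: L2_igr|apply: igrD; [|exact: L2_igr]].
by apply: igrZ; exact: L2M.
Qed.

Lemma L2N f : L2 f -> L2 (fun x => - f x).
Proof.
by move=> /(L2Z (-1)) h; rewrite (_ : (fun _ => _) = (fun x => -1 * f x))//; apply/funext => x; rewrite mulN1r.
Qed.

Lemma L2B f g : L2 f -> L2 g -> L2 (fun x => f x - g x).
Proof. by move=> Lf /L2N; exact: L2D. Qed.

Lemma L2_0 : L2 (fun=> 0).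
Proof.
by apply: L2P => //; apply: (@eq_igr (cst 0)); [move=> x; rewrite expr0n|exact: integrable0].
Qed.

Lemma L2_sum (I : Type) (s : seq I) (P : pred I) (f : I -> T -> R) :
  (forall i, L2 (f i)) -> L2 (fun x => \sum_(i <- s | P i) f i x).
Proof.
move=> fi; elim: s => [|i s IH].
  by rewrite (_ : (fun _ => _) = (fun=> 0)); [exact: L2_0|apply/funext => x; rewrite big_nil].
rewrite (_ : (fun _ => _) = (fun x => (if P i then f i x else 0) + \sum_(i <- s | P i) f i x)).
  by apply: L2D => //; case: (P i); [exact: fi|exact: L2_0].
by apply/funext => x; rewrite big_cons; case: (P i); rewrite ?add0r.
Qed.

Lemma L2_norm f : L2 f -> L2 (fun x => `|f x|).
Proof.
move=> Lf; apply: L2P; first by apply: measurableT_comp => //; case: Lf.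
by apply: (eq_igr _ (L2_igr Lf)) => x; rewrite real_normK// num_real.
Qed.

Lemma le_L2 f g : measurable_fun setT f -> (forall x, `|f x| <= g x) -> L2 g -> L2 f.
Proof.
move=> mf fg Lg; apply: L2P => //; apply: le_igr (L2_igr Lg); first exact: measurable_funX.
by move=> x; rewrite ger0_norm ?sqr_ge0// -(real_normK (num_real (f x))) lerXn2r// nnegrE (le_trans _ (fg x)).
Qed.

Lemma L2_ae f g : measurable_fun setT g -> {ae mu, forall x, f x = g x} -> L2 f -> L2 g.
Proof.
move=> mg fg Lf; apply: L2P => //; apply: igr_ae (L2_igr Lf); first exact: measurable_funX.
by apply: filterS fg => x ->.
Qed.

Definition sqn f := \int[mu]_x (f x) ^+ 2.

Lemma sqn_ge0 f : 0 <= sqn f.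
Proof. by apply: Rint_ge0 => x; exact: sqr_ge0. Qed.

(** Discriminant of the nonnegative quadratic s |-> int (s f + g)^2. *)
Lemma Cauchy_Schwarz_L2 f g : L2 f -> L2 g -> (\int[mu]_x (f x * g x)) ^+ 2 <= sqn f * sqn g.
Proof.
move=> Lf Lg; set B := \int[mu]_x (f x * g x).
apply: ge0_quadratic_discr => [|s]; first exact: sqn_ge0.
have -> : s ^+ 2 * sqn f + 2 * s * B + sqn g = \int[mu]_x (s * f x + g x) ^+ 2.
  rewrite -!RintZ//; [|exact: L2M|exact: L2_igr].
  have i1 : igr (fun x => s ^+ 2 * f x ^+ 2) by apply: igrZ; exact: L2_igr.
  have i2 : igr (fun x => 2 * s * (f x * g x)) by apply: igrZ; exact: L2M.
  rewrite -(RintD i1 i2) -(RintD (igrD i1 i2) (L2_igr Lg)).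
  by apply: eq_Rint => x; ring.
by apply: Rint_ge0 => x; exact: sqr_ge0.
Qed.

Lemma Cauchy_Schwarz_sqrt f g : L2 f -> L2 g ->
  \int[mu]_x (`|f x| * `|g x|) <= Num.sqrt (sqn f) * Num.sqrt (sqn g).
Proof.
move=> Lf Lg.
have := Cauchy_Schwarz_L2 (L2_norm Lf) (L2_norm Lg).
rewrite /sqn (_ : \int[mu]_x `|f x| ^+ 2 = \int[mu]_x f x ^+ 2); last first.
  by apply: eq_Rint => x; rewrite real_normK ?num_real.
rewrite (_ : \int[mu]_x `|g x| ^+ 2 = \int[mu]_x g x ^+ 2); last first.
  by apply: eq_Rint => x; rewrite real_normK ?num_real.
move=> h; rewrite -sqrtrM ?sqn_ge0// -(ler_sqr (x := \int[mu]_x _)) ?nnegrE ?sqrtr_ge0//.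
  by rewrite sqr_sqrtr// mulr_ge0// sqn_ge0.
by apply: Rint_ge0 => x; rewrite mulr_ge0.
Qed.

Lemma norm_Rint_mul f g : L2 f -> L2 g ->
  `|\int[mu]_x (f x * g x)| <= Num.sqrt (sqn f) * Num.sqrt (sqn g).
Proof.
move=> Lf Lg; apply: le_trans (Cauchy_Schwarz_sqrt Lf Lg).
apply: le_norm_Rint; [exact: L2M|exact: (L2M (L2_norm Lf) (L2_norm Lg))|].
by move=> x; rewrite normrM.
Qed.

End real_integrals.

(** * Fubini for real-valued integrals *)

Section real_fubini.
Context d1 d2 (T1 : measurableType d1) (T2 : measurableType d2) (R : realType).
Variables (m1 : {sigma_finite_measure set T1 -> \bar R}) (m2 : {sigma_finite_measure set T2 -> \bar R}).
Implicit Types f : T1 * T2 -> R.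

Definition igr2 f := (m1 \x m2)%E.-integrable setT (EFin \o f).

Lemma igr2_12 f : measurable_fun setT f ->
  (\int[m1]_x \int[m2]_y (`|f (x, y)|)%:E < +oo)%E -> igr2 f.
Proof. by move=> mf h; apply/integrable12ltyP => //; exact/measurable_EFinP. Qed.

Lemma igr2_21 f : measurable_fun setT f ->
  (\int[m2]_y \int[m1]_x (`|f (x, y)|)%:E < +oo)%E -> igr2 f.
Proof. by move=> mf h; apply/integrable21ltyP => //; exact/measurable_EFinP. Qed.

Lemma igr2_prod f (g : T1 -> R) (h : T2 -> R) : measurable_fun setT f ->
  (forall x y, `|f (x, y)| <= g x * h y) -> igr m1 g -> igr m2 h -> igr2 f.
Proof.
move=> mf fgh ig ih; apply: igr2_12 => //.
have mg := igr_measurable ig; have mh := igr_measurable ih.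
apply: (@le_lt_trans _ _ (\int[m1]_x ((`|g x|)%:E * \int[m2]_y (`|h y|)%:E))%E).
  apply: ge0_le_integral => //.
  - by move=> x _; apply: integral_ge0.
  - have := @measurable_fun_fubini_tonelli_F _ _ _ _ R m2 (fun z => (`|f z|)%:E).
    by move=> H; apply: H => // ; apply/measurable_EFinP; exact: measurableT_comp.
  - apply: emeasurable_funM => //.
    by apply/measurable_EFinP; exact: measurableT_comp.
  move=> x _; rewrite -ge0_integralZl//=; last by apply/measurable_EFinP; exact: measurableT_comp.
  apply: ge0_le_integral => //.
  - apply/measurable_EFinP; apply: measurableT_comp => //.
    exact: (measurableT_comp mf (measurable_pair1 x)).
  - apply: emeasurable_funM => //; apply/measurable_EFinP; exact: measurableT_comp.
  - by move=> y _; rewrite -EFinM lee_fin (le_trans (fgh x y))// (le_trans (ler_norm _))// normrM.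
rewrite ge0_integralZr//.
- apply: lte_mul_pinfty; [exact: integral_ge0| |exact/igrP].
  by rewrite ge0_fin_numE ?integral_ge0//; exact/igrP.
- by apply/measurable_EFinP; exact: measurableT_comp.
- by apply: integral_ge0.
Qed.

Lemma igr2_measurable f : igr2 f -> measurable_fun setT f.
Proof. by move=> /measurable_int/measurable_EFinP. Qed.

Lemma ae_igr_12 f : igr2 f -> {ae m1, forall x, igr m2 (fun y => f (x, y))}.
Proof. by move=> fi; exact: (ae_integrable1 fi). Qed.

(** The inner integral in Fubini is extended-real valued and finite only almost everywhere. Applying
    [fine] alters it on a null set, which affects neither integrability nor the integral. *)
Lemma igr_fine d (T : measurableType d) (m : {measure set T -> \bar R}) (F : T -> \bar R) :
  m.-integrable setT F -> igr m (fun x => fine (F x)) /\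
  (\int[m]_x fine (F x) = fine (\int[m]_x F x)%E).
Proof.
move=> Fi; have mF := measurable_int _ Fi.
have mfF : measurable_fun setT (fun x => fine (F x)).
  by apply: (measurableT_comp (fine_measurable measurableT)).
have ae : {ae m, forall x, setT x -> F x = (fine (F x))%:E}.
  have := integrable_ae measurableT Fi.
  by apply: filterS => x h _; rewrite fineK//; exact: h.
split; last first.
  by congr fine; apply: ae_eq_integral => //; [exact/measurable_EFinP|apply: filterS ae => x h _; rewrite h].
apply/igrP => //.
case/integrableP : Fi => _; rewrite (@ge0_ae_eq_integral _ _ _ m setT (fun x => `|F x|%E) (fun x => (`|fine (F x)|)%:E))//.
- exact: measurableT_comp.
- by apply/measurable_EFinP; exact: measurableT_comp.
- by apply: filterS ae => x h _; rewrite h.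
Qed.

Lemma igr_Rint12 f : igr2 f -> igr m1 (fun x => \int[m2]_y f (x, y)).
Proof. by move=> fi; case: (igr_fine (integrable_fubini_F fi)). Qed.

End real_fubini.

Section real_fubini_swap.
Context d1 d2 (T1 : measurableType d1) (T2 : measurableType d2) (R : realType).
Variables (m1 : {sigma_finite_measure set T1 -> \bar R}) (m2 : {sigma_finite_measure set T2 -> \bar R}).
Implicit Types f : T1 * T2 -> R.

Lemma igr2_swap f : igr2 m1 m2 f -> igr2 m2 m1 (fun z => f (z.2, z.1)).
Proof.
move=> fi; have mf := igr2_measurable fi.
apply: igr2_12.
  by apply: (measurableT_comp mf); apply: measurable_fun_pair.
by apply: (integrable21ltyP _ _ _).1 fi; exact/measurable_EFinP.
Qed.

Lemma igr_Rint21 f : igr2 m1 m2 f -> igr m2 (fun y => \int[m1]_x f (x, y)).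
Proof. by move=> /igr2_swap/igr_Rint12. Qed.

Lemma Rint_Fubini f : igr2 m1 m2 f ->
  \int[m1]_x (\int[m2]_y f (x, y)) = \int[m2]_y (\int[m1]_x f (x, y)).
Proof.
move=> fi; apply: etrans (igr_fine (integrable_fubini_F fi)).2 _.
apply: etrans _ (esym (igr_fine (integrable_fubini_F (igr2_swap fi))).2).
by congr fine; exact: (Fubini fi).
Qed.

End real_fubini_swap.

Section real_translation.
Context {R : realType} (n : nat).
Implicit Types (f g : 'rV[R]_n -> R) (x y : 'rV[R]_n).
Local Notation mu := (volume n).

Lemma measurable_translate f y : measurable_fun setT f -> measurable_fun setT (fun x => f (x + y)).
Proof. by move=> mf; exact: (measurableT_comp mf (measurable_fun_rowDr y)). Qed.

Lemma igr_translate f y : igr mu f -> igr mu (fun x => f (x + y)).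
Proof.
move=> fi; have mf := igr_measurable fi.
apply/igrP; first exact: measurable_translate.
rewrite (@ge0_integral_translate _ _ (fun x => (`|f x|)%:E))//; first exact/igrP.
by apply/measurable_EFinP; exact: measurableT_comp.
Qed.

Lemma Rint_translate f y : igr mu f -> \int[mu]_x f (x + y) = \int[mu]_x f x.
Proof.
move=> fi; have mf := igr_measurable fi.
rewrite /Rintegral [in RHS]integralE [in LHS]integralE; congr (fine (_ - _)%E).
  rewrite -(@ge0_integral_translate _ _ ((fun x => (f x)%:E)^\+)%E y)//.
    by apply: eq_integral => x _; rewrite !funeposE.
  by apply: measurable_funepos; exact/measurable_EFinP.
rewrite -(@ge0_integral_translate _ _ ((fun x => (f x)%:E)^\-)%E y)//.
  by apply: eq_integral => x _; rewrite !funenegE.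
by apply: measurable_funeneg; exact/measurable_EFinP.
Qed.

Lemma L2_translate f y : L2 mu f -> L2 mu (fun x => f (x + y)).
Proof.
move=> Lf; apply: L2P; first by apply: measurable_translate; case: Lf.
exact: (igr_translate y (L2_igr Lf)).
Qed.

Lemma sqn_translate f y : L2 mu f -> sqn mu (fun x => f (x + y)) = sqn mu f.
Proof. by move=> Lf; exact: (Rint_translate y (L2_igr Lf)). Qed.

End real_translation.

(** * Directional derivatives *)

Section derive_rules.
Context {R : realType} {V : normedModType R}.
Implicit Types (f g : V -> R) (x v : V).

Lemma is_derive_constant (c : R) x v : is_derive x v (fun=> c : R) 0.
Proof. exact: (@is_derive_cst R V R c x v). Qed.

Lemma is_derive_add f g x v (df dg : R) : is_derive x v f df -> is_derive x v g dg ->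
  is_derive x v (fun y => f y + g y) (df + dg).
Proof. exact: is_deriveD. Qed.

Lemma is_derive_opp f x v (df : R) : is_derive x v f df ->
  is_derive x v (fun y => - f y) (- df).
Proof. exact: is_deriveN. Qed.

Lemma is_derive_mul f g x v (df dg : R) : is_derive x v f df -> is_derive x v g dg ->
  is_derive x v (fun y => f y * g y) (f x * dg + g x * df).
Proof. exact: is_deriveM. Qed.

Lemma is_derive_scale (c : R) f x v (df : R) : is_derive x v f df ->
  is_derive x v (fun y => c * f y) (c * df).
Proof. exact: is_deriveZ. Qed.

Lemma is_derive_idr (x : R) : is_derive x (1 : R) (fun y : R => y) 1.
Proof. exact: is_derive_id. Qed.

Lemma is_derive_comp1 (f g : R -> R) (x df dg : R) :
  is_derive (g x) (1 : R) f df -> is_derive x (1 : R) g dg ->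
  is_derive x (1 : R) (fun y => f (g y)) (dg * df).
Proof. by move=> h k; have := @is_derive1_comp _ f g x _ _ h k; rewrite mulrC. Qed.

Lemma is_derive_along (F : V -> R) x v (t l : R) : is_derive (t *: v + x) v F l ->
  is_derive t (1 : R) (fun t => F (t *: v + x)) l.
Proof.
move=> [d1 d2].
have E : (fun h : R => h^-1 *: (((fun t : R => F (t *: v + x)) \o shift t) (h *: (1 : R)) - F (t *: v + x))) =
         (fun h : R => h^-1 *: ((F \o shift (t *: v + x)) (h *: v) - F (t *: v + x))).
  by apply/funext => h /=; rewrite [h *: 1]mulr1 scalerDl addrA.
by apply: DeriveDef; [rewrite /derivable E|rewrite /derive E].
Qed.

Lemma is_derive1_near (f g : R -> R) (x df : R) : is_derive x (1 : R) f df ->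
  (\forall y \near x, f y = g y) -> is_derive x (1 : R) g df.
Proof. by move=> d fg; apply: near_eq_is_derive d. Qed.

(** Brings a directional derivative down to one variable as soon as the function is explicit along
    the line. *)
Lemma is_derive_line (F : V -> R) (phi : R -> R) x v (a l : R) :
  (forall h : R, F (h *: v + x) = phi (h + a)) -> is_derive a (1 : R) phi l ->
  is_derive x v F l.
Proof.
move=> HF [dphi dl].
have E : (fun h : R => h^-1 *: ((F \o shift x) (h *: v) - F x)) =
         (fun h : R => h^-1 *: ((phi \o shift a) (h *: (1 : R)) - phi a)).
  apply/funext => h /=; rewrite HF [h *: 1]mulr1.
  by have := HF 0; rewrite scale0r !add0r => ->.
by apply: DeriveDef; [rewrite /derivable E|rewrite /derive E].
Qed.

End derive_rules.

(** * Test functions *)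

Section smooth_line.
Context {R : realType}.
Implicit Types f g : R -> R.

(* The witness [S] plays the role of a coinductive definition: it is a class of
   functions closed under differentiation. *)
Definition smooth1 f := exists S : set (R -> R), S f /\
  forall g, S g -> exists2 g', S g' & forall x : R, is_derive x (1 : R) g (g' x).

Lemma smooth1_is_derive f : smooth1 f -> forall x : R, is_derive x (1 : R) f (derive1 f x).
Proof.
move=> [S [Sf HS]] x; have [g' _ /(_ x) h] := HS _ Sf.
by rewrite derive1E derive_val.
Qed.

Lemma smooth1_derive1 f : smooth1 f -> smooth1 (derive1 f).
Proof.
move=> [S [Sf HS]]; exists S; split => //.
have [g' Sg' h] := HS _ Sf.
by rewrite (_ : derive1 f = g')//; apply/funext => x; rewrite derive1E derive_val.
Qed.

Lemma smooth1_continuous f : smooth1 f -> continuous f.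
Proof.
move=> sf x; apply: differentiable_continuous; apply/derivable1_diffP.
by have := smooth1_is_derive sf x; case.
Qed.

(** The finite linear combinations of the family serve as the witness: they are closed under
    differentiation as soon as the derivative of each generator lies in the span. *)
Lemma smooth1_span (I : Type) (E : I -> R -> R) :
  (forall i, exists l : seq (R * I), forall x : R,
     is_derive x (1 : R) (E i) (\sum_(z <- l) z.1 * E z.2 x)) ->
  forall i, smooth1 (E i).
Proof.
move=> HE i.
exists [set g | exists l : seq (R * I), g = fun x => \sum_(z <- l) z.1 * E z.2 x]; split.
  by exists [:: (1, i)]; apply/funext => x; rewrite big_seq1 mul1r.
move=> _ [l ->].
elim: l => [|[c j] l [_ [l' ->] IH]].
  exists (fun=> 0); first by exists [::]; apply/funext => x; rewrite big_nil.
  move=> x; rewrite (_ : (fun _ => _) = cst 0); first exact: is_derive_cst.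
  by apply/funext => y; rewrite big_nil.
have [lj Hj] := HE j.
exists (fun x => c * \sum_(z <- lj) z.1 * E z.2 x + \sum_(z <- l') z.1 * E z.2 x).
  exists ([seq (c * z.1, z.2) | z <- lj] ++ l'); apply/funext => x.
  rewrite big_cat big_map big_distrr/=; congr (_ + _).
  by apply: eq_bigr => z _; rewrite mulrA.
move=> x; rewrite (_ : (fun _ => _) = (c *: E j) \+ (fun x => \sum_(z <- l) z.1 * E z.2 x)); last first.
  by apply/funext => y; rewrite big_cons.
by apply: is_deriveD.
Qed.

(** By Leibniz, the products of a member of one witness with a member of the other span a class
    closed under differentiation. *)
Lemma smooth1M f g : smooth1 f -> smooth1 g -> smooth1 (fun x => f x * g x).
Proof.
move=> [S [Sf HS]] [S' [Sg HS']].
pose I := {z : (R -> R) * (R -> R) | S z.1 /\ S' z.2}.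
pose E (i : I) := fun x => (sval i).1 x * (sval i).2 x.
apply: (@smooth1_span I E _ (exist _ (f, g) (conj Sf Sg))) => -[[h k] [/= Sh Sk]].
have [h' Sh' dh] := HS _ Sh; have [k' Sk' dk] := HS' _ Sk.
exists [:: (1, exist _ (h, k') (conj Sh Sk')); (1, exist _ (h', k) (conj Sh' Sk))] => x.
rewrite big_cons big_seq1 /E /= !mul1r.
rewrite (_ : (fun _ => _) = h \* k)//.
have -> : h x * k' x + h' x * k x = h x *: k' x + k x *: h' x.
  by rewrite /GRing.scale/= [k x * _]mulrC.
exact: is_deriveM.
Qed.

Lemma smooth1_affine f (a b : R) : smooth1 f -> smooth1 (fun x => f (a * x + b)).
Proof.
move=> [S [Sf HS]].
pose E (g : {g | S g}) x := sval g (a * x + b).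
apply: (@smooth1_span _ E _ (exist _ f Sf)) => -[g Sg].
have [g' Sg' dg] := HS _ Sg.
exists [:: (a, exist _ g' Sg')] => x; rewrite big_seq1/= /E/=.
rewrite (_ : (fun x => _) = g \o (fun x => a * x + b))//.
have da : is_derive x (1 : R) (fun x => a * x + b) a.
  have := is_derive_add (is_derive_scale a (is_derive_idr x)) (is_derive_constant b x 1).
  by rewrite addr0 mulr1.
exact: (is_derive_comp1 (dg _) da).
Qed.

Lemma smooth1D f g : smooth1 f -> smooth1 g -> smooth1 (fun x => f x + g x).
Proof.
move=> [S [Sf HS]] [S' [Sg HS']].
exists [set h | exists f g, [/\ S f, S' g & h = fun x => f x + g x]].
split; first by exists f, g.
move=> _ [h [k [Sh Sk ->]]].
have [h' Sh' dh] := HS _ Sh; have [k' Sk' dk] := HS' _ Sk.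
exists (fun x => h' x + k' x); first by exists h', k'.
by move=> x; apply: is_deriveD.
Qed.

Lemma smooth1N f : smooth1 f -> smooth1 (fun x => - f x).
Proof.
move=> [S [Sf HS]].
exists [set h | exists2 f, S f & h = fun x => - f x]; split; first by exists f.
move=> _ [h Sh ->]; have [h' Sh' dh] := HS _ Sh.
exists (fun x => - h' x); first by exists h'.
by move=> x; apply: is_deriveN.
Qed.

(** x^(-n) e^(-1/x) continued by 0. All powers are kept together because differentiating one of
    these functions produces the powers n + 1 and n + 2. *)
Definition expinv (n : nat) (x : R) := if 0 < x then x ^- n * expR (- x^-1) else 0.

Lemma exprn_le_expR (n : nat) (y : R) : 0 <= y -> y ^+ n <= n`!%:R * expR y.
Proof.
move=> y0; case: n => [|n]; first by rewrite expr0 mul1r (le_trans _ (expR_ge1Dx _))// lerDl.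
rewrite mulrC -ler_pdivrMr ?ltr0n ?fact_gt0//.
by apply: le_trans (expR_ge1Dxn n y0); rewrite lerDr.
Qed.

(** Handles the junction point 0 of [expinv], where no formula is available on both sides. *)
Lemma is_derive_quadratic f (C : R) : f 0 = 0 ->
  (forall h, 0 < `|h| -> `|h| < 1 -> `|f h| <= C * h ^+ 2) -> is_derive (0 : R) (1 : R) f 0.
Proof.
move=> f0 H.
have lim : h^-1 *: ((f \o shift 0) (h *: 1) - f 0) @[h --> (0 : R)^'] --> (0 : R).
  apply/cvgrPdist_le => /= e e0; near=> h.
  have h0 : 0 < `|h| by rewrite normr_gt0; near: h; exact: nbhs_dnbhs_neq.
  rewrite sub0r normrN f0 subr0 /= addr0 [h *: 1]mulr1 normrZ normfV.
  rewrite -[X in _ * X]/(`|f h|).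
  apply: (@le_trans _ _ (`|h|^-1 * (`|C| * `|h| ^+ 2))).
    rewrite ler_wpM2l ?invr_ge0// (le_trans (H h h0 _))//.
      near: h; apply: dnbhs0_lt; exact: ltr01.
    rewrite real_normK ?num_real// ler_wpM2r ?sqr_ge0// ler_norm.
    by [].
  rewrite mulrCA expr2 mulKf; last by rewrite gt_eqF.
  have : `|h| <= e / (`|C| + 1).
    by near: h; apply: dnbhs0_le; rewrite divr_gt0// ltr_wpDl.
  rewrite ler_pdivlMr ?ltr_wpDl// => /(le_trans _); apply.
  by rewrite mulrC ler_wpM2l// lerDl.
apply: DeriveDef; last exact: cvg_lim.
by apply/cvg_ex; exists 0.
Unshelve. all: by end_near. Qed.

(** With y = 1/x the inequality y^(n+2) <= (n+2)! e^y leaves two powers of x to spare. *)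
Lemma expinv_le (n : nat) (x : R) : `|expinv n x| <= n.+2`!%:R * x ^+ 2.
Proof.
rewrite /expinv; case: ifPn => x0; last by rewrite normr0 mulr_ge0// sqr_ge0.
have xV0 : 0 < x^-1 by rewrite invr_gt0.
have xV := ltW xV0.
rewrite ger0_norm; last by rewrite mulr_ge0 ?expR_ge0// invr_ge0 exprn_ge0// ltW.
have h : x^-1 ^+ n.+2 * expR (- x^-1) <= n.+2`!%:R.
  by rewrite expRN ler_pdivrMr ?expR_gt0//; exact: exprn_le_expR.
rewrite -(ler_pM2r (exprn_gt0 2 xV0)) -[leRHS]mulrA -exprMn divff ?gt_eqF// expr1n mulr1.
by apply: le_trans h; rewrite mulrAC -exprVn -exprD addn2.
Qed.

Lemma is_derive_invr (x : R) : x != 0 -> is_derive x (1 : R) (fun y : R => y^-1) (- x ^- 2).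
Proof.
move=> x0; have dI := @derivable_id R R x 1.
apply: DeriveDef; first exact: (@derivableV R R id x 1 x0 dI).
by rewrite (@deriveV R R id x 1 x0 dI) derive_id /GRing.scale/= mulr1.
Qed.

Lemma expinv_smooth n : smooth1 (expinv n).
Proof.
apply: smooth1_span => {}n.
(* The derivative of x^(-n) e^(-1/x) is -n x^(-n-1) e^(-1/x) + x^(-n-2) e^(-1/x). *)
exists [:: (- n%:R, n.+1); (1, n.+2)] => x; rewrite big_cons big_seq1 /= mul1r.
have [x0|x0|->] := ltrgt0P x.
- have xn0 : x != 0 by rewrite gt_eqF.
  have di := is_derive_invr xn0.
  have dN : is_derive x (1 : R) (fun y : R => - y^-1) (x ^- 2).
    by have := is_derive_opp di; rewrite opprK.
  have := is_derive_mul (is_deriveX n di) (is_derive_comp1 (is_derive_expR _) dN).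
  set l := (X in is_derive x 1 _ X) => dl.
  have -> : - n%:R * expinv n.+1 x + expinv n.+2 x = l.
    rewrite /l /expinv x0 exprfctE /GRing.scale/= !exprVn.
    rewrite -!exprVn; move: (x^-1) (expR _) => y e.
    by case: (n) => [|k]; rewrite /= ?expr0 !exprS; ring.
  apply: (is_derive1_near dl).
  near=> y; rewrite /expinv.
  have y0 : 0 < y by near: y; exact: lt_nbhsr.
  by rewrite y0 -exprVn exprfctE.
- have -> : - n%:R * expinv n.+1 x + expinv n.+2 x = 0.
    by rewrite /expinv !ifN ?mulr0 ?addr0// -leNgt ltW.
  apply: (is_derive1_near (is_derive_constant 0 x 1)).
  near=> y; rewrite /expinv.
  have y0 : y < 0 by near: y; exact: lt_nbhsl.
  by rewrite ltNge (ltW y0).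
- have -> : - n%:R * expinv n.+1 0 + expinv n.+2 0 = 0 by rewrite /expinv ltxx mulr0 addr0.
  apply: (@is_derive_quadratic _ (n.+2`!%:R)); first by rewrite /expinv ltxx.
  by move=> h _ _; exact: expinv_le.
Unshelve. all: by end_near. Qed.

(** The steepness k makes these bumps converge to the indicator of the open interval ]a, b[. *)
Definition bump1 (a b k x : R) := expinv 0 (k * (x - a)) * expinv 0 (k * (b - x)).

Lemma bump1_smooth a b k : smooth1 (bump1 a b k).
Proof.
apply: smooth1M.
  have := smooth1_affine k (- k * a) (expinv_smooth 0).
  rewrite (_ : (fun x => _) = (fun x => expinv 0 (k * (x - a))))//.
  by apply/funext => x; congr expinv; ring.
have := smooth1_affine (- k) (k * b) (expinv_smooth 0).
rewrite (_ : (fun x => _) = (fun x => expinv 0 (k * (b - x))))//.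
by apply/funext => x; congr expinv; ring.
Qed.

Lemma expinv0_ge0 x : 0 <= expinv 0 x.
Proof. by rewrite /expinv; case: ifP => // _; rewrite expr0 invr1 mul1r expR_ge0. Qed.

Lemma expinv0_le1 x : expinv 0 x <= 1.
Proof.
rewrite /expinv; case: ifP => // x0; rewrite expr0 invr1 mul1r -expR0 ler_expR.
by rewrite oppr_le0 invr_ge0 ltW.
Qed.

Lemma bump1_ge0 a b k x : 0 <= bump1 a b k x.
Proof. by rewrite mulr_ge0// expinv0_ge0. Qed.

Lemma bump1_le1 a b k x : bump1 a b k x <= 1.
Proof. by rewrite mulr_ile1// ?expinv0_ge0 ?expinv0_le1. Qed.

Lemma bump1_gt0 a b k x : 0 < k -> a < x < b -> 0 < bump1 a b k x.
Proof.
move=> k0 /andP[ax xb]; rewrite /bump1 /expinv !(pmulr_rgt0 _ k0) !subr_gt0 ax xb.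
by rewrite expr0 invr1 !mul1r ?mulr_gt0 ?expR_gt0.
Qed.

Lemma bump1_out a b k x : 0 < k -> ~~ (a < x < b) -> bump1 a b k x = 0.
Proof.
move=> k0; rewrite negb_and -!leNgt /bump1 /expinv !pmulr_rgt0// !subr_gt0 => /orP[h|h].
  by rewrite (ltNge a) h /= mul0r.
by rewrite [x < b]ltNge h /= mulr0.
Qed.

Lemma expinv0_cvg (x : R) : 0 < x -> expinv 0 (k.+1%:R * x) @[k --> \oo] --> (1 : R).
Proof.
move=> x0.
rewrite (_ : (fun k => _) = (fun k : nat => expR (- (k.+1%:R^-1 * x^-1)))); last first.
  by apply/funext => k; rewrite /expinv mulr_gt0// expr0 invr1 mul1r invfM.
rewrite (_ : nbhs (1 : R) = nbhs (expR (- 0) : R)); last by rewrite oppr0 expR0.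
apply: continuous_cvg; first exact: continuous_expR.
apply: cvgN; rewrite -[X in _ --> X](mul0r x^-1); apply: cvgM; last exact: cvg_cst.
exact: cvg_harmonic.
Qed.

Lemma bump1_cvg a b x : bump1 a b k.+1%:R x @[k --> \oo] --> (\1_(`]a, b[%classic : set R) x : R).
Proof.
have [xab|xab] := boolP (a < x < b).
  rewrite indicE mem_set/= ?in_itv//.
  move/andP : xab => [ax xb].
  rewrite -[X in _ --> X]mulr1; apply: cvgM; apply: expinv0_cvg; by rewrite subr_gt0.
rewrite indicE memNset/= ?in_itv//; last exact/negP.
apply: cvg_near_cst; near=> k; exact: bump1_out.
Unshelve. all: by end_near. Qed.

Definition test1 f := smooth1 f /\ exists M, forall x, M <= `|x| -> f x = 0.

Lemma test1_bump a b k : 0 < k -> test1 (bump1 a b k).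
Proof.
move=> k0; split; first exact: bump1_smooth.
exists (`|a| + `|b|) => x abx; apply: bump1_out => //; apply/negP => /andP[ax xb].
have := ler_norm b; have := ler_norm (- a); have := normr_ge0 a; have := normr_ge0 b; rewrite normrN.
by move: abx; case: (ger0P x) => _ ? ? ? ? ?; lra.
Qed.

End smooth_line.

Section tensor_functions.
Context {R : realType} {n : nat}.
Local Notation E := 'rV[R]_n.
Local Notation mu := (volume n).
Implicit Types (psi : 'I_n -> R -> R) (j : 'I_n).

Definition tens psi (x : E) := \prod_i psi i (x ord0 i).

(** Differentiation and primitives along axis j change only the j-th factor of a product
    function. *)
Definition upd psi j (g : R -> R) : 'I_n -> R -> R := fun i => if i == j then g else psi i.

Lemma upd_id psi j : upd psi j (psi j) = psi.
Proof. by apply/funext => i; rewrite /upd; case: eqP => [->|]. Qed.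

Lemma tens_upd psi j g (x : E) : tens (upd psi j g) x = g (x ord0 j) * \prod_(i | i != j) psi i (x ord0 i).
Proof.
rewrite /tens (bigD1 j)//= /upd eqxx; congr (_ * _).
by apply: eq_bigr => i /negbTE ->.
Qed.

Lemma tensE psi j (x : E) : tens psi x = psi j (x ord0 j) * \prod_(i | i != j) psi i (x ord0 i).
Proof. by rewrite -{1}(upd_id psi j) tens_upd. Qed.

Lemma base_vecE j (h : R) (x : E) i : (h *: base_vec j + x) ord0 i = h * (i == j)%:R + x ord0 i.
Proof. by rewrite !mxE eqxx /= eq_sym. Qed.

Lemma is_derive_tens psi j (x : E) (l : R) : is_derive (x ord0 j) (1 : R) (psi j) l ->
  is_derive x (base_vec j) (tens psi) (l * \prod_(i | i != j) psi i (x ord0 i)).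
Proof.
move=> dl; set C := \prod_(i | _) _.
apply: (@is_derive_line _ _ _ (fun t => C * psi j t) _ _ (x ord0 j)).
  move=> h; rewrite (tensE _ j) base_vecE eqxx mulr1 mulrC; congr (_ * _).
  by apply: eq_bigr => i /negbTE ij; rewrite base_vecE ij mulr0 add0r.
by rewrite mulrC; exact: is_derive_scale.
Qed.

Lemma coord_cont i : continuous (fun x : E => x ord0 i).
Proof. exact: coord_continuous. Qed.

Lemma continuous_prodr (I : Type) (T : topologicalType) (s : seq I) (P : pred I) (f : I -> T -> R) :
  (forall i, continuous (f i)) -> continuous (fun x => \prod_(i <- s | P i) f i x).
Proof.
move=> cf x; elim: s => [|i s IH].
  by under eq_fun do rewrite big_nil; exact: cvg_cst.
under eq_fun do rewrite big_cons.
by case: (P i) => //; apply: cvgM => //; exact: cf.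
Qed.

Lemma continuous_tens psi : (forall i, continuous (psi i)) -> continuous (tens psi).
Proof.
move=> cpsi; apply: continuous_prodr => i x.
by apply: continuous_comp; [exact: coord_cont|exact: cpsi].
Qed.

Lemma pderiv_is_derive (f : E -> R) j (x : E) (l : R) : is_derive x (base_vec j) f l -> pderiv j f x = l.
Proof. by case. Qed.

(** Coinduction principle for smoothness: membership in a class of continuous functions stable under
    all partial derivatives. *)
Lemma smooth_coind (S : set (E -> R)) f : S f ->
  (forall g, S g -> continuous g /\ forall j, S (pderiv j g) /\ forall x, derivable g x (base_vec j)) ->
  smooth f.
Proof.
move=> Sf HS s.
have Ss : S (foldr pderiv f s).
  by elim: s => [//|j s IH] /=; have [_ /(_ j)[]] := HS _ IH.
by have [c h] := HS _ Ss; split => // j x; have [] := h j.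
Qed.

Lemma pderiv_tens psi j : (forall i, smooth1 (psi i)) ->
  pderiv j (tens psi) = tens (upd psi j (derive1 (psi j))).
Proof.
move=> spsi; apply/funext => x; rewrite tens_upd; apply: pderiv_is_derive.
apply: is_derive_tens; exact: smooth1_is_derive.
Qed.

Lemma smooth1_upd psi j g : (forall i, smooth1 (psi i)) -> smooth1 g -> forall i, smooth1 (upd psi j g i).
Proof. by move=> spsi sg i; rewrite /upd; case: ifP. Qed.

Lemma test1_upd psi j g : (forall i, test1 (psi i)) -> test1 g -> forall i, test1 (upd psi j g i).
Proof. by move=> spsi sg i; rewrite /upd; case: ifP. Qed.

Lemma tens_is_derive psi j (x : E) : (forall i, smooth1 (psi i)) ->
  is_derive x (base_vec j) (tens psi) (tens (upd psi j (derive1 (psi j))) x).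
Proof.
move=> spsi; rewrite tens_upd; apply: is_derive_tens; exact: smooth1_is_derive.
Qed.

Lemma smooth_tens psi : (forall i, smooth1 (psi i)) -> smooth (tens psi).
Proof.
move=> spsi; apply: (@smooth_coind [set g | exists2 psi : 'I_n -> R -> R, forall i, smooth1 (psi i) & g = tens psi]).
  by exists psi.
move=> _ [{}psi {}spsi ->]; split.
  by apply: continuous_tens => i; exact: smooth1_continuous.
move=> j; split; last by move=> x; have [] := tens_is_derive j x spsi.
exists (upd psi j (derive1 (psi j))); last exact: pderiv_tens.
by apply: smooth1_upd => //; exact: smooth1_derive1.
Qed.

Definition rtest (f : E -> R) := smooth f /\ compact (closure [set x | f x != 0]).

Lemma compact_support (f : E -> R) (M : R) : (forall (x : E) i, M <= `|x ord0 i| -> f x = 0) ->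
  compact (closure [set x | f x != 0]).
Proof.
move=> fM; apply: bounded_closed_compact; last exact: closed_closure.
pose K : set E := [set x | forall i, x ord0 i \in `[(- M), M]].
have cK : compact K.
  by apply: (@rV_compact _ _ (fun=> `[(- M), M]%classic)) => i; exact: segment_compact.
have [r [rr rK]] := compact_bounded cK.
exists r; split => // s rs x cx; apply: (rK s rs).
have clK : closed K by apply: compact_closed => //; exact: norm_hausdorff.
apply: clK; apply: closure_subset cx => z /= fz i.
rewrite in_itv/= -ler_norml leNgt; apply: contra fz => h.
by rewrite (fM _ i)// ltW.
Qed.

Lemma test1_bounded (f : R -> R) : test1 f -> exists2 M : R, 0 < M & (forall x, M <= `|x| -> f x = 0) /\ forall x, `|f x| <= M.
Proof.
move=> [/smooth1_continuous cf [M fM]].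
have cfn : {within `[- `|M|, `|M|], continuous (fun x => `|f x|)}.
  apply: continuous_subspaceT => x; apply: continuous_comp; [exact: cf|exact: norm_continuous].
have [c _ Hc] := @EVT_max _ _ (- `|M|) `|M| ltac:(rewrite ge0_cp//) cfn.
exists (`|M| + `|f c| + 1); first by rewrite ltr_wpDl// addr_ge0.
have h x : `|M| <= `|x| -> f x = 0 by move=> hx; apply: fM; rewrite (le_trans (ler_norm _)).
split=> x.
  move=> hx; apply: h; apply: le_trans hx; rewrite -addrA lerDl addr_ge0//.
have [hx|hx] := leP `|M| `|x|; first by rewrite h// normr0 !addr_ge0.
apply: le_trans (Hc x _) _; first by rewrite in_itv/= -ler_norml ltW.
by rewrite addrAC lerDr addr_ge0.
Qed.

Lemma tens_out psi : (forall i, test1 (psi i)) ->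
  exists M : R, forall (x : E) i, M <= `|x ord0 i| -> tens psi x = 0.
Proof.
move=> tpsi; have /choice[M HM] : forall i, exists M : R, forall x, M <= `|x| -> psi i x = 0.
  by move=> i; case: (tpsi i).
exists (\sum_i `|M i|) => x i hx; rewrite (tensE _ i) HM ?mul0r//.
apply: le_trans hx; rewrite (bigD1 i)//= (le_trans (ler_norm _))// lerDl.
by apply: sumr_ge0.
Qed.

Lemma rtest_tens psi : (forall i, test1 (psi i)) -> rtest (tens psi).
Proof.
move=> tpsi; split; first by apply: smooth_tens => i; case: (tpsi i).
by have [M HM] := tens_out tpsi; exact: compact_support HM.
Qed.

Lemma measurable_tens psi : (forall i, smooth1 (psi i)) -> measurable_fun setT (tens psi).
Proof.
move=> spsi; apply: continuous_row_measurable; apply: continuous_tens => i.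
exact: smooth1_continuous.
Qed.

End tensor_functions.

Section test_functions.
Context {R : realType} {n : nat}.
Local Notation E := 'rV[R]_n.
Local Notation mu := (volume n).
Implicit Types (f g phi : E -> R) (j : 'I_n).

(** [foldr] applies the last index of the sequence first, so a derivative taken beforehand is
    appended at the end. *)
Lemma smooth_pderiv f j : smooth f -> smooth (pderiv j f).
Proof. by move=> sf s; have := sf (rcons s j); rewrite foldr_rcons. Qed.

Lemma smooth_continuous f : smooth f -> continuous f.
Proof. by move=> /(_ [::])[]. Qed.

Lemma smooth_is_derive f (x : E) j : smooth f -> is_derive x (base_vec j) f (pderiv j f x).
Proof. by move=> /(_ [::])[_ h]; apply: DeriveDef. Qed.

Lemma rtest_bounded_support f : rtest f -> exists M : R, forall (x : E) i, M <= `|x ord0 i| -> f x = 0.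
Proof.
move=> [_ /compact_row_bounded[M M0 HM]]; exists M => x i; apply: contraTeq => fx.
rewrite -ltNge ltr_norml; apply: HM; exact: subset_closure.
Qed.

(** The margin 1 keeps a whole neighbourhood of x on the line inside the region where f vanishes. *)
Lemma pderiv_support f j (M : R) : smooth f -> (forall (x : E) i, M <= `|x ord0 i| -> f x = 0) ->
  forall (x : E) i, M + 1 <= `|x ord0 i| -> pderiv j f x = 0.
Proof.
move=> sf fM x i Mx; apply: pderiv_is_derive.
apply: (@is_derive_line _ _ _ (fun t => f (t *: base_vec j + x)) _ _ 0).
  by move=> h; rewrite addr0.
apply: (is_derive1_near (@is_derive_constant R R 0 (0 : R) (1 : R))).
near=> t; rewrite (fM _ i)// base_vecE.
have t1 : `|0 - t| < 1 by near: t; apply: cvgr_dist_lt => //; exact: cvg_id.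
have : `|x ord0 i| - `|t| <= `|t * (i == j)%:R + x ord0 i|.
  have : `|t * (i == j)%:R| <= `|t| by case: (i == j); rewrite ?mulr1 ?mulr0 ?normr0.
  move: (t * _) (x ord0 i) => a b h; have := ler_normB (a + b) a.
  by rewrite [a + b - a]addrAC subrr add0r; lra.
by move: t1; rewrite sub0r normrN; lra.
Unshelve. all: by end_near. Qed.

Lemma rtest_bounded f : rtest f -> exists M : R, forall x, `|f x| <= M.
Proof.
move=> tf; have [M HM] := rtest_bounded_support tf.
case: tf => /smooth_continuous cf _.
have cK : compact [set x : E | forall i, x ord0 i \in `[(- M), M]].
  by apply: (@rV_compact _ _ (fun=> `[(- M), M]%classic)) => i; exact: segment_compact.
have /compact_bounded[r [rr Hr]] : compact (f @` [set x : E | forall i, x ord0 i \in `[(- M), M]]).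
  by apply: continuous_compact => //; exact: continuous_subspaceT.
exists (`|r| + 1) => x.
have [xK|/existsNP[i xi]] := pselect (forall i, x ord0 i \in `[(- M), M]).
  by apply: (Hr (`|r| + 1)) => //=; [rewrite (le_lt_trans (ler_norm _))// ltrDl|exists x].
rewrite (HM _ i) ?normr0 ?addr_ge0//.
by rewrite leNgt; apply/negP => h; apply: xi; rewrite in_itv/= -ler_norml ltW.
Qed.

Lemma rtest_pderiv f j : rtest f -> rtest (pderiv j f).
Proof.
move=> tf; have [M HM] := rtest_bounded_support tf; case: tf => sf _.
split; first exact: smooth_pderiv.
by apply: (@compact_support _ _ _ (M + 1)); exact: pderiv_support HM.
Qed.

End test_functions.

Section measurable_Rint.
Context d1 d2 (T1 : measurableType d1) (T2 : measurableType d2) (R : realType).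
Variable m2 : {sigma_finite_measure set T2 -> \bar R}.

Lemma measurable_Rint12 (f : T1 * T2 -> R) : measurable_fun setT f ->
  measurable_fun setT (fun x => \int[m2]_y f (x, y)).
Proof.
move=> mf; apply: (measurableT_comp (fine_measurable measurableT)).
have mE : measurable_fun setT (EFin \o f) by exact/measurable_EFinP.
rewrite (_ : (fun x => _) = (fun x => \int[m2]_y ((EFin \o f)^\+ (x, y)))%E \- (fun x => \int[m2]_y ((EFin \o f)^\- (x, y)))%E)%E.
  apply: emeasurable_funB.
    have := @measurable_fun_fubini_tonelli_F _ _ T1 T2 R m2 ((EFin \o f)^\+)%E.
    by apply => //; exact: measurable_funepos.
  have := @measurable_fun_fubini_tonelli_F _ _ T1 T2 R m2 ((EFin \o f)^\-)%E.
  by apply => //; exact: measurable_funeneg.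
apply/funext => x; rewrite integralE; congr (_ - _)%E.
  by apply: eq_integral => y _; rewrite !funeposE.
by apply: eq_integral => y _; rewrite !funenegE.
Qed.

End measurable_Rint.

(** * Weighted averages of translates *)

Section averaging.
Context {R : realType} {n : nat} d2 (T2 : measurableType d2).
Variable m2 : {sigma_finite_measure set T2 -> \bar R}.
Variables (tau : T2 -> 'rV[R]_n) (phi : T2 -> R).
Hypotheses (mtau : measurable_fun setT tau) (iphi : igr m2 phi).
Local Notation E := 'rV[R]_n.
Local Notation mu := (volume n).
Implicit Types f g h : E -> R.

Let mphi : measurable_fun setT phi := igr_measurable iphi.

(** One construction for two purposes: with a real parameter it integrates along a segment ([seg]),
    with a vector parameter it regularises ([mollify]). *)
Definition avg h (x : E) := \int[m2]_y (phi y * h (x + tau y)).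

Lemma measurable_shift_tau h : measurable_fun setT h ->
  measurable_fun setT (fun z : E * T2 => h (z.1 + tau z.2)).
Proof.
move=> mh; apply: (measurableT_comp mh).
have m : measurable_fun setT (fun z : E * T2 => (z.1, tau z.2)).
  by apply: measurable_fun_pair => //; exact: measurableT_comp.
exact: (measurableT_comp (@measurable_fun_rowD R n) m).
Qed.

Lemma measurable_avg_integrand h : measurable_fun setT h ->
  measurable_fun setT (fun z : E * T2 => phi z.2 * h (z.1 + tau z.2)).
Proof.
move=> mh; apply: measurable_funM; last exact: measurable_shift_tau.
exact: measurableT_comp.
Qed.

Lemma measurable_avg h : measurable_fun setT h -> measurable_fun setT (avg h).
Proof. by move=> mh; exact: (measurable_Rint12 m2 (measurable_avg_integrand mh)). Qed.

(** Integrating in x first, translation invariance turns the double integral into the product of the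
    L^1 norms of phi and h. *)
Lemma igr2_avg h : igr mu h -> igr2 mu m2 (fun z => phi z.2 * h (z.1 + tau z.2)).
Proof.
move=> ih; have mh := igr_measurable ih.
apply: igr2_21; first exact: measurable_avg_integrand.
have K y : (\int[mu]_x (`|phi y * h (x + tau y)|)%:E = (`|phi y|)%:E * \int[mu]_x (`|h x|)%:E)%E.
  rewrite -(@ge0_integral_translate _ _ (fun x => (`|h x|)%:E) (tau y))//; last first.
    by apply/measurable_EFinP; exact: measurableT_comp.
  rewrite -ge0_integralZl//; last first.
    apply/measurable_EFinP; apply: measurableT_comp => //; exact: measurable_translate.
  by apply: eq_integral => x _; rewrite normrM EFinM.
under eq_integral do rewrite K.
rewrite ge0_integralZr//; last 2 first.
- by apply/measurable_EFinP; exact: measurableT_comp.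
- exact: integral_ge0.
apply: lte_mul_pinfty; [exact: integral_ge0| |exact/igrP].
by rewrite ge0_fin_numE ?integral_ge0//; exact/igrP.
Qed.

(** |phi g h| <= |phi| g^2 + |phi| h^2, and both terms are integrable on the product space. *)
Lemma igr2_avg_mul g h : L2 mu g -> L2 mu h ->
  igr2 mu m2 (fun z => g z.1 * (phi z.2 * h (z.1 + tau z.2))).
Proof.
move=> Lg Lh; have [mg _] := Lg; have [mh _] := Lh.
have m : measurable_fun setT (fun z : E * T2 => g z.1 * (phi z.2 * h (z.1 + tau z.2))).
  by apply: measurable_funM; [exact: measurableT_comp|exact: measurable_avg_integrand].
have i1 : igr2 mu m2 (fun z => phi z.2 * g z.1 ^+ 2).
  apply: igr2_prod (igr_norm (L2_igr Lg)) (igr_norm iphi).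
    apply: measurable_funM; first exact: measurableT_comp.
    by apply: measurable_funX; exact: measurableT_comp.
  by move=> x y /=; rewrite normrM mulrC.
have i2 := igr2_avg (L2_igr Lh).
apply: (le_igr m _ (igrD (igr_norm i1) (igr_norm i2))) => z /=.
move: (g _) (h _) (phi _) => a b c.
rewrite mulrCA [leLHS]normrM [X in _ <= X + _]normrM [X in _ <= _ + X]normrM -mulrDr ler_wpM2l// !normrX normrM.
have := sqr_ge0 (`|a| - `|b|); have := mulr_ge0 (normr_ge0 a) (normr_ge0 b); nra.
Qed.

Lemma ae_igr_avg h : L2 mu h ->
  {ae mu, forall x, igr m2 (fun y => phi y * h (x + tau y) ^+ 2)}.
Proof. by move=> Lh; exact: (ae_igr_12 (igr2_avg (L2_igr Lh))). Qed.

Lemma ae_igr_avg1 h : L2 mu h ->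
  {ae mu, forall x, igr m2 (fun y => phi y * h (x + tau y))}.
Proof.
move=> Lh; have [mh _] := Lh; have := ae_igr_avg Lh; apply: filterS => x ix.
have mhx : measurable_fun setT (fun y => h (x + tau y)).
  exact: (measurableT_comp (measurable_shift_tau mh) (measurable_pair1 x)).
apply: (le_igr _ _ (igrD (igr_norm iphi) (igr_norm ix))); first exact: measurable_funM.
move=> y; move: (h _) (phi _) => a c; rewrite !normrM.
rewrite -[X in _ <= X + _]mulr1 -mulrDr ler_wpM2l//.
have := sqr_ge0 (`|a| - 1); have := normr_ge0 a; nra.
Qed.

(** Young's inequality for averages: a pointwise Cauchy-Schwarz with weight |phi|, integrated with
    the help of translation invariance. *)
Lemma L2_avg h : L2 mu h -> L2 mu (avg h) /\ sqn mu (avg h) <= (\int[m2]_y `|phi y|) ^+ 2 * sqn mu h.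
Proof.
move=> Lh; have [mh _] := Lh; have Ih := L2_igr Lh.
set C := \int[m2]_y `|phi y|.
have ma := measurable_avg mh.
have C0 : 0 <= C by apply: Rint_ge0.
pose H x := \int[m2]_y (`|phi y| * h (x + tau y) ^+ 2).
have i2 : igr2 mu m2 (fun z => `|phi z.2| * h (z.1 + tau z.2) ^+ 2).
  apply: eq_igr (igr_norm (igr2_avg Ih)) => z.
  by rewrite normrM [X in _ * X]ger0_norm// sqr_ge0.
have iH : igr mu H by exact: (igr_Rint12 i2).
have IH : \int[mu]_x H x = C * sqn mu h.
  rewrite (Rint_Fubini i2) /= /C -[RHS]mulrC -RintZ; last exact: igr_norm.
  apply: eq_Rint => y; rewrite RintZ; last exact: (igr_translate (tau y) Ih).
  by rewrite mulrC; congr (_ * _); exact: (Rint_translate (tau y) Ih).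
(* Cauchy-Schwarz for the measure |phi|: the quadratic int |phi| s^2 + 2 s phi h + |phi| h^2 is
   nonnegative. *)
have key : {ae mu, forall x, avg h x ^+ 2 <= C * H x}.
  have := ae_igr_avg Lh; have := ae_igr_avg1 Lh; apply: filterS2 => x i1x ix.
  have i2x : igr m2 (fun y => `|phi y| * h (x + tau y) ^+ 2).
    by apply: eq_igr (igr_norm ix) => y; rewrite normrM [X in _ * X]ger0_norm// sqr_ge0.
  apply: ge0_quadratic_discr => // s.
  rewrite /C /H /avg -!RintZ//; last exact: igr_norm.
  have i3 : igr m2 (fun y => s ^+ 2 * `|phi y|) by apply: igrZ; exact: igr_norm.
  have i4 : igr m2 (fun y => 2 * s * (phi y * h (x + tau y))) by exact: igrZ.
  rewrite -(RintD i3 i4) -(RintD (igrD i3 i4) i2x).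
  apply: Rint_ge0 => y; move: (h _) (phi y) => a c.
  have : 0 <= `|c| * (`|s| - `|a|) ^+ 2 by rewrite mulr_ge0// sqr_ge0.
  have : `|2 * s * (c * a)| <= 2 * `|c| * `|s| * `|a|.
    by rewrite !normrM [`|2|]ger0_norm// mulrACA mulrA [X in X <= _](_ : _ = 2 * `|c| * `|s| * `|a|)//; ring.
  rewrite ler_norml => /andP[h1 _].
  rewrite -(real_normK (num_real s)) -(real_normK (num_real a)).
  by move: h1; lra.
have La : L2 mu (avg h).
  apply: L2P => //.
  pose K x := C * H x.
  have iK : igr mu K by exact: igrZ.
  apply/igrP; first exact: measurable_funX.
  apply: (@le_lt_trans _ _ (\int[mu]_x (`|K x|)%:E)%E); last first.
    by apply/igrP => //; exact: igr_measurable iK.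
  apply: ae_ge0_le_integral => //.
  - by apply/measurable_EFinP; apply: measurableT_comp => //; exact: measurable_funX.
  - by apply/measurable_EFinP; apply: measurableT_comp => //; exact: igr_measurable iK.
  - apply: filterS key => x hx _; rewrite lee_fin ger0_norm ?sqr_ge0// (le_trans hx)// ler_norm//.
split => //.
rewrite expr2 -mulrA -IH -RintZ// /sqn.
have := L2_igr La => iA.
rewrite -lee_fin !EFin_Rint//; last exact: igrZ.
apply: ae_ge0_le_integral => //.
- by move=> x _; rewrite lee_fin sqr_ge0.
- by apply/measurable_EFinP; exact: measurable_funX.
- by move=> x _; rewrite lee_fin mulr_ge0// Rint_ge0// => y; rewrite mulr_ge0// sqr_ge0.
- by apply/measurable_EFinP; exact: (igr_measurable (igrZ C iH)).
- by apply: filterS key => x hx _; rewrite lee_fin.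
Qed.

Lemma Rint_mul_avg g h : L2 mu g -> L2 mu h ->
  \int[mu]_x (g x * avg h x) = \int[m2]_y (phi y * \int[mu]_x (g x * h (x + tau y))).
Proof.
move=> Lg Lh; have i2 := igr2_avg_mul Lg Lh.
transitivity (\int[mu]_x \int[m2]_y (g x * (phi y * h (x + tau y)))).
  apply: Rint_ae.
  - by apply: measurable_funM; [case: Lg|apply: measurable_avg; case: Lh].
  - exact: (igr_measurable (igr_Rint12 i2)).
  have := ae_igr_avg1 Lh; apply: filterS => x ix; rewrite /avg -RintZ//.
rewrite (Rint_Fubini i2) /=; apply: eq_Rint => y.
rewrite -RintZ; last by apply: L2M => //; exact: L2_translate.
by apply: eq_Rint => x; rewrite mulrCA.
Qed.

End averaging.

Section dominated.
Context d (T : measurableType d) (R : realType) (mu : {measure set T -> \bar R}).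

Lemma Rint_dominated (f_ : nat -> T -> R) (f g : T -> R) :
  (forall k, measurable_fun setT (f_ k)) -> measurable_fun setT f ->
  (forall x, f_ k x @[k --> \oo] --> f x) ->
  igr mu g -> (forall k x, `|f_ k x| <= g x) ->
  igr mu f /\ \int[mu]_x f_ k x @[k --> \oo] --> \int[mu]_x f x.
Proof.
move=> mf_ mf f_f ig f_g.
have m1 k : measurable_fun setT (fun x => (f_ k x)%:E) by exact/measurable_EFinP.
have m2 : measurable_fun setT (EFin \o f) by exact/measurable_EFinP.
have h1 : {ae mu, forall x, setT x -> (fun k => (f_ k x)%:E) @ \oo --> (EFin \o f) x}.
  by apply: aeW => x _; apply: cvg_EFin; [exact: nearW|exact: f_f].
have h2 : {ae mu, forall x k, setT x -> (`|(f_ k x)%:E| <= (EFin \o g) x)%E}.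
  by apply: aeW => x k _; rewrite lee_fin.
have [fi _ fcvg] := dominated_convergence measurableT m1 m2 h1 ig h2.
by split=> //; apply: fine_cvg; rewrite EFin_Rint.
Qed.

End dominated.

(** * Weak derivatives *)

Section boxes.
Context {R : realType} {n : nat}.
Local Notation E := 'rV[R]_n.
Local Notation mu := (volume n).

(** Boxes are stable under intersection, so this makes them a generating pi-system for the Dynkin
    argument in [du_Bois_Reymond]. A half-space is the union of an increasing sequence of boxes. *)
Lemma measurable_boxes : @measurable _ E = <<s [set B : set E | exists a b : 'I_n -> R, B = box a b] >>.
Proof.
apply/seteqP; split; last first.
  apply: smallest_sub; first exact: sigma_algebra_measurable.
  by move=> _ [a [b ->]]; exact: measurable_box.
set S := <<s _ >>.
have SS : sigma_algebra setT S by exact: smallest_sigma_algebra.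
apply: smallest_sub => //.
rewrite -bigcup_seq => B [i _] [C mC <-] /=; rewrite setTI.
suff : @measurable _ (measurableTypeR R) `<=` [set C | S (row_coord i @^-1` C)] by move=> /(_ _ mC).
have -> : @measurable _ (measurableTypeR R) = <<s (@RGenOInfty.G R) >> by exact: RGenOInfty.measurableE.
apply: smallest_sub.
  case: SS => S0 SC SU; split => //=.
  - by move=> A SA; rewrite setTD preimage_setC -setTD; exact: SC.
  - by move=> F SF; rewrite preimage_bigcup; exact: SU.
move=> _ [a ->] /=.
have -> : @row_coord R n i @^-1` `]a, +oo[%classic =
  \bigcup_k box (fun j => if j == i then a else - k%:R) (fun=> k%:R).
  apply/seteqP; split=> [x|x [k _] /(_ i)]; rewrite /row_coord /= in_itv/= andbT ?eqxx; last by case/andP.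
  move=> ax; pose M := \sum_j `|x ord0 j|.
  have [k Mk] : exists k : nat, M < k%:R by exists (Num.truncn M).+1; exact: truncnS_gt.
  exists k => // j /=.
  have : `|x ord0 j| < k%:R.
    by apply: le_lt_trans Mk; rewrite /M (bigD1 j)//= lerDl sumr_ge0.
  by rewrite ltr_norml => /andP[h1 h2]; rewrite h2 andbT; case: eqP => [->|].
case: SS => _ _; apply => k; apply: sub_sigma_algebra.
by do 2 eexists.
Qed.

Lemma boxI (a b a' b' : 'I_n -> R) :
  box a b `&` box a' b' = box (fun i => Num.max (a i) (a' i)) (fun i => Num.min (b i) (b' i)).
Proof.
apply/seteqP; split=> x.
  by move=> [h h'] i; rewrite gt_max lt_min; move: (h i) (h' i) => /andP[-> ->] /andP[-> ->].
move=> h; split=> i; move: (h i); rewrite gt_max lt_min => /andP[/andP[? ?] /andP[? ?]]; exact/andP.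
Qed.

Definition cubeM (M : R) : set E := box (fun=> - M) (fun=> M).

Lemma cubeP M x : cubeM M x <-> forall i, `|x ord0 i| < M.
Proof. by split=> h i; move: (h i); rewrite ltr_norml. Qed.

Definition bsupp (f : E -> R) := [/\ measurable_fun setT f, (exists C : R, forall x, `|f x| <= C)
  & exists M : R, forall (x : E) i, M <= `|x ord0 i| -> f x = 0].

Lemma igr_indic_box (a b : 'I_n -> R) : igr mu (\1_(box a b) : E -> R).
Proof.
apply: ge0_igr => //; first by apply: measurable_indic; exact: measurable_box.
rewrite integral_indic//; last exact: measurable_box.
rewrite setIT; pose b' i := Num.max (a i) (b i).
apply: (@le_lt_trans _ _ (volume n (box a b'))).
  apply: le_measure; rewrite ?inE; try exact: measurable_box.
  by move=> x h i; move: (h i) => /andP[-> xb]; rewrite lt_max xb orbT.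
by rewrite volume_box ?ltry// => i; rewrite le_max lexx.
Qed.

Lemma bsupp_le f : bsupp f -> exists C M, 0 < C /\ forall x, `|f x| <= C * \1_(cubeM M) x.
Proof.
move=> [_ [C HC] [M HM]]; exists (`|C| + 1), M; split; first by rewrite ltr_wpDl.
move=> x; have [xM|xM] := pselect (cubeM M x).
  by rewrite indicE mem_set// mulr1 (le_trans (HC x))// (le_trans (ler_norm _))// lerDl.
rewrite indicE memNset// mulr0; move/existsNP : xM => [i /negP].
by rewrite -ltr_norml -leNgt => /HM ->; rewrite normr0.
Qed.

Lemma bsupp_igr f : bsupp f -> igr mu f.
Proof.
move=> bf; have [C [M [_ H]]] := bsupp_le bf; case: bf => mf _ _.
exact: le_igr mf H (igrZ C (igr_indic_box _ _)).
Qed.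

Lemma bsuppX f : bsupp f -> bsupp (fun x => f x ^+ 2).
Proof.
move=> [mf [C HC] [M HM]]; split; first exact: measurable_funX.
  by exists (C ^+ 2) => x; rewrite normrX lerXn2r// nnegrE// (le_trans _ (HC x)).
by exists M => x i h; rewrite (HM x i)// expr0n.
Qed.

Lemma bsupp_L2 f : bsupp f -> L2 mu f.
Proof. by move=> bf; apply: L2P; [case: bf|exact: bsupp_igr (bsuppX bf)]. Qed.

Lemma bsupp_rtest f : rtest f -> bsupp f.
Proof.
move=> tf; split; [|exact: rtest_bounded|exact: rtest_bounded_support].
by apply: continuous_row_measurable; case: tf => /smooth_continuous.
Qed.

(** Local integrability tested on cubes instead of compact sets; [loc_integrableP] reconciles the
    two. *)
Definition rloc (f : E -> R) := measurable_fun setT f /\ forall M, igr mu (fun x => \1_(cubeM M) x * f x).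

Lemma rlocM f phi : rloc f -> bsupp phi -> igr mu (fun x => f x * phi x).
Proof.
move=> [mf lf] bp; have [C [M [C0 H]]] := bsupp_le bp; case: bp => mp _ _.
apply: (le_igr _ _ (igrZ C (igr_norm (lf M)))); first exact: measurable_funM.
move=> x; rewrite !normrM [`|\1_(cubeM M) x|]ger0_norm// mulrA mulrC.
by rewrite ler_wpM2r.
Qed.

Lemma L2_rloc f : L2 mu f -> rloc f.
Proof.
move=> Lf; split; first by case: Lf.
move=> M; apply: L2M => //; apply: L2P; first by apply: measurable_indic; exact: measurable_box.
by apply: (eq_igr _ (igr_indic_box (fun=> -M) (fun=> M))) => x; rewrite indicE; case: (_ \in _); rewrite /= ?expr1n ?expr0n.
Qed.

Lemma rlocD f g : rloc f -> rloc g -> rloc (fun x => f x + g x).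
Proof.
move=> [mf lf] [mg lg]; split; first exact: measurable_funD.
by move=> M; apply: eq_igr (igrD (lf M) (lg M)) => x; rewrite mulrDr.
Qed.

Lemma rlocZ c f : rloc f -> rloc (fun x => c * f x).
Proof.
move=> [mf lf]; split; first exact: measurable_funM.
by move=> M; apply: eq_igr (igrZ c (lf M)) => x; rewrite mulrCA.
Qed.

Lemma continuous_rloc f : continuous f -> rloc f.
Proof.
move=> cf; have mf := continuous_row_measurable cf; split => // M.
pose K := [set x : E | forall i, x ord0 i \in `[(- M), M]].
have cK : compact K.
  by apply: (@rV_compact _ _ (fun=> `[(- M), M]%classic)) => i; exact: segment_compact.
have /compact_bounded[r [rr Hr]] : compact (f @` K).
  by apply: continuous_compact => //; exact: continuous_subspaceT.
apply: (le_igr _ _ (igrZ (`|r| + 1) (igr_indic_box (fun=> -M) (fun=> M)))).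
  by apply: measurable_funM => //; apply: measurable_indic; exact: measurable_box.
move=> x; rewrite normrM [`|\1_(cubeM M) x|]ger0_norm// mulrC.
have [xM|xM] := pselect (cubeM M x); last by rewrite indicE memNset// !mulr0.
rewrite ler_wpM2r//; apply: (Hr (`|r| + 1)) => /=; first by rewrite (le_lt_trans (ler_norm _))// ltrDl.
by exists x => // i; move: (xM i); rewrite in_itv/= => /andP[/ltW -> /ltW ->].
Qed.

Lemma rloc_translate f y : rloc f -> rloc (fun x => f (x + y)).
Proof.
move=> [mf lf]; split; first exact: measurable_translate.
move=> M; pose M' := M + \sum_i `|y ord0 i|.
apply: (le_igr _ _ (igr_norm (igr_translate y (lf M')))).
  apply: measurable_funM; last exact: measurable_translate.
  by apply: measurable_indic; exact: measurable_box.
move=> x; rewrite !normrM ler_wpM2r//.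
have [/cubeP xM|xM] := pselect (cubeM M x); last by rewrite [X in `|X| <= _]indicE memNset// normr0.
suff h : cubeM M' (x + y) by rewrite [X in _ <= `|X|]indicE mem_set// normr1 indicE; case: (_ \in _); rewrite ?normr1 ?normr0.
apply/cubeP => i; rewrite mxE (le_lt_trans (ler_normD _ _))// /M' ltr_leD//.
by rewrite (bigD1 i)//= lerDl sumr_ge0.
Qed.

Lemma box_sub_cube (a b : 'I_n -> R) : exists M, box a b `<=` cubeM M.
Proof.
exists (1 + \sum_i (`|a i| + `|b i|)) => x xab; apply/cubeP => i.
have /andP[ax xb] := xab i.
have : `|x ord0 i| <= `|a i| + `|b i|.
  have := ler_norm (b i); have := ler_norm (- a i); rewrite normrN; have := normr_ge0 (a i); have := normr_ge0 (b i).
  by case: (ger0P (x ord0 i)) => _ ? ? ? ?; lra.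
rewrite (bigD1 i)//=.
have : 0 <= \sum_(i0 < n | i0 != i) (`|a i0| + `|b i0|) by apply: sumr_ge0 => ? _; rewrite addr_ge0.
by lra.
Qed.

Lemma bsupp_indic_box (a b : 'I_n -> R) : bsupp (\1_(box a b)).
Proof.
split; first by apply: measurable_indic; exact: measurable_box.
  by exists 1 => x; rewrite indicE; case: (_ \in _); rewrite ?normr1 ?normr0.
have [M HM] := box_sub_cube a b; exists M => x i Mx.
rewrite indicE memNset// => /HM/cubeP/(_ i); by rewrite ltNge Mx.
Qed.

Lemma cvg_prodr (I : Type) (s : seq I) (f : I -> nat -> R) (l : I -> R) :
  (forall i, f i k @[k --> \oo] --> l i) ->
  \prod_(i <- s) f i k @[k --> \oo] --> \prod_(i <- s) l i.
Proof.
move=> fl; elim: s => [|i s IH].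
  by rewrite big_nil; under eq_cvg do rewrite big_nil; exact: cvg_cst.
by rewrite big_cons; under eq_cvg do rewrite big_cons; exact: cvgM.
Qed.

(** The indicator of a box is the pointwise limit of products of bumps with values in [0, 1]
    supported in that box, so dominated convergence applies. *)
Lemma Rint_box_eq0 h (a b : 'I_n -> R) : rloc h ->
  (forall psi : 'I_n -> R -> R, (forall i, test1 (psi i)) -> \int[mu]_x (h x * tens psi x) = 0) ->
  \int[mu]_x (h x * \1_(box a b) x) = 0.
Proof.
move=> lh h0; have [mh _] := lh.
pose psi k i := bump1 (a i) (b i) k.+1%:R.
have tpsi k i : test1 (psi k i) by exact: test1_bump.
have [M HM] := box_sub_cube a b.
have out k x : ~ cubeM M x -> tens (psi k) x = 0.
  move=> xM; have /existsNP[i xi] : ~ box a b x by move=> /HM.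
  rewrite (tensE _ i) /psi bump1_out ?mul0r//; exact/negP.
have le1 k x : `|tens (psi k) x| <= 1.
  rewrite /tens normr_prod; apply: prodr_ile1 => i _.
  by rewrite normr_ge0 ger0_norm ?bump1_ge0// bump1_le1.
have mk k : measurable_fun setT (fun x => h x * tens (psi k) x).
  by apply: measurable_funM => //; apply: measurable_tens => i; case: (tpsi k i).
have ml : measurable_fun setT (fun x => h x * \1_(box a b) x).
  by apply: measurable_funM => //; apply: measurable_indic; exact: measurable_box.
have cl x : h x * tens (psi k) x @[k --> \oo] --> h x * \1_(box a b) x.
  apply: cvgM; first exact: cvg_cst.
  by rewrite indic_box; apply: cvg_prodr => i; exact: bump1_cvg.
have bd k x : `|h x * tens (psi k) x| <= `|\1_(cubeM M) x * h x|.
  rewrite !normrM mulrC.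
  have [xM|xM] := pselect (cubeM M x).
    by rewrite indicE mem_set// normr1 ler_wpM2r.
  by rewrite out// normr0 !mul0r mulr_ge0.
have [_ cv] := Rint_dominated mk ml cl (igr_norm (lh.2 M)) bd.
have cv0 : \int[mu]_x (h x * tens (psi k) x) @[k --> \oo] --> (0 : R).
  under eq_cvg do rewrite (h0 _ (tpsi _)); exact: cvg_cst.
exact: (cvg_unique _ cv cv0).
Qed.

(** Product test functions suffice: they give vanishing integrals over boxes, and the sets over
    which the integral of a truncation of h vanishes form a Dynkin class. The truncation to a cube
    provides global integrability. *)
Lemma du_Bois_Reymond h : rloc h ->
  (forall psi : 'I_n -> R -> R, (forall i, test1 (psi i)) -> \int[mu]_x (h x * tens psi x) = 0) ->
  {ae mu, forall x, h x = 0}.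
Proof.
move=> lh h0; have [mh _] := lh.
have H (k : nat) : {ae mu, forall x, \1_(cubeM k%:R) x * h x = 0}.
  pose g x := \1_(cubeM k%:R) x * h x.
  have ig : igr mu g := lh.2 k%:R.
  have mg := igr_measurable ig.
  have Gbox a b : (\int[mu]_(x in box a b) (g x)%:E = 0)%E.
    (* The truncating cube is absorbed into the box, since an intersection of boxes is a box. *)
    have := Rint_box_eq0 (fun i => Num.max (a i) (- k%:R)) (fun i => Num.min (b i) (k%:R)) lh h0.
    rewrite -boxI => e; rewrite integral_mkcond -[RHS]/(0%:E) -e EFin_Rint.
      apply: eq_integral => x _; rewrite patchE indicI /g.
      have E : (\1_(box a b) x : R) = (x \in box a b)%:R by rewrite indicE.
      rewrite [in RHS]/= E; case: (x \in box a b); rewrite ?mul1r ?mul0r ?mulr0//.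
      by rewrite mulrC.
    by rewrite boxI; apply: rlocM => //; exact: bsupp_indic_box.
  have : forall S, <<s [set B : set E | exists a b : 'I_n -> R, B = box a b] >> S -> (\int[mu]_(x in S) (g x)%:E = 0)%E.
    have gT : (\int[mu]_x (g x)%:E = 0)%E.
      rewrite -[RHS](Gbox (fun=> - k%:R) (fun=> k%:R)) [RHS]integral_mkcond; apply: eq_integral => x _.
      by rewrite patchE; case: ifPn => // /negbTE xk; rewrite /g indicE xk mul0r.
    apply: (@dynkin_induction _ E _ (fun S => (\int[mu]_(x in S) (g x)%:E = 0)%E)).
    - exact: measurable_boxes.
    - by move=> _ _ [a [b ->]] [a' [b' ->]]; rewrite boxI; do 2 eexists.
    - exact: gT.
    - by move=> _ [a [b ->]]; exact: Gbox.
    - move=> S mS S0.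
      have : (\int[mu]_(x in S `|` ~` S) (g x)%:E = 0)%E by rewrite setUv gT.
      rewrite integral_setU ?S0 ?add0e//; first exact: measurableC.
        by rewrite setUv; exact/measurable_EFinP.
      by apply/disj_setPS => x [].
    - move=> F mF tF F0; rewrite (integral_bigcup tF mF).
      by apply: eseries0 => i _ _; exact: F0.
      by apply: integrableS ig => //; exact: bigcup_measurable.
  rewrite -measurable_boxes => gS.
  have m0 : measurable_fun setT (cst 0%E : E -> \bar R) by exact: measurable_cst.
  have : ae_eq mu setT (EFin \o g) (cst 0%E).
    by apply: integral_ae_eq => // A _ mA; rewrite gS// integral0.
  by apply: filterS => x /(_ I)[].
have := ae_foralln H; apply: filterS => x hx.
pose M := \sum_j `|x ord0 j|.
have := hx (Num.truncn M).+1; rewrite indicE mem_set ?mul1r//; apply/cubeP => i.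
apply: le_lt_trans (truncnS_gt M); rewrite /M (bigD1 i)//= lerDl sumr_ge0//.
Qed.

End boxes.

(** * Primitives and averages of one-variable test functions *)

Section line_integrals.
Context {R : realType}.
Local Notation leb := (@lebesgue_measure R).

Lemma FTC_line (F f : R -> R) (a b : R) : a < b -> continuous f ->
  (forall x : R, is_derive x (1 : R) F (f x)) ->
  \int[leb]_(t in `[a, b]) f t = F b - F a.
Proof.
move=> ab cf dF; rewrite /Rintegral (@continuous_FTC2 _ _ F)//.
- exact: continuous_subspaceT.
- have cF : continuous F.
    by move=> x; apply: differentiable_continuous; apply/derivable1_diffP; case: (dF x).
  split; first by move=> x _; case: (dF x).
    exact: cvg_at_right_filter (cF a).
  exact: cvg_at_left_filter (cF b).
- by move=> x _; rewrite derive1E; case: (dF x).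
Qed.

Lemma Rint_indic_itv (f : R -> R) (a b : R) :
  \int[leb]_(t in `[a, b]) f t = \int[leb]_t (\1_(`[a, b]%classic : set R) t * f t).
Proof.
rewrite Rintegral_mkcond; apply: eq_Rint => t.
by rewrite patchE indicE; case: (_ \in _); rewrite ?mul1r ?mul0r.
Qed.

Lemma igr_indic_itv (a b : R) : igr leb (\1_(`[a, b]%classic : set R)).
Proof. exact: integrable_indic_itv. Qed.

Lemma Rint_indic_itv1 (s : R) : 0 <= s -> \int[leb]_t (\1_(`[0, s]%classic : set R) t) = s.
Proof.
move=> s0; rewrite /Rintegral integral_indic// setIT.
rewrite -[RHS]/(fine s%:E); congr fine.
apply: etrans (lebesgue_measure_itv `[0, s]) _; rewrite /= lte_fin sube0.
by move: s0; rewrite le_eqVlt => /predU1P[<-|->]//; rewrite ltxx.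
Qed.

Lemma test1_primitive (f : R -> R) : test1 f -> exists F : R -> R, forall x : R, is_derive x (1 : R) F (f x).
Proof.
move=> [sf [M fM]]; have cf := smooth1_continuous sf.
(* Far enough to the left of the support for the primitive to vanish near every x <= a. *)
pose a := - (`|M| + 1).
exists (fun x => \int[leb]_(t in `[a, x]) f t) => x.
have [ax|xa] := ltP a x.
  have [] := @continuous_FTC1_closed R f a x (x + 1) _ _ ax _.
  - by rewrite ltrDl.
  - apply: continuous_compact_integrable; first exact: segment_compact.
    exact: continuous_subspaceT.
  - exact: cf.
  by move=> d1 d2; apply: (DeriveDef d1); rewrite -derive1E d2.
have f0 y : y <= - `|M| -> f y = 0.
  move=> h; apply: fM; rewrite ler0_norm; last by rewrite (le_trans h)// oppr_le0.
  by rewrite lerNr (le_trans h)// lerN2 ler_norm.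
rewrite f0; last by rewrite (le_trans xa)// /a lerN2 lerDl.
apply: (is_derive1_near (@is_derive_constant R R 0 x 1)).
near=> y.
have ya : y <= - `|M|.
  have : `|x - y| < 1 by near: y; apply: cvgr_dist_lt => //; exact: cvg_id.
  by rewrite ltr_norml => /andP[]; move: xa; rewrite /a; lra.
rewrite (@eq_Rintegral _ _ _ _ _ (fun=> 0)) ?Rintegral_cst ?mul0r//.
move=> t; rewrite inE/= in_itv/= => /andP[_ ty]; apply: f0.
exact: le_trans ya.
Unshelve. all: by end_near. Qed.

(** P averages psi over [y - s, y]. As a difference of two translates of a primitive it has the
    stated derivative, and it is compactly supported even when the primitive is not. *)
Lemma test1_average (s : R) (psi : R -> R) : 0 < s -> test1 psi -> exists P : R -> R,
  [/\ test1 P, forall y, derive1 P y = psi y - psi (y - s)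
   & forall y, P y = \int[leb]_t (\1_(`[0, s]%classic : set R) t * psi (y - t))].
Proof.
move=> s0 tpsi.
have [Q dQ] := test1_primitive tpsi.
pose P y := Q y - Q (y - s).
have [[Sj [Sjp HSj]] [M HM]] := tpsi.
have dP (y : R) : is_derive y (1 : R) P (psi y - psi (y - s)).
  apply: is_derive_add => //; apply: is_derive_opp.
  have dm : is_derive y (1 : R) (fun y : R => y - s) 1.
    by have := is_derive_add (is_derive_idr y) (is_derive_constant (- s) y 1); rewrite addr0.
  by have := @is_derive_comp1 R Q (fun y => y - s) _ _ _ (dQ (y - s)) dm; rewrite mul1r.
have PE y : P y = \int[leb]_t (\1_(`[0, s]%classic : set R) t * psi (y - t)).
  rewrite -Rint_indic_itv.
  have c : continuous (fun t : R => psi (y - t)).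
    move=> t; apply: (continuous_comp (f := fun t => y - t) (g := psi)).
      by apply: cvgB; [exact: cvg_cst|exact: cvg_id].
    by apply: smooth1_continuous; case: tpsi.
  have d (t : R) : is_derive t (1 : R) (fun t => - Q (y - t)) (psi (y - t)).
    have dm : is_derive t (1 : R) (fun t : R => y - t) (-1).
      by have := is_derive_add (is_derive_constant y t 1) (is_derive_opp (is_derive_idr t)); rewrite add0r.
    by have := is_derive_opp (@is_derive_comp1 R Q (fun t => y - t) _ _ _ (dQ (y - t)) dm); rewrite mulN1r opprK.
  by rewrite (FTC_line s0 c d) subr0 opprK addrC.
have tP : test1 P.
  split.
    have sp : smooth1 (fun y => psi y - psi (y - s)).
      apply: smooth1D; first by case: (tpsi).
      apply: smooth1N; have [sj _] := tpsi.
      have := smooth1_affine 1 (- s) sj; rewrite (_ : (fun x => _) = (fun x => psi (x - s)))//.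
      by apply/funext => x; rewrite mul1r.
    have [S [Ssp HS]] := sp.
    exists [set g | g = P \/ S g]; split; first by left.
    move=> g [->|Sg]; first by exists (fun y => psi y - psi (y - s)) => //; right.
    by have [g' Sg' dg] := HS _ Sg; exists g' => //; right.
  exists (`|M| + s) => y hy; rewrite PE -[RHS](Rint0 leb); apply: eq_Rint => t.
  rewrite indicE; case: (boolP (t \in _)); rewrite ?mul0r// inE/= in_itv/= => /andP[t0 ts].
  rewrite mul1r; apply: HM; apply: (le_trans (ler_norm M)).
  have := lerB_dist y t; rewrite (ger0_norm t0); lra.
exists P; split => // y; rewrite derive1E; by case: (dP y).
Qed.

End line_integrals.

Section continuous_ring.
Context {R : realType} (T : topologicalType).
Implicit Types f g : T -> R.

Lemma continuous_mulr f g : continuous f -> continuous g -> continuous (fun x => f x * g x).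
Proof. by move=> cf cg x; apply: cvgM; [exact: cf|exact: cg]. Qed.

Lemma continuous_addr f g : continuous f -> continuous g -> continuous (fun x => f x + g x).
Proof. by move=> cf cg x; apply: cvgD; [exact: cf|exact: cg]. Qed.

Lemma continuous_along (V : normedModType R) (F : V -> R) (v x : V) : continuous F ->
  continuous (fun t : R => F (t *: v + x)).
Proof.
move=> cF t; apply: (@continuous_comp R V R (fun t => t *: v + x) F); last exact: cF.
by apply: cvgD; [apply: cvgZr_tmp; exact: cvg_id|exact: cvg_cst].
Qed.

End continuous_ring.

(** * Weak derivatives along segments *)

Section weak_derivatives.
Context {R : realType} {n : nat}.
Local Notation E := 'rV[R]_n.
Local Notation mu := (volume n).
Local Notation leb := (@lebesgue_measure R).
Implicit Types (f g h : E -> R) (j : 'I_n).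

Lemma measurable_line j : measurable_fun setT (fun t : measurableTypeR R => t *: base_vec j : E).
Proof.
exact: (measurableT_comp (@measurable_fun_rowZ R n) (measurable_pair2 (base_vec j))).
Qed.

Lemma measurable_line_opp j : measurable_fun setT (fun t : measurableTypeR R => - t *: base_vec j : E).
Proof.
have m : measurable_fun setT ((fun t => - t) : measurableTypeR R -> measurableTypeR R) by exact: oppr_measurable.
exact: (measurableT_comp (measurable_line j) m).
Qed.

Lemma bsupp_translate (f : E -> R) (v : E) : bsupp f -> bsupp (fun x => f (x + v)).
Proof.
move=> [mf [C HC] [M HM]]; split; [exact: measurable_translate|by exists C|].
exists (M + \sum_i `|v ord0 i|) => x i hx; apply: (HM _ i); rewrite mxE.
have vi : `|v ord0 i| <= \sum_i `|v ord0 i| by rewrite (bigD1 i)//= lerDl sumr_ge0.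
have := ler_normB (x ord0 i + v ord0 i) (v ord0 i); rewrite addrK; lra.
Qed.

(* [seg j s h x] is the integral of h along the segment from x to x + s e_j. *)
Definition seg j (s : R) : (E -> R) -> E -> R :=
  avg (leb : {sigma_finite_measure set (measurableTypeR R) -> \bar R})
    (fun t => t *: base_vec j) (\1_(`[0, s]%classic : set R)).

Lemma segE j s h x : seg j s h x = \int[leb]_t (\1_(`[0, s]%classic : set R) t * h (x + t *: base_vec j)).
Proof. by []. Qed.

(** The integral of F(x + e_j) - F(x) is 0 by translation invariance. It also averages the integrals
    of the translates of F' along the unit segment, which all equal the integral of F'. *)
Lemma Rint_pderiv0 (F F' : E -> R) j : (forall x, is_derive x (base_vec j) F (F' x)) ->
  continuous F' -> igr mu F -> igr mu F' -> \int[mu]_x F' x = 0.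
Proof.
move=> dF cF' iF iF'.
have line x : F (x + base_vec j) - F x = seg j 1 F' x.
  have H : forall t : R, is_derive t (1 : R) (fun t => F (t *: base_vec j + x)) (F' (t *: base_vec j + x)).
    by move=> t; exact: is_derive_along.
  have cl : continuous (fun t : R => F' (t *: base_vec j + x)).
    exact: continuous_along.
  have := FTC_line (@ltr01 R) cl H.
  rewrite scale1r scale0r add0r [_ + x]addrC => <-.
  by rewrite Rint_indic_itv segE; apply: eq_Rint => t; rewrite [x + _]addrC.
have := Rint_translate (base_vec j) iF => e.
have : \int[mu]_x (F (x + base_vec j) - F x) = 0.
  by rewrite RintB ?e ?subrr//; exact: igr_translate.
rewrite (eq_Rint _ line) /seg /avg => <-.
have i2 := igr2_avg (measurable_line j) (igr_indic_itv 0 1) iF'.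
rewrite (Rint_Fubini i2)/=.
transitivity (\int[leb]_t (\int[mu]_x F' x * \1_(`[0, 1]%classic : set R) t)).
  by rewrite RintZ ?Rint_indic_itv1 ?mulr1//; exact: igr_indic_itv.
apply: eq_Rint => t; rewrite RintZ; last exact: igr_translate.
by rewrite Rint_translate// mulrC.
Qed.

Definition rwpd j f h := [/\ rloc f, rloc h
  & forall phi : E -> R, rtest phi -> \int[mu]_x (f x * pderiv j phi x) = - \int[mu]_x (h x * phi x)].

Lemma rwpd_C1 f j : continuous f -> (forall x, derivable f x (base_vec j)) -> continuous (pderiv j f) ->
  rwpd j f (pderiv j f).
Proof.
move=> cf df cdf; split; [exact: continuous_rloc|exact: continuous_rloc|].
move=> phi tp; have [sp _] := tp.
have dtp := rtest_pderiv j tp.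
have i1 := rlocM (continuous_rloc cf) (bsupp_rtest dtp).
have i2 := rlocM (continuous_rloc cdf) (bsupp_rtest tp).
apply/eqP; rewrite eq_sym -subr_eq0 -opprD oppr_eq0 -RintD//; apply/eqP.
apply: (@Rint_pderiv0 (fun x => f x * phi x) _ j).
- move=> x; rewrite addrC [pderiv j f x * _]mulrC.
  apply: is_derive_mul; first exact: DeriveDef.
  exact: smooth_is_derive.
- apply: continuous_addr; apply: continuous_mulr => //.
    exact: smooth_continuous.
  exact: (smooth_continuous (smooth_pderiv j sp)).
- exact: (rlocM (continuous_rloc cf) (bsupp_rtest tp)).
- exact: igrD.
Qed.

Lemma smooth_rwpd f j : smooth f -> rwpd j f (pderiv j f).
Proof.
move=> sf; apply: rwpd_C1; first exact: smooth_continuous.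
  by move=> x; have [_] := sf [::]; apply.
exact: smooth_continuous (smooth_pderiv j sf).
Qed.

(** Tested with a product function phi, the increment of f moves onto phi. The difference phi(x) -
    phi(x - v) is the j-th derivative of the average Phi of phi along the segment, so the weak
    derivative applies to Phi; the average is then moved back onto h. *)
Lemma rwpd_line f h j (s : R) : 0 < s -> rwpd j f h -> L2 mu h ->
  {ae mu, forall x, f (x + s *: base_vec j) - f x = seg j s h x}.
Proof.
move=> s0 [lf lh fh] Lh.
pose v := s *: base_vec j : E.
have Lseg : L2 mu (seg j s h) by case: (L2_avg (measurable_line j) (igr_indic_itv 0 s) Lh).
suff : {ae mu, forall x, (f (x + v) + -1 * f x) + -1 * seg j s h x = 0}.
  by apply: filterS => x /eqP; rewrite !mulN1r subr_eq0 => /eqP.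
apply: du_Bois_Reymond.
  apply: rlocD; first by apply: rlocD; [exact: rloc_translate|exact: rlocZ].
  by apply: rlocZ; exact: L2_rloc.
move=> psi tpsi; set phi := tens psi.
have tphi : rtest phi by exact: rtest_tens.
have bphi := bsupp_rtest tphi.
have i1 := rlocM (rloc_translate v lf) bphi.
have i2 := rlocM lf bphi.
have i3 := rlocM (L2_rloc Lseg) bphi.
transitivity (\int[mu]_x (f (x + v) * phi x) - \int[mu]_x (f x * phi x) - \int[mu]_x (seg j s h x * phi x)).
  rewrite -RintB// -RintB//; last exact: igrB.
  by apply: eq_Rint => x; ring.
have [P [tP dP PE]] := test1_average s0 (tpsi j).
(* Averaging only the j-th factor keeps Phi a product of test functions. *)
pose Phi := tens (upd psi j P).
have tPhi : rtest Phi by apply: rtest_tens => i; exact: test1_upd.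
have pPhi x : pderiv j Phi x = phi x - phi (x - v).
  rewrite /Phi pderiv_tens; last by move=> i; case: (test1_upd j tpsi tP i).
  have -> : upd psi j P j = P by rewrite /upd eqxx.
  rewrite tens_upd.
  rewrite dP /phi !(tensE _ j) mulrBl; congr (_ * _ - _ * _).
  - by apply: eq_bigr => i /negbTE ij; rewrite /upd ij.
  - by rewrite /v !mxE !eqxx mulr1.
  - by apply: eq_bigr => i /negbTE ij; rewrite /upd ij /v !mxE eqxx ij mulr0 subr0.
have PhiE x : Phi x = avg (leb : {sigma_finite_measure set (measurableTypeR R) -> \bar R})
    (fun t => - t *: base_vec j) (\1_(`[0, s]%classic : set R)) phi x.
  have ip : igr leb (fun t => \1_(`[0, s]%classic : set R) t * psi j (x ord0 j - t)).
    have cp : continuous (fun t : R => psi j (x ord0 j - t)).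
      move=> t; apply: (continuous_comp (f := fun t => x ord0 j - t) (g := psi j)).
        by apply: cvgB; [exact: cvg_cst|exact: cvg_id].
      by apply: smooth1_continuous; case: (tpsi j).
    have [C [C0 [_ HC]]] := test1_bounded (tpsi j).
    apply: (le_igr _ _ (igrZ C (igr_indic_itv 0 s))).
      apply: measurable_funM; first exact: measurable_indic.
      exact: (continuous_measurable_fun cp).
    by move=> t; rewrite normrM ger0_norm// mulrC ler_wpM2r.
  rewrite /Phi tens_upd PE /avg -RintegralZr//.
  apply: eq_Rint => t; rewrite -mulrA; congr (_ * _).
  rewrite /phi (tensE _ j); congr (_ * _).
    by rewrite !mxE !eqxx mulr1.
  by apply: eq_bigr => i /negbTE ij; rewrite !mxE eqxx ij mulr0 addr0.
have -> : \int[mu]_x (f (x + v) * phi x) - \int[mu]_x (f x * phi x) = - \int[mu]_x (f x * pderiv j Phi x).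
  have bt : bsupp (fun x => phi (x - v)).
    exact: bsupp_translate.
  under [in RHS]eq_Rint do rewrite pPhi.
  under [in RHS]eq_Rint do rewrite mulrBr.
  rewrite RintB//; last exact: rlocM.
  rewrite opprB; congr (_ - _).
  rewrite -(Rint_translate v (rlocM lf bt)).
  by apply: eq_Rint => x; rewrite addrK.
rewrite (fh _ tPhi) opprK; apply/eqP; rewrite subr_eq0; apply/eqP.
have Lphi := bsupp_L2 bphi.
under eq_Rint do rewrite PhiE.
rewrite (Rint_mul_avg (measurable_line_opp j) (igr_indic_itv 0 s) Lh Lphi).
under [in RHS]eq_Rint do rewrite mulrC.
rewrite (Rint_mul_avg (measurable_line j) (igr_indic_itv 0 s) Lphi Lh).
apply: eq_Rint => t; congr (_ * _).
rewrite -(Rint_translate (t *: base_vec j) (L2M Lh (L2_translate _ Lphi))).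
by apply: eq_Rint => x; rewrite mulrC scaleNr addrK.
Qed.

End weak_derivatives.

(** * Increments in L^2 and integration by parts *)

Section sobolev_basic.
Context {R : realType} {n : nat}.
Local Notation E := 'rV[R]_n.
Local Notation mu := (volume n).
Local Notation leb := (@lebesgue_measure R).
Implicit Types (f g h : E -> R) (j : 'I_n).

Lemma sqn_ae f g : L2 mu f -> L2 mu g -> {ae mu, forall x, f x = g x} -> sqn mu f = sqn mu g.
Proof.
move=> [mf _] [mg _] fg; apply: Rint_ae; [exact: measurable_funX|exact: measurable_funX|].
by apply: filterS fg => x ->.
Qed.

Lemma L2_increment_pos f h j (s : R) : 0 < s -> rwpd j f h -> L2 mu h ->
  L2 mu (fun x => f (x + s *: base_vec j) - f x) /\
  sqn mu (fun x => f (x + s *: base_vec j) - f x) <= s ^+ 2 * sqn mu h.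
Proof.
move=> s0 wf Lh; have ae := rwpd_line s0 wf Lh; have [[mf _] _ _] := wf.
have [Ls Hs] := L2_avg (measurable_line j) (igr_indic_itv 0 s) Lh.
have md : measurable_fun setT (fun x : E => f (x + s *: base_vec j) - f x).
  by apply: measurable_funB => //; exact: measurable_translate.
have Ld : L2 mu (fun x => f (x + s *: base_vec j) - f x).
  by apply: L2_ae md _ Ls; apply: filterS ae => x ->.
split => //; rewrite (sqn_ae Ld Ls ae) (le_trans Hs)//.
rewrite (_ : \int[leb]_y _ = s)//.
rewrite -[RHS](Rint_indic_itv1 (ltW s0)); apply: eq_Rint => t.
by rewrite ger0_norm.
Qed.

Lemma L2_increment f h j (s : R) : rwpd j f h -> L2 mu h ->
  L2 mu (fun x => f (x + s *: base_vec j) - f x) /\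
  sqn mu (fun x => f (x + s *: base_vec j) - f x) <= s ^+ 2 * sqn mu h.
Proof.
move=> wf Lh; have [s0|s0|->] := ltrgt0P s; first exact: L2_increment_pos.
  have [Ld Hd] := @L2_increment_pos f h j (- s) ltac:(by rewrite oppr_gt0) wf Lh.
  have e : (fun x => f (x + s *: base_vec j) - f x) =
           (fun x => - 1 * (fun x => f (x + - s *: base_vec j) - f x) (x + s *: base_vec j)).
    by apply/funext => x; rewrite scaleNr addrK; ring.
  have Lt := L2_translate (s *: base_vec j) Ld.
  rewrite e; split; first exact: L2Z.
  rewrite /sqn; under eq_Rint do rewrite mulN1r sqrrN.
  by rewrite -[leLHS]/(sqn mu (fun x => (fun x => f (x + - s *: base_vec j) - f x) (x + s *: base_vec j))) sqn_translate// -(sqrrN s).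
rewrite (_ : (fun x => _) = (fun=> 0)); last by apply/funext => x; rewrite scale0r addr0 subrr.
split; first exact: L2_0.
rewrite expr0n/= mul0r /sqn.
by under eq_Rint do rewrite expr0n/=; rewrite Rint0.
Qed.

Lemma Rint_increment_le f g g' j (s : R) : L2 mu f -> rwpd j g g' -> L2 mu g' ->
  `|\int[mu]_x (f x * (g (x + s *: base_vec j) - g x))| <= `|s| * (Num.sqrt (sqn mu f) * Num.sqrt (sqn mu g')).
Proof.
move=> Lf wg Lg'; have [Ld Hd] := L2_increment s wg Lg'.
apply: (le_trans (norm_Rint_mul Lf Ld)).
rewrite mulrCA ler_wpM2l ?sqrtr_ge0//.
by rewrite -sqrtr_sqr -sqrtrM ?sqr_ge0// ler_wsqrtr.
Qed.

(** The hypothesis is averaged over a segment of length s, which produces the second-order error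
    used in [rwpd_IBP]. *)
Lemma Rint_mul_seg_near F h j (s c K : R) : L2 mu F -> L2 mu h -> 0 < s ->
  (forall t, 0 <= t -> t <= s -> `|\int[mu]_x (F x * h (x + t *: base_vec j)) - c| <= s * K) ->
  `|\int[mu]_x (F x * seg j s h x) - s * c| <= s ^+ 2 * K.
Proof.
move=> LF Lh s0 H.
pose chi : R -> R := \1_(`[0, s]%classic : set R).
have ichi : igr leb chi by exact: igr_indic_itv.
rewrite (Rint_mul_avg (measurable_line j) ichi LF Lh).
have i1 : igr leb (fun t => chi t * \int[mu]_x (F x * h (x + t *: base_vec j))).
  have := igr_Rint21 (igr2_avg_mul (measurable_line j) ichi LF Lh).
  apply: eq_igr => t /=; rewrite -RintZ; last by apply: L2M => //; exact: L2_translate.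
  by apply: eq_Rint => x; rewrite mulrCA.
have i2 : igr leb (fun t => c * chi t) by exact: igrZ ichi.
have i3 : igr leb (fun t => s * K * chi t) by exact: igrZ ichi.
have -> : s * c = \int[leb]_t (c * chi t).
  by rewrite (RintZ c ichi) (Rint_indic_itv1 (ltW s0)) mulrC.
rewrite -(RintB i1 i2).
have -> : s ^+ 2 * K = \int[leb]_t (s * K * chi t).
  by rewrite (RintZ _ ichi) (Rint_indic_itv1 (ltW s0)); ring.
apply: (le_norm_Rint (igrB i1 i2) i3) => t.
rewrite [c * _]mulrC -mulrBr normrM [s * K * _]mulrC ger0_norm /chi//.
rewrite indicE; case: (boolP (t \in _)); rewrite ?mul0r// inE/= in_itv/= => /andP[t0 ts]; rewrite !mul1r.
exact: H.
Qed.

(** The pairing X(s) of g with the increment of f is expanded at s = 0 in two ways: X(s) = s int f'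
    g + O(s^2), and, after moving the increment onto g by translation, -X(s) = s int f g' + O(s^2).
    Adding, dividing by s and letting s tend to 0 gives the formula. *)
Lemma rwpd_IBP f f' g g' j : L2 mu f -> L2 mu g -> rwpd j f f' -> L2 mu f' -> rwpd j g g' -> L2 mu g' ->
  \int[mu]_x (f' x * g x) = - \int[mu]_x (f x * g' x).
Proof.
move=> Lf Lg wf Lf' wg Lg'.
pose e := base_vec j : E.
pose K := Num.sqrt (sqn mu f') * Num.sqrt (sqn mu g').
have K0 : 0 <= K by rewrite mulr_ge0 ?sqrtr_ge0.
pose X s := \int[mu]_x (g x * (f (x + s *: e) - f x)).
have near_s f1 f1' F s : L2 mu F -> rwpd j f1 f1' -> L2 mu f1' -> 0 < s ->
    \int[mu]_x (F x * (f1 (x + s *: e) - f1 x)) = \int[mu]_x (F x * seg j s f1' x).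
  move=> LF w1 L1' s0; have [Ls _] := L2_avg (measurable_line j) (igr_indic_itv 0 s) L1'.
  apply: Rint_ae.
  - by apply: measurable_funM; [case: LF|case: (L2_increment s w1 L1') => -[]].
  - by apply: measurable_funM; [case: LF|case: Ls].
  - by have := rwpd_line s0 w1 L1'; apply: filterS => x ->.
have T1 s : 0 < s -> `|X s - s * \int[mu]_x (f' x * g x)| <= s ^+ 2 * K.
  move=> s0; rewrite /X (near_s _ _ _ _ Lg wf Lf' s0); apply: Rint_mul_seg_near => // t t0 ts.
  have -> : \int[mu]_x (g x * f' (x + t *: e)) = \int[mu]_x (f' x * g (x + - t *: e)).
    rewrite -(Rint_translate (- t *: e) (L2M Lg (L2_translate (t *: e) Lf'))).
    by apply: eq_Rint => x; rewrite scaleNr subrK mulrC.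
  rewrite -(RintB (L2M Lf' (L2_translate (- t *: e) Lg)) (L2M Lf' Lg)).
  under eq_Rint do rewrite -mulrBr.
  apply: (le_trans (Rint_increment_le (- t) Lf' wg Lg')).
  by rewrite normrN ger0_norm// ler_wpM2r.
have T2 s : 0 < s -> `|- X s - s * \int[mu]_x (f x * g' x)| <= s ^+ 2 * K.
  move=> s0; have Lfs := L2_translate (s *: e) Lf.
  have -> : - X s = \int[mu]_x (f (x + s *: e) * (g (x + s *: e) - g x)).
    rewrite /X; under eq_Rint do rewrite mulrBr; under [RHS]eq_Rint do rewrite mulrBr.
    have Lgs := L2_translate (s *: e) Lg.
    rewrite (RintB (L2M Lg Lfs) (L2M Lg Lf)) (RintB (L2M Lfs Lgs) (L2M Lfs Lg)) opprB.
    congr (_ - _); last by apply: eq_Rint => x; rewrite mulrC.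
    by rewrite -(Rint_translate (s *: e) (L2M Lg Lf)); apply: eq_Rint => x; rewrite mulrC.
  rewrite (near_s _ _ _ _ Lfs wg Lg' s0); apply: Rint_mul_seg_near => // t t0 ts.
  have -> : \int[mu]_x (f (x + s *: e) * g' (x + t *: e)) = \int[mu]_x (g' x * f (x + (s - t) *: e)).
    rewrite -(Rint_translate (- t *: e) (L2M Lfs (L2_translate (t *: e) Lg'))).
    by apply: eq_Rint => x; rewrite -!addrA -!scalerDl addNr scale0r addr0 mulrC [- t + s]addrC.
  rewrite (_ : \int[mu]_x (f x * g' x) = \int[mu]_x (g' x * f x)); last by apply: eq_Rint => x; rewrite mulrC.
  rewrite -(RintB (L2M Lg' (L2_translate ((s - t) *: e) Lf)) (L2M Lg' Lf)).
  under eq_Rint do rewrite -mulrBr.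
  apply: (le_trans (Rint_increment_le (s - t) Lg' wf Lf')).
  rewrite ger0_norm ?subr_ge0// [_ * Num.sqrt (sqn mu f')]mulrC ler_wpM2r//.
  by rewrite lerBlDr lerDl.
set A := \int[mu]_x _ in T1 *; set B := \int[mu]_x _ in T2 *.
suff AB : `|A + B| = 0 by apply/eqP; rewrite -addr_eq0 -normr_eq0 AB.
apply/eqP; rewrite eq_le normr_ge0 andbT; apply/ler_addgt0Pl => eps eps0; rewrite addr0.
(* Small enough for the combined error 2 K s to stay below eps. *)
pose s := eps / (2 * K + 1).
have s0 : 0 < s by rewrite divr_gt0// ltr_wpDl// mulr_ge0.
have H : s * `|A + B| <= s * (s * (2 * K)).
  rewrite -{1}(gtr0_norm s0) -normrM (_ : s * (A + B) = - ((X s - s * A) + (- X s - s * B))); last by ring.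
  rewrite normrN (le_trans (ler_normD _ _))//.
  by have := T1 s s0; have := T2 s s0; lra.
move: H; rewrite ler_pM2l// => /le_trans; apply.
by rewrite /s mulrAC -mulrA ler_piMr ?ltW// ltr_pdivrMr ?ltr_wpDl ?mulr_ge0// mul1r ltrDl.
Qed.

End sobolev_basic.

Lemma le_Rint_ae d (T : measurableType d) (R : realType) (mu : {measure set T -> \bar R}) (f g : T -> R) :
  igr mu f -> igr mu g -> {ae mu, forall x, f x <= g x} -> \int[mu]_x f x <= \int[mu]_x g x.
Proof.
move=> fi gi fg; have mf := igr_measurable fi; have mg := igr_measurable gi.
pose h x := Num.max (f x) (g x).
have mh : measurable_fun setT h by exact: measurable_maxr.
have gh : {ae mu, forall x, g x = h x} by apply: filterS fg => x /max_idPr.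
rewrite (Rint_ae mg mh gh); apply: le_Rint => //; first exact: igr_ae mh gh gi.
by move=> x; rewrite le_max lexx.
Qed.

(** * Sobolev embedding *)

Section sobolev.
Context {R : realType} {n : nat}.
Local Notation E := 'rV[R]_n.
Local Notation mu := (volume n).
Local Notation leb := (@lebesgue_measure R).
Variables (f : E -> R) (h : 'I_n -> E -> R).
Hypotheses (Lf : L2 mu f) (wf : forall j, rwpd j f (h j)) (Lh : forall j, L2 mu (h j)).

(** The vector is reached one axis at a time; each step costs a factor 2 through (a + b)^2 <= 2 a^2
    + 2 b^2. *)
Lemma L2_increment_sum (y : 'I_n -> R) (s : seq 'I_n) (v := \sum_(j <- s) y j *: base_vec j) :
  L2 mu (fun x => f (x + v) - f x) /\
  sqn mu (fun x => f (x + v) - f x) <= 2 ^+ size s * \sum_(j <- s) y j ^+ 2 * sqn mu (h j).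
Proof.
rewrite /v {v}; elim: s => [|j s [L1 H1]].
  rewrite !big_nil mulr0 (_ : (fun x => _) = fun=> 0); last by apply/funext => x; rewrite addr0 subrr.
  by split; [exact: L2_0|rewrite /sqn; under eq_Rint do rewrite expr0n; rewrite Rint0].
rewrite !big_cons; set v := \sum_(_ <- _) _ in L1 H1 *.
have [L2' H2] := L2_increment (y j) (wf j) (Lh j).
pose a x := f (x + v + y j *: base_vec j) - f (x + v).
have La : L2 mu a by exact: (L2_translate v L2').
have sa : sqn mu a = sqn mu (fun x => f (x + y j *: base_vec j) - f x) by exact: (sqn_translate v L2').
have e : (fun x => f (x + (y j *: base_vec j + v)) - f x) = fun x => a x + (f (x + v) - f x).
  by apply/funext => x; rewrite /a [y j *: _ + v]addrC addrA; ring.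
rewrite e; split; first exact: L2D.
set b := fun x => f (x + v) - f x in L1 H1 *.
apply: (@le_trans _ _ (2 * sqn mu a + 2 * sqn mu b)).
  rewrite -(RintZ 2 (L2_igr La)) -(RintZ 2 (L2_igr L1)).
  have i1 := igrZ 2 (L2_igr La); have i2 := igrZ 2 (L2_igr L1).
  rewrite -(RintD i1 i2); apply: (le_Rint (L2_igr (L2D La L1)) (igrD i1 i2)) => x.
  by have := sqr_ge0 (a x - b x); rewrite -/(b x); nra.
rewrite sa /= exprS -mulrA -mulrDr ler_pM2l// mulrDr; apply: lerD => //.
apply: (le_trans H2); rewrite ler_peMl//; first by rewrite mulr_ge0 ?sqr_ge0 ?sqn_ge0.
by rewrite exprn_ege1// ler1n.
Qed.

(** The factor 2^n pays for the n axis-parallel steps of [L2_increment_sum]. *)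
Definition energy := 2 ^+ n * \sum_j sqn mu (h j).

Lemma energy_ge0 : 0 <= energy.
Proof. by rewrite mulr_ge0 ?exprn_ge0 ?sumr_ge0// => j _; exact: sqn_ge0. Qed.

Lemma L2_increment_cube (eps : R) (y : E) : (forall i, `|y ord0 i| <= eps) ->
  sqn mu (fun x => f (x + y) - f x) <= eps ^+ 2 * energy.
Proof.
move=> ye; have [_] := L2_increment_sum (fun j => y ord0 j) (index_enum 'I_n).
rewrite -(row_sum_delta y) => /le_trans; apply.
have -> : size (index_enum 'I_n) = n by rewrite -[RHS]card_ord cardE enumT.
rewrite /energy mulrCA ler_pM2l ?exprn_gt0// mulr_sumr; apply: ler_sum => j _.
apply: ler_wpM2r; first exact: sqn_ge0.
by rewrite -(real_normK (num_real (y ord0 j))) lerXn2r// nnegrE// (le_trans _ (ye j)).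
Qed.

Definition lev (a : R) (x : E) : R := \1_[set x | a < `|f x|] x.

Lemma measurable_lev_set (a : R) : measurable [set x | a < `|f x|].
Proof.
have mf : measurable_fun setT (fun x => `|f x|) by apply: measurableT_comp => //; case: Lf.
rewrite (_ : [set x | _] = (fun x => `|f x|) @^-1` `]a, +oo[%classic); last first.
  by apply/seteqP; split => x /=; rewrite in_itv/= andbT.
by rewrite -[X in measurable X]setTI; exact: mf.
Qed.

Lemma levE (a : R) x : lev a x = ((a < `|f x|)%R : bool)%:R.
Proof.
rewrite /lev indicE; congr (nat_of_bool _)%:R.
by apply/idP/idP => [|?]; rewrite inE.
Qed.

(** Chebyshev: the indicator is at most f^2 / a^2. *)
Lemma igr_lev (a : R) : 0 < a -> igr mu (lev a).
Proof.
move=> a0; apply: (le_igr _ _ (igrZ (a ^- 2) (L2_igr Lf))).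
  by apply: measurable_indic; exact: measurable_lev_set.
move=> x; rewrite levE normr_nat -(real_normK (num_real (f x))) -exprVn -exprMn.
case: ltP => [fa|_]; last by rewrite sqr_ge0.
by rewrite /= exprn_ege1// ler_pdivlMl// mulr1 ltW.
Qed.

(* Where |f(x)| > 2 m, either f differs from f(x) by about m on much of the box
   x + [0, eps]^n, or |f| > m / 2 on much of it; the moment bound excludes the
   latter, and the increments are controlled by the energy. *)
Lemma level_set_bound (q : nat) (m eps : R) : 0 < m -> 0 < eps -> (0 < q)%N ->
  igr mu (fun x => `|f x| ^+ q) ->
  \int[mu]_x `|f x| ^+ q <= eps ^+ n * (m / 2) ^+ q ->
  \int[mu]_x lev (2 * m) x <= energy * eps ^+ 2 / m ^+ 2.
Proof.
move=> m0 e0 q0 iq Mq.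
pose Q := box (fun=> 0) (fun=> eps) : set E.
have mQ : measurable Q by exact: measurable_box.
pose ph : E -> R := \1_Q.
have iph : igr mu ph by exact: igr_indic_box.
have Iph : \int[mu]_y ph y = eps ^+ n.
  rewrite /Rintegral integral_indic// setIT.
  apply: etrans (congr1 fine (@volume_box _ _ (fun=> 0) (fun=> eps) (fun=> ltW e0))) _.
  by rewrite /=; under eq_bigr do rewrite subr0; rewrite prodr_const card_ord.
pose D z := ph z.2 * (f (z.1 + z.2) - f z.1) ^+ 2.
have mf : measurable_fun setT f by case: Lf.
have mid : measurable_fun setT (fun y : E => y) by exact: measurable_id.
have mD : measurable_fun setT D.
  apply: measurable_funM; first by apply: measurableT_comp => //; exact: (igr_measurable iph).
  apply: measurable_funX; apply: measurable_funB; last exact: measurableT_comp.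
  exact: (measurable_shift_tau mid mf).
have ph01 y : 0 <= ph y by [].
have iD : igr2 mu mu D.
  have i1 := igr2_avg mid iph (L2_igr Lf).
  have i2 : igr2 mu mu (fun z => ph z.2 * f z.1 ^+ 2).
    apply: (igr2_prod _ _ (L2_igr Lf) iph).
      apply: measurable_funM; first by apply: measurableT_comp => //; exact: (igr_measurable iph).
      by apply: measurable_funX; exact: measurableT_comp.
    by move=> x y /=; rewrite (ger0_norm (mulr_ge0 (ph01 y) (sqr_ge0 (f x)))) mulrC.
  apply: (le_igr mD _ (igrZ 2 (igrD i1 i2))) => -[x y]; rewrite /D /=.
  rewrite (ger0_norm (mulr_ge0 (ph01 y) (sqr_ge0 _))) -mulrDr [leRHS]mulrCA.
  apply: ler_wpM2l => //.
  by have := sqr_ge0 (f (x + y) + f x); nra.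
have key : {ae mu, forall x, eps ^+ n * m ^+ 2 * lev (2 * m) x <= \int[mu]_y D (x, y)}.
  have := ae_igr_12 iD; apply: filterS => x ix.
  rewrite levE; case: ltP => [fx|_]; last by rewrite mulr0 Rint_ge0// => y; rewrite /D mulr_ge0 ?sqr_ge0.
  rewrite mulr1.
  have ifq : igr mu (fun y => `|f (x + y)| ^+ q).
    apply: (eq_igr _ (igr_translate x iq)) => y /=; by rewrite addrC.
  have Ifq : \int[mu]_y `|f (x + y)| ^+ q = \int[mu]_y `|f y| ^+ q.
    by rewrite -(Rint_translate x iq); apply: eq_Rint => y; rewrite addrC.
  (* With a = f(x + y) and 2 m < |f(x)| <= |f(x) - a| + |a|: the first term is at most (a - f(x))^2
     / (2 m) + m/2, the second at most m/2 + (m/2) (2 |a| / m)^q. What exceeds m is integrated over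
     the box. *)
  have H : \int[mu]_y (m * ph y) <= \int[mu]_y ((2 * m)^-1 * D (x, y) + (m / 2) / (m / 2) ^+ q * `|f (x + y)| ^+ q).
    apply: le_Rint; [exact: igrZ|by apply: igrD; exact: igrZ|] => y.
    rewrite /D /=; have -> : ph y = (y \in Q)%:R by rewrite /ph indicE.
    have z0 : 0 <= (m / 2) / (m / 2) ^+ q * `|f (x + y)| ^+ q.
      by rewrite mulr_ge0// ?exprn_ge0// divr_ge0// ?exprn_ge0// divr_ge0// ltW.
    case: (y \in Q); last by rewrite mulr0 mul0r mulr0 add0r.
    rewrite mulr1 mul1r; set a := f (x + y).
    have B1 : `|a| <= m / 2 + (m / 2) / (m / 2) ^+ q * `|a| ^+ q.
      have c0 : 0 < m / 2 by rewrite divr_gt0.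
      have [am|am] := leP `|a| (m / 2); first by rewrite ler_wpDr.
      apply: ler_wpDl; first exact: ltW.
      case: (q) q0 => // k _.
      have -> : m / 2 / (m / 2) ^+ k.+1 * `|a| ^+ k.+1 = `|a| * (`|a| / (m / 2)) ^+ k.
        move: c0; generalize (m / 2) => c c0; rewrite !exprS exprMn exprVn; field.
        by rewrite expf_neq0 ?(gt_eqF c0).
      rewrite ler_peMr// exprn_ege1// ler_pdivlMr// mul1r; exact: ltW.
    have B2 : `|f x - a| <= (2 * m)^-1 * (a - f x) ^+ 2 + m / 2.
      rewrite distrC -(real_normK (num_real (a - f x))); set d := `|a - f x|.
      rewrite -(ler_pM2l (_ : 0 < 2 * m)) ?mulr_gt0// mulrDr mulrA divff ?mul1r; last by rewrite gt_eqF// mulr_gt0.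
      by have := sqr_ge0 (d - m); nra.
    have := ler_normD (f x - a) a; rewrite subrK => B3.
    have := le_trans B3 (lerD B2 B1).
    move=> B4; have := lt_le_trans fx B4; lra.
  rewrite (RintZ _ iph) Iph RintD in H; [|exact: igrZ|exact: igrZ].
  rewrite (RintZ _ ix) (RintZ _ ifq) Ifq in H.
  (* By the moment bound this contribution is at most half of the left-hand side. *)
  have K1 : m / 2 / (m / 2) ^+ q * \int[mu]_y `|f y| ^+ q <= m / 2 * eps ^+ n.
    rewrite -mulrA ler_pM2l ?divr_gt0// mulrC ler_pdivrMr ?exprn_gt0 ?divr_gt0//.
  have := le_trans H (lerD (lexx _) K1).
  rewrite -lerBlDr (_ : m * eps ^+ n - m / 2 * eps ^+ n = (2 * m)^-1 * (m ^+ 2 * eps ^+ n)); last by field; rewrite gt_eqF.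
  by rewrite ler_pM2l ?invr_gt0 ?mulr_gt0// mulrC.
have m2 : 0 < 2 * m by rewrite mulr_gt0.
have Hx := le_Rint_ae (igrZ (eps ^+ n * m ^+ 2) (igr_lev m2)) (igr_Rint12 iD) key.
rewrite (Rint_Fubini iD) in Hx.
have Hy : \int[mu]_y \int[mu]_x D (x, y) <= \int[mu]_y (eps ^+ 2 * energy * ph y).
  apply: le_Rint; [exact: igr_Rint21|exact: igrZ|] => y.
  have -> : \int[mu]_x D (x, y) = ph y * sqn mu (fun x => f (x + y) - f x).
    rewrite /D /= -RintZ//; apply: L2_igr.
    by apply: L2B => //; exact: L2_translate.
  rewrite /ph indicE; case: (boolP (y \in Q)) => [|_]; last by rewrite mulr0 mul0r.
  rewrite inE mul1r mulr1 => Qy; apply: L2_increment_cube => i.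
  by have /andP[y0 ye] := Qy i; rewrite gtr0_norm// ltW.
have := le_trans Hx Hy.
rewrite (RintZ _ (igr_lev m2)) (RintZ _ iph) Iph.
rewrite [X in _ <= X]mulrC -mulrA ler_pM2l ?exprn_gt0// => H.
by rewrite ler_pdivlMr ?exprn_gt0// mulrC [energy * _]mulrC.
Qed.

(* Sum [level_set_bound] over the levels m = B^k with boxes of side e0 / D^k:
   D^n = B^q keeps the moment hypothesis true at every level, and
   2 B^r <= D^2 B^2 makes the resulting series geometric. *)
Lemma moment_igr (q r : nat) (B D : R) : (0 < q)%N -> (1 < r)%N -> (0 < n)%N -> 1 < B -> 0 < D ->
  D ^+ n = B ^+ q -> 2 * B ^+ r <= D ^+ 2 * B ^+ 2 ->
  igr mu (fun x => `|f x| ^+ q) -> igr mu (fun x => `|f x| ^+ r).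
Proof.
have alg (y x a e d b : R) : d != 0 -> b != 0 ->
    y * x * (a * (e / d) ^+ 2 / b ^+ 2) = y * (a * e ^+ 2) * (x / (d ^+ 2 * b ^+ 2)).
  by move=> d0 b0; field; rewrite d0 b0.
move=> q0 r1 n0 B1 D0 DB BD iq; have B0 : 0 < B by exact: lt_trans B1.
have mf : measurable_fun setT f by case: Lf.
have mfr : measurable_fun setT (fun x : E => `|f x| ^+ r).
  by apply: measurable_funX; exact: measurableT_comp.
pose M := \int[mu]_x `|f x| ^+ q.
have M0 : 0 <= M by apply: Rint_ge0 => x; rewrite exprn_ge0.
(* At every level the moment hypothesis of [level_set_bound] reduces to 2^q M <= e0^n, which holds
   because e0 >= 1. *)
pose e0 := 1 + 2 ^+ q * M.
have e01 : 1 <= e0 by rewrite lerDl mulr_ge0// exprn_ge0.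
have e0gt : 0 < e0 by exact: lt_le_trans e01.
pose c := (2 * B) ^+ r * (energy * e0 ^+ 2).
have c0 : 0 <= c.
  apply: mulr_ge0; first by rewrite exprn_ge0// mulr_ge0// ltW.
  by apply: mulr_ge0; [exact: energy_ge0|exact: sqr_ge0].
have levk k : \int[mu]_x lev (2 * B ^+ k) x <= energy * (e0 / D ^+ k) ^+ 2 / (B ^+ k) ^+ 2.
  apply: (@level_set_bound q) => //; [exact: exprn_gt0|by rewrite divr_gt0// exprn_gt0|].
  rewrite -/M expr_div_n -exprM mulnC exprM DB -!exprM expr_div_n -exprM mulnC.
  rewrite mulrA mulfVK ?expf_neq0 ?gt_eqF//.
  rewrite ler_pdivlMr ?exprn_gt0// mulrC (le_trans _ (ler_eXnr n0 e01))// lerDr.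
  exact: ler01.
(* Dominates |f|^r where 2 B^k < |f| <= 2 B^(k+1). *)
pose u k x := (2 * B ^+ k.+1) ^+ r * lev (2 * B ^+ k) x.
have u0 k x : 0 <= u k x by rewrite /u levE mulr_ge0// exprn_ge0// mulr_ge0// exprn_ge0// ltW.
have iu k : igr mu (u k) by apply: igrZ; apply: igr_lev; rewrite mulr_gt0// exprn_gt0.
have Iu k : \int[mu]_x u k x <= c / 2 ^+ k.
  rewrite (RintZ _ (igr_lev _)); last by rewrite mulr_gt0// exprn_gt0.
  apply: (@le_trans _ _ ((2 * B ^+ k.+1) ^+ r * (energy * (e0 / D ^+ k) ^+ 2 / (B ^+ k) ^+ 2))).
    by rewrite ler_wpM2l// exprn_ge0// mulr_ge0// exprn_ge0// ltW.
  rewrite (_ : _ * _ = c * (B ^+ r / (D ^+ 2 * B ^+ 2)) ^+ k); last first.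
    have -> : (2 * B ^+ k.+1) ^+ r = (2 * B) ^+ r * (B ^+ r) ^+ k by rewrite exprS mulrA exprMn exprAC.
    rewrite [(B ^+ r / _) ^+ k]exprMn exprVn [(D ^+ 2 * _) ^+ k]exprMn ![(_ ^+ 2) ^+ k]exprAC /c.
    have : D ^+ k != 0 by rewrite expf_neq0// gt_eqF.
    have : B ^+ k != 0 by rewrite expf_neq0// gt_eqF.
    by move=> b0' d0'; apply: alg.
  have DB0 : 0 < D ^+ 2 * B ^+ 2 by rewrite mulr_gt0// exprn_gt0.
  rewrite -exprVn; apply: ler_wpM2l => //; apply: lerXn2r; rewrite ?nnegrE ?invr_ge0 ?ler0n//.
    by rewrite divr_ge0 ?exprn_ge0// ltW.
  rewrite (ler_pdivrMr _ _ DB0).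
  by rewrite -(ler_pM2l (_ : 0 < 2))// mulrA divff// mul1r.
(* Where |f| <= 2 the square of f suffices; a larger value belongs to some level k and is dominated
   by the single term u k. *)
have ptw x : ((`|f x| ^+ r)%:E <= (2 ^+ r * f x ^+ 2)%:E + \sum_(0 <= k <oo) (u k x)%:E)%E.
  have S0 : (0 <= \sum_(0 <= k <oo) (u k x)%:E)%E by apply: nneseries_ge0 => k _ _; rewrite lee_fin.
  have [f2|f2] := leP `|f x| 2.
    apply: (@le_trans _ _ (2 ^+ r * f x ^+ 2)%:E); last by rewrite leeDl.
    rewrite lee_fin -(real_normK (num_real (f x))) -(subnK r1) exprD; apply: ler_wpM2r; first exact: sqr_ge0.
    rewrite exprD (le_trans (_ : _ <= 2 ^+ (r - 2)))//; first by rewrite lerXn2r// nnegrE.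
    by rewrite ler_peMr ?exprn_ge0// -natrX ler1n.
  have [k [k1 k2]] : exists k, 2 * B ^+ k < `|f x| /\ `|f x| <= 2 * B ^+ k.+1.
    have ex : exists k, `|f x| <= 2 * B ^+ k.
      have Bi : `|B^-1| < 1 by rewrite gtr0_norm ?invr_gt0// invf_lt1.
      have f0 : 0 < 2 / `|f x| by rewrite divr_gt0// (lt_trans _ f2).
      have /cvgrPdist_lt/(_ _ f0) := cvg_expr Bi.
      move=> [k _ /(_ k (leqnn k))]; rewrite sub0r normrN gtr0_norm ?exprn_gt0 ?invr_gt0// => H; exists k.
      move: H; rewrite ltr_pdivlMr ?(lt_trans _ f2)// exprVn mulrC ltr_pdivrMr ?exprn_gt0//.
      exact: ltW.
    case: (ex_minnP ex) => -[|k] fk mk.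
      by move: fk; rewrite expr0 mulr1 leNgt f2.
    exists k; split => //; rewrite ltNge; apply/negP => /mk; by rewrite ltnn.
  apply: (@le_trans _ _ (\sum_(0 <= k <oo) (u k x)%:E)%E); last by rewrite leeDr// lee_fin mulr_ge0 ?sqr_ge0 ?exprn_ge0.
  apply: (@le_trans _ _ (\sum_(0 <= i < k.+1) (u i x)%:E)%E); last first.
    by apply: nneseries_lim_ge => i _ _; rewrite lee_fin.
  rewrite sumEFin lee_fin big_nat_recr//= ler_wpDl ?sumr_ge0//.
  by rewrite /u levE k1 mulr1; apply: lerXn2r; rewrite ?nnegrE// mulr_ge0// exprn_ge0// ltW.
apply: ge0_igr => //.
have mEu k : measurable_fun setT (fun x : E => (u k x)%:E) by apply/measurable_EFinP; exact: igr_measurable (iu k).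
have mS : measurable_fun setT (fun x : E => (\sum_(0 <= k <oo) (u k x)%:E)%E).
  by apply: ge0_emeasurable_sum => // k x _ _; rewrite lee_fin.
have m2 : measurable_fun setT (fun x : E => (2 ^+ r * f x ^+ 2)%:E).
  by apply/measurable_EFinP; apply: measurable_funM => //; exact: measurable_funX.
apply: (@le_lt_trans _ _ (\int[mu]_x ((2 ^+ r * f x ^+ 2)%:E + \sum_(0 <= k <oo) (u k x)%:E))%E).
  apply: ge0_le_integral => //; first exact/measurable_EFinP.
  exact: emeasurable_funD.
rewrite ge0_integralD//; first last.
- by move=> x _; apply: nneseries_ge0 => k _ _; rewrite lee_fin.
- by move=> x _; rewrite lee_fin mulr_ge0 ?sqr_ge0 ?exprn_ge0.
apply: lte_add_pinfty.
  rewrite -(EFin_Rint (igrZ (2 ^+ r) (L2_igr Lf))); exact: ltry.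
rewrite integral_nneseries//; last by move=> k x _; rewrite lee_fin.
apply: (@le_lt_trans _ _ (\sum_(0 <= k <oo) (c / 2 ^+ k)%:E)%E).
  apply: lee_nneseries => k _; first by move=> _; apply: integral_ge0 => x _; rewrite lee_fin.
  by rewrite -(EFin_Rint (iu k)) lee_fin.
have h2 : `|2^-1 : R| < 1 by rewrite gtr0_norm// invf_lt1// ltr1n.
have cv := @cvg_geometric_series R c 2^-1 h2.
rewrite (_ : (\sum_(0 <= k <oo) _)%E = (c / (1 - 2^-1))%:E); first exact: ltry.
apply/cvg_lim => //; under eq_cvg do rewrite sumEFin.
apply: cvg_EFin; first by near=> k.
rewrite (_ : _ \o _ = series (geometric c 2^-1))//.
by apply/funext => k; rewrite /series /geometric/=; apply: eq_bigr => i _; rewrite exprVn.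
Unshelve. all: by end_near. Qed.

End sobolev.

Section sobolev_embedding.
Context {R : realType}.

(** In dimension 2 each application raises the exponent by one: D^2 = B^(q+2), hence D^2 B^2 =
    B^(q+4) >= 2 B^(q+3) as soon as B >= 2. *)
Lemma sobolev_moment2 (f : 'rV[R]_2 -> R) (h : 'I_2 -> 'rV[R]_2 -> R) (q : nat) :
  L2 (volume 2) f -> (forall j, rwpd j f (h j)) -> (forall j, L2 (volume 2) (h j)) ->
  igr (volume 2) (fun x => `|f x| ^+ q.+2).
Proof.
move=> Lf wf Lh; elim: q => [|q IH].
  by apply: eq_igr (L2_igr Lf) => x; rewrite real_normK ?num_real.
apply: (moment_igr Lf wf Lh (q := q.+2) (B := 4) (D := 2 ^+ q.+2)) => //.
- by rewrite ltr1n.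
- by rewrite exprAC -natrX.
- rewrite [X in _ <= X * _]exprAC (_ : 2 ^+ 2 = 4) ?exprS; last by ring.
  have := exprn_ge0 q (ler0n R 4); move: (4 ^+ q) => x; lra.
Qed.

(** One application leads from the second to the third moment: 4^3 = 8^2 and 2 * 8^3 = 4^2 * 8^2.
    This is below the critical exponent 6 but covers p + 1 < 3. *)
Lemma sobolev_moment3 (f : 'rV[R]_3 -> R) (h : 'I_3 -> 'rV[R]_3 -> R) :
  L2 (volume 3) f -> (forall j, rwpd j f (h j)) -> (forall j, L2 (volume 3) (h j)) ->
  igr (volume 3) (fun x => `|f x| ^+ 3).
Proof.
move=> Lf wf Lh; apply: (moment_igr Lf wf Lh (q := 2) (B := 8) (D := 4)) => //.
- by rewrite ltr1n.
- by ring.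
- by rewrite -!natrX -!natrM ler_nat.
- by apply: eq_igr (L2_igr Lf) => x; rewrite real_normK ?num_real.
Qed.

(** |f|^r is at most f^2 where |f| <= 1 and at most |f|^m elsewhere. *)
Lemma igr_powR_interpolation d (T : measurableType d) (mu : {measure set T -> \bar R}) (f : T -> R) (m : nat) (r : R) :
  2 <= r -> r <= m%:R -> L2 mu f -> igr mu (fun x => `|f x| ^+ m) -> igr mu (fun x => `|f x| `^ r).
Proof.
move=> r2 rm Lf im; have mf : measurable_fun setT f by case: Lf.
apply: (le_igr _ _ (igrD (L2_igr Lf) im)).
  by apply: (measurableT_comp (measurable_powR _)); exact: measurableT_comp.
move=> x; rewrite (ger0_norm (powR_ge0 _ _)) -(real_normK (num_real (f x))) -!powR_mulrn//.
have [f1|f1] := leP `|f x| 1.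
  rewrite ler_wpDr ?powR_ge0//; have [->|f0] := eqVneq `|f x| 0.
    by rewrite powR0 ?powR_ge0// gt_eqF// (lt_le_trans _ r2).
  by apply: ger_powR => //; rewrite f1 andbT lt_neqAle eq_sym f0 normr_ge0.
by rewrite ler_wpDl ?powR_ge0//; apply: ler_powR => //; exact: ltW.
Qed.

End sobolev_embedding.

(** * Heat kernel and Green function *)

Section integrable_decay.
Context {R : realType}.
Local Notation leb := (@lebesgue_measure R).

Lemma FTC_itv (F f : R -> R) (a b : R) : a < b ->
  (forall x, a <= x -> x <= b -> {for x, continuous f}) ->
  (forall x, a <= x -> x <= b -> is_derive x (1 : R) F (f x)) ->
  igr leb (fun t => \1_(`[a, b]%classic : set R) t * f t) /\
  \int[leb]_t (\1_(`[a, b]%classic : set R) t * f t) = F b - F a.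
Proof.
move=> ab cf dF.
have cF x : a <= x -> x <= b -> {for x, continuous F}.
  by move=> ax xb; apply: differentiable_continuous; apply/derivable1_diffP; case: (dF x ax xb).
have cfw : {within `[a, b], continuous f}.
  by apply: continuous_in_subspaceT => x; rewrite inE/= in_itv/= => /andP[ax xb]; exact: cf.
split.
  have := continuous_compact_integrable (@segment_compact _ a b) cfw.
  rewrite integrable_mkcond//; apply: eq_integrable => // t _.
  by rewrite /= patchE indicE; case: (_ \in _); rewrite ?mul1r ?mul0r.
rewrite -Rint_indic_itv /Rintegral (@continuous_FTC2 _ _ F)//.
- split; first by move=> x; rewrite in_itv/= => /andP[/ltW ax /ltW xb]; case: (dF x ax xb).
    exact: cvg_at_right_filter (cF a (lexx _) (ltW ab)).
  exact: cvg_at_left_filter (cF b (ltW ab) (lexx _)).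
- by move=> x; rewrite in_itv/= => /andP[/ltW ax /ltW xb]; rewrite derive1E; case: (dF x ax xb).
Qed.

(** Fatou's lemma along the truncations of f to the sets D k; at a zero of f every truncation
    already has the right value. *)
Lemma igr_exhaust d (T : measurableType d) (mu : {measure set T -> \bar R}) (f : T -> R)
    (D : nat -> set T) (C : R) : measurable_fun setT f -> (forall x, 0 <= f x) ->
  (forall k, measurable (D k)) -> (forall x, f x != 0 -> \forall k \near \oo, D k x) ->
  (forall k, igr mu (fun x => \1_(D k) x * f x)) -> (forall k, \int[mu]_x (\1_(D k) x * f x) <= C) ->
  igr mu f.
Proof.
move=> mf f0 mD fD iD DC.
pose u k x := (\1_(D k) x * f x)%:E.
have u0 k x : (0 <= u k x)%E by rewrite lee_fin mulr_ge0.
have mu_ k : measurable_fun setT (u k).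
  by apply/measurable_EFinP; exact: igr_measurable (iD k).
have uf x : (f x)%:E = limn_einf (u ^~ x).
  have : u ^~ x @ \oo --> (f x)%:E.
    have [fx0|fx0] := eqVneq (f x) 0.
      by rewrite (_ : u ^~ x = fun=> (f x)%:E) => [|]; [exact: cvg_cst|apply/funext => k; rewrite /u fx0 mulr0].
    apply: cvg_near_cst; apply: filterS (fD x fx0) => k Dk.
    by rewrite /u indicE mem_set// mul1r.
  by move=> /cvg_limn_einf_sup[].
apply: ge0_igr => //.
apply: (@le_lt_trans _ _ (limn_einf (fun k => \int[mu]_x u k x)%E)).
  under eq_integral do rewrite uf.
  by apply: fatou.
apply: (@le_lt_trans _ _ C%:E); last exact: ltry.
rewrite limn_einf_lim; apply: lime_le; first exact: is_cvg_einfs.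
near=> k; apply: (@le_trans _ _ (\int[mu]_x u k x)%E).
  by apply: ereal_inf_lbound; exists k => /=.
by rewrite -(EFin_Rint (iD k)) lee_fin.
Unshelve. all: by end_near. Qed.

Lemma lebesgue_measure_opp (A : set (measurableTypeR R)) : measurable A ->
  pushforward leb ((fun x => - x) : measurableTypeR R -> measurableTypeR R) A = lebesgue_measure A.
Proof.
move=> mA.
have ms : measurable_fun setT ((fun x => - x) : measurableTypeR R -> measurableTypeR R).
  exact: oppr_measurable.
pose f : {mfun (measurableTypeR R) >-> (measurableTypeR R)} :=
  HB.pack (fun x : measurableTypeR R => - x) (isMeasurableFun.Build _ _ _ _ _ ms).
apply/esym; apply: (@lebesgue_measure_unique R (pushforward leb f)) => //= _ [[b c]] _ <-.
rewrite /pushforward.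
have -> : f @^-1` `]b, c]%classic = (`[(- c), (- b)[)%classic.
  by apply/seteqP; split=> x /=; rewrite !in_itv/= andbC lerNl ltrNr.
rewrite !lebesgue_measure_itv/= !lte_fin ltrN2; case: ifP => // _.
by rewrite -!EFinD opprK addrC.
Qed.

Lemma igr_oppr (f : R -> R) : igr leb f -> igr leb (fun x => f (- x)).
Proof.
move=> fi; have mf := igr_measurable fi.
have ms : measurable_fun setT ((fun x => - x) : measurableTypeR R -> measurableTypeR R).
  exact: oppr_measurable.
pose s : {mfun (measurableTypeR R) >-> (measurableTypeR R)} :=
  HB.pack (fun x : measurableTypeR R => - x) (isMeasurableFun.Build _ _ _ _ _ ms).
have mfs : measurable_fun setT (fun x : measurableTypeR R => f (- x)) by exact: (measurableT_comp mf ms).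
have mnf : measurable_fun setT (fun x : measurableTypeR R => (`|f x|)%:E).
  by apply/measurable_EFinP; exact: measurableT_comp.
apply/igrP => //; move/igrP : fi => /(_ mf).
rewrite (_ : (\int[leb]_x (`|f x|)%:E)%E = (\int[leb]_x (`|f (- x)|)%:E)%E)//.
transitivity (\int[pushforward leb s]_x (`|f x|)%:E)%E; last by rewrite ge0_integral_pushforward.
by apply: eq_measure_integral => //= A mA _; rewrite -lebesgue_measure_opp.
Qed.

Lemma powR_continuous_at (c x : R) : 0 < x -> {for x, continuous (fun t : R => t `^ c)}.
Proof.
move=> x0; apply: differentiable_continuous; apply/derivable1_diffP.
by have := is_derive1_powR c x0; case.
Qed.

Lemma Rint_powR_itv (c a b : R) : 0 < a -> a < b -> c + 1 != 0 ->
  igr leb (fun t => \1_(`[a, b]%classic : set R) t * t `^ c) /\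
  \int[leb]_t (\1_(`[a, b]%classic : set R) t * t `^ c) = (c + 1)^-1 * b `^ (c + 1) - (c + 1)^-1 * a `^ (c + 1).
Proof.
move=> a0 ab c1; apply: (@FTC_itv (fun t => (c + 1)^-1 * t `^ (c + 1))) => // x ax _.
  by apply: powR_continuous_at; exact: lt_le_trans ax.
have x0 : 0 < x by exact: lt_le_trans ax.
have := is_derive_scale (c + 1)^-1 (is_derive1_powR (c + 1) x0).
by rewrite mulrA mulVf// mul1r addrK.
Qed.

(** A profile integrable on the half-line for 0 < b < 1. It bounds the heat kernel both in time and
    in each space coordinate. *)
Definition decay (b t : R) : R := if t <= 1 then t `^ (- b) else t `^ (- 2).

Lemma decay_ge0 b t : 0 <= decay b t.
Proof. by rewrite /decay; case: ifP => _; exact: powR_ge0. Qed.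

Lemma measurable_decay b : measurable_fun setT (decay b).
Proof.
apply: measurable_fun_ifT; last 2 first.
- exact: measurable_powR.
- exact: measurable_powR.
exact: measurable_fun_ler.
Qed.

Lemma igr_decay (b : R) : 0 < b -> b < 1 -> igr leb (fun y => decay b `|y|).
Proof.
move=> b0 b1; pose P (t : R) := if 0 < t then decay b t else 0.
have mP : measurable_fun setT P.
  apply: measurable_fun_ifT; [exact: measurable_fun_ltr|exact: measurable_decay|exact: measurable_cst].
have P0 t : 0 <= P t by rewrite /P; case: ifP => // _; exact: decay_ge0.
have Db1 : - b + 1 != 0 by rewrite gt_eqF// addrC subr_gt0.
have D21 : - 2 + 1 != 0 :> R by rewrite -[X in X != _]opprK opprD opprK oppr_eq0 (_ : 2 - 1 = 1) ?oner_eq0//; ring.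
have a0 k : 0 < (k.+2%:R : R)^-1 by [].
have a1 k : (k.+2%:R : R)^-1 < 1 by rewrite invf_lt1// ltr1n.
have a2 k : 1 < k.+2%:R :> R by rewrite ltr1n.
pose D (k : nat) : set R := `[k.+2%:R^-1, k.+2%:R]%classic.
have le_P k t : `|\1_(D k) t * P t| <=
    \1_(`[k.+2%:R^-1, 1]%classic : set R) t * t `^ (- b) + \1_(`[1, k.+2%:R]%classic : set R) t * t `^ (- 2).
  have -> : `|\1_(D k) t * P t| = \1_(D k) t * P t by apply/normr_idP; apply: mulr_ge0.
  rewrite !indicE !mem_setE !in_itv/= /P /decay.
  have z1 := powR_ge0 t (- b); have z2 := powR_ge0 t (- 2).
  case: (lerP t 1) => t1; case: (lerP 1 t) => t1'; case: (lerP _ t) => ta; case: (lerP t k.+2%:R) => tk /=;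
    rewrite ?mul1r ?mul0r ?addr0 ?add0r//; case: (ltP 0 t) => t0 /=; rewrite ?mul1r ?mul0r ?addr0 ?add0r ?addr_ge0 ?lerDl//;
    by have := a1 k; have := a2 k; have := a0 k; lra.
have iDP k : igr leb (fun t => \1_(D k) t * P t).
  have [i1 _] := Rint_powR_itv (a0 k) (a1 k) Db1.
  have [i2 _] := Rint_powR_itv (ltr01) (a2 k) D21.
  apply: (le_igr _ _ (igrD i1 i2)); last exact: le_P.
  by apply: measurable_funM => //; apply: measurable_indic; exact: measurable_itv.
have iP : igr leb P.
  apply: (@igr_exhaust _ _ leb P D ((- b + 1)^-1 + 1)) => //.
  - move=> k; exact: measurable_itv.
  - move=> x; rewrite /P; case: ltP => [x0 _|]; last by rewrite eqxx.
    near=> k; have kk : k%:R <= k.+2%:R :> R by rewrite ler_nat (leq_trans (leqnSn _) (leqnSn _)).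
    rewrite /D /= in_itv/=; apply/andP; split.
      rewrite -[leRHS]invrK lef_pV2 ?posrE ?invr_gt0//; apply: le_trans kk.
      by near: k; exact: nbhs_infty_ger.
    by apply: le_trans kk; near: k; exact: nbhs_infty_ger.
  - move=> k; have [i1 e1] := Rint_powR_itv (a0 k) (a1 k) Db1.
    have [i2 e2] := Rint_powR_itv (ltr01) (a2 k) D21.
    apply: (@le_trans _ _ (\int[leb]_t (\1_(`[k.+2%:R^-1, 1]%classic : set R) t * t `^ (- b) +
        \1_(`[1, k.+2%:R]%classic : set R) t * t `^ (- 2)))).
      apply: le_Rint => //; first exact: igrD.
      by move=> t; apply: le_trans (le_P k t); exact: ler_norm.
    rewrite (RintD i1 i2) e1 e2 !powR1 !mulr1; apply: lerD.
      by rewrite gerBl mulr_ge0 ?powR_ge0// invr_ge0 addrC subr_ge0 ltW.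
    rewrite (_ : (- 2 + 1)^-1 = - 1 :> R); last by field.
    by rewrite opprK !mulN1r addrC gerDl oppr_le0 powR_ge0.
apply: (le_igr _ _ (igrD iP (igr_oppr iP))).
  by apply: (measurableT_comp (measurable_decay b)); exact: normr_measurable.
move=> y; rewrite ger0_norm ?decay_ge0// /P oppr_gt0.
case: ltrgt0P => y0; rewrite ?addr0 ?add0r//.
(* [powR] sends 0 with a nonzero exponent to 0, so at the origin both sides vanish. *)
by rewrite /decay ler01 powR0// oppr_eq0 gt_eqF.
Unshelve. all: by end_near. Qed.

End integrable_decay.

(** * Gaussians, their moments and derivatives *)

Section gaussian.
Context {R : realType} {n : nat}.
Local Notation E := 'rV[R]_n.
Local Notation mu := (volume n).
Local Notation leb := (@lebesgue_measure R).

Lemma igr_tensor (m : 'I_n -> R -> R) : (forall i x, 0 <= m i x) -> (forall i, igr leb (m i)) ->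
  igr mu (fun x : E => \prod_i m i (x ord0 i)) /\
  \int[mu]_x \prod_i m i (x ord0 i) = \prod_i \int[leb]_x m i x.
Proof.
move=> m0 im; have mm i : measurable_fun setT (m i : measurableTypeR R -> R) by exact: igr_measurable (im i).
have P : (\int[mu]_x (\prod_i m i (x ord0 i))%:E = (\prod_i \int[leb]_x m i x)%:E)%E.
  rewrite (ge0_integral_tensor mm m0) (big_morph EFin EFinM (erefl _)).
  by apply: eq_bigr => i _; rewrite (EFin_Rint (im i)).
split; last by rewrite /Rintegral P.
apply: ge0_igr; [exact: measurable_tensor|by move=> x; exact: prodr_ge0|by rewrite P ltry].
Qed.

(** Up to a constant this is the normal density of variance 1 / (2 a). *)
Lemma igr_gauss1 (a : R) : 0 < a -> igr leb (fun y => expR (- (a * y ^+ 2))) /\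
  \int[leb]_y expR (- (a * y ^+ 2)) = Num.sqrt (pi / a).
Proof.
move=> a0; pose s := Num.sqrt (2 * a)^-1.
have a20 : 0 < (2 * a)^-1 by rewrite invr_gt0 mulr_gt0.
have s0 : s != 0 by rewrite gt_eqF// sqrtr_gt0.
have s2 : s ^+ 2 = (2 * a)^-1 by rewrite sqr_sqrtr// ltW.
have p0 : 0 < Num.sqrt (pi / a) by rewrite sqrtr_gt0 divr_gt0// pi_gt0.
have e y : normal_pdf 0 s y = (Num.sqrt (pi / a))^-1 * expR (- (a * y ^+ 2)).
  rewrite normal_pdfE// /normal_peak /normal_fun s2 subr0; congr (_^-1 * expR _).
    by congr (Num.sqrt _); rewrite -mulr_natl; field; rewrite gt_eqF.
  by rewrite -[(2 * a)^-1 *+ 2]mulr_natl; field; rewrite gt_eqF.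
have e' y : expR (- (a * y ^+ 2)) = Num.sqrt (pi / a) * normal_pdf 0 s y.
  by rewrite e mulVKf// gt_eqF.
have ip : igr leb (normal_pdf 0 s) by exact: integrable_normal_pdf.
split; first by apply: (eq_igr _ (igrZ (Num.sqrt (pi / a)) ip)) => y; rewrite e'.
under eq_Rint do rewrite e'.
by rewrite (RintZ _ ip) /Rintegral (integral_normal_pdf 0 s) /= mulr1.
Qed.

Definition sqsum (x : E) := \sum_i x ord0 i ^+ 2.

Lemma sqsum_ge0 x : 0 <= sqsum x.
Proof. by apply: sumr_ge0 => i _; exact: sqr_ge0. Qed.

Lemma le_sqsum (x : E) i : x ord0 i ^+ 2 <= sqsum x.
Proof. by rewrite /sqsum (bigD1 i)//= lerDl sumr_ge0// => k _; exact: sqr_ge0. Qed.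

Definition gauss (a : R) (x : E) := expR (- (a * sqsum x)).

Lemma gauss_ge0 a x : 0 <= gauss a x.
Proof. exact: expR_ge0. Qed.

Lemma gauss_tensor a x : gauss a x = \prod_i expR (- (a * x ord0 i ^+ 2)).
Proof. by rewrite /gauss /sqsum mulr_sumr -sumrN expR_sum. Qed.

Lemma le_gauss a b x : a <= b -> gauss b x <= gauss a x.
Proof. by move=> ab; rewrite ler_expR lerN2 ler_wpM2r// sqsum_ge0. Qed.

Lemma igr_gauss a : 0 < a -> igr mu (gauss a) /\ \int[mu]_x gauss a x = Num.sqrt (pi / a) ^+ n.
Proof.
move=> a0; have [i1 e1] := igr_gauss1 a0.
have [i2 e2] := igr_tensor (fun (_ : 'I_n) y => expR_ge0 (- (a * y ^+ 2))) (fun=> i1).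
split; first by apply: (eq_igr _ i2) => x; rewrite gauss_tensor.
under eq_Rint do rewrite gauss_tensor.
by rewrite e2 e1 prodr_const card_ord.
Qed.

Lemma gauss_sqr a x : gauss a x ^+ 2 = gauss (2 * a) x.
Proof. by rewrite /gauss expr2 -expRD; congr expR; ring. Qed.

Lemma L2_gauss a : 0 < a -> L2 mu (gauss a).
Proof.
move=> a0; apply: L2P; first exact: igr_measurable (igr_gauss a0).1.
by apply: (eq_igr _ (igr_gauss (_ : 0 < 2 * a)).1) => [x|]; rewrite ?gauss_sqr// mulr_gt0.
Qed.

(** The exponential is split into two halves: one absorbs the polynomial through y <= e^y, the other
    remains. *)
Lemma le_poly_gauss (p A B a : R) x : 0 < a -> 0 <= A -> 0 <= B -> `|p| <= A + B * sqsum x ->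
  `|p * gauss a x| <= (A + B * (2 / a)) * gauss (a / 2) x.
Proof.
move=> a0 A0 B0 pAB; rewrite normrM (ger0_norm (gauss_ge0 _ _)).
have a2 : a = a / 2 + a / 2 by field.
have e : gauss a x = gauss (a / 2) x * gauss (a / 2) x by rewrite /gauss -expRD -opprD -mulrDl -a2.

rewrite e mulrA; apply: ler_wpM2r; first exact: gauss_ge0.
have g1 : gauss (a / 2) x <= 1 by rewrite -expR0 ler_expR oppr_le0 mulr_ge0 ?sqsum_ge0// divr_ge0// ltW.
have g2 : sqsum x * gauss (a / 2) x <= 2 / a.
  rewrite /gauss expRN ler_pdivrMr ?expR_gt0// -ler_pdivrMl ?divr_gt0// invf_div.
  by apply: le_trans (expR_ge1Dx _); rewrite lerDr.
apply: (@le_trans _ _ ((A + B * sqsum x) * gauss (a / 2) x)).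
  by apply: ler_wpM2r => //; exact: gauss_ge0.
rewrite mulrDl -mulrA; apply: lerD; last exact: ler_wpM2l.
by rewrite ler_piMr.
Qed.

Lemma is_derive_sqsum j x : is_derive x (base_vec j) sqsum (2 * x ord0 j).
Proof.
pose C := \sum_(i | i != j) x ord0 i ^+ 2.
apply: (@is_derive_line _ _ _ (fun t => t * t + C) _ _ (x ord0 j)).
  move=> h; rewrite /sqsum (bigD1 j)//= base_vecE eqxx mulr1 expr2; congr (_ + _).
  by apply: eq_bigr => i /negbTE ij; rewrite base_vecE ij mulr0 add0r.
have := is_derive_add (is_derive_mul (is_derive_idr (x ord0 j)) (is_derive_idr (x ord0 j))) (is_derive_constant C (x ord0 j) 1).
by rewrite (_ : _ + _ = 2 * x ord0 j)//; ring.
Qed.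

Lemma is_derive_expV (f : E -> R) j x l : is_derive x (base_vec j) f l ->
  is_derive x (base_vec j) (fun y => expR (f y)) (l * expR (f x)).
Proof.
move=> df; apply: (@is_derive_line _ _ _ (fun t => expR (f (t *: base_vec j + x))) _ _ 0).
  by move=> h; rewrite addr0.
have d1 : is_derive (0 : R) (1 : R) (fun t => f (t *: base_vec j + x)) l.
  by apply: is_derive_along; rewrite scale0r add0r.
have := @is_derive_comp1 R expR (fun t => f (t *: base_vec j + x)) 0 (expR (f x)) l.
rewrite scale0r add0r => H; apply: H => //; exact: is_derive_expR.
Qed.

Lemma is_derive_gauss a j x : is_derive x (base_vec j) (gauss a) (- (2 * a) * x ord0 j * gauss a x).
Proof.
have := is_derive_expV (is_derive_opp (is_derive_scale a (is_derive_sqsum j x))).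
by rewrite (_ : - (a * _) * _ = - (2 * a) * x ord0 j * gauss a x)// /gauss; ring.
Qed.

Definition dgauss a j (x : E) := - (2 * a) * x ord0 j * gauss a x.
Definition ddgauss a j (x : E) := (4 * a ^+ 2 * x ord0 j ^+ 2 - 2 * a) * gauss a x.

Lemma is_derive_dgauss a j x : is_derive x (base_vec j) (dgauss a j) (ddgauss a j x).
Proof.
have dx : is_derive x (base_vec j) (fun y : E => - (2 * a) * y ord0 j) (- (2 * a)).
  apply: (@is_derive_line _ _ _ (fun t => - (2 * a) * t) _ _ (x ord0 j)).
    by move=> h; rewrite base_vecE eqxx mulr1.
  by have := is_derive_scale (- (2 * a)) (is_derive_idr (x ord0 j)); rewrite mulr1.
have := is_derive_mul dx (is_derive_gauss a j x).
by rewrite (_ : _ + _ = ddgauss a j x)// /ddgauss; ring.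
Qed.

Lemma continuous_sqsum : continuous sqsum.
Proof.
rewrite /sqsum; elim: (index_enum 'I_n) => [|i s IH].
  by rewrite (_ : (fun x => _) = fun=> 0); [exact: cst_continuous|apply/funext => x; rewrite big_nil].
rewrite (_ : (fun x => _) = fun x : E => x ord0 i ^+ 2 + \sum_(j <- s) x ord0 j ^+ 2); last by apply/funext => x; rewrite big_cons.
apply: continuous_addr => //.
by apply: continuous_mulr; exact: coord_cont.
Qed.

Lemma continuous_gauss a : continuous (gauss a).
Proof.
move=> x; apply: (@continuous_comp _ _ _ (fun x => - (a * sqsum x)) expR); last exact: continuous_expR.
rewrite (_ : (fun x => _) = fun x => - a * sqsum x); last by apply/funext => y; rewrite mulNr.
by apply: continuous_mulr; [exact: cst_continuous|exact: continuous_sqsum].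
Qed.

Lemma continuous_dgauss a j : continuous (dgauss a j).
Proof.
apply: continuous_mulr; last exact: continuous_gauss.
apply: continuous_mulr; last exact: coord_cont.
exact: cst_continuous.
Qed.

Lemma continuous_ddgauss a j : continuous (ddgauss a j).
Proof.
apply: continuous_mulr; last exact: continuous_gauss.
apply: continuous_addr; last exact: cst_continuous.
apply: continuous_mulr; first exact: cst_continuous.
by apply: continuous_mulr; exact: coord_cont.
Qed.

Lemma rwpd_derive (f g : E -> R) j : continuous f -> continuous g ->
  (forall x, is_derive x (base_vec j) f (g x)) -> rwpd j f g.
Proof.
move=> cf cg df; have e : pderiv j f = g by apply/funext => x; exact: pderiv_is_derive.
by rewrite -e; apply: (rwpd_C1 cf); [move=> x; case: (df x)|rewrite e].
Qed.

Lemma rwpd_gauss a j : rwpd j (gauss a) (dgauss a j).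
Proof.
apply: rwpd_derive; [exact: continuous_gauss|exact: continuous_dgauss|].
by move=> x; exact: is_derive_gauss.
Qed.

Lemma rwpd_dgauss a j : rwpd j (dgauss a j) (ddgauss a j).
Proof.
apply: rwpd_derive; [exact: continuous_dgauss|exact: continuous_ddgauss|].
by move=> x; exact: is_derive_dgauss.
Qed.

Lemma L2_poly_gauss (p : E -> R) (A B a : R) : 0 < a -> 0 <= A -> 0 <= B ->
  continuous (fun x => p x * gauss a x) -> (forall x, `|p x| <= A + B * sqsum x) -> L2 mu (fun x => p x * gauss a x).
Proof.
move=> a0 A0 B0 cp pAB; have a20 : 0 < a / 2 by rewrite divr_gt0.
apply: (le_L2 _ _ (L2Z (A + B * (2 / a)) (L2_gauss a20))).
  exact: continuous_row_measurable.
by move=> x; exact: le_poly_gauss.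
Qed.

Lemma L2_dgauss a j : 0 < a -> L2 mu (dgauss a j).
Proof.
move=> a0; apply: (L2_poly_gauss (p := fun x => - (2 * a) * x ord0 j) (A := 2 * a) (B := 2 * a)) => //.
- by rewrite mulr_ge0// ltW.
- by rewrite mulr_ge0// ltW.
- exact: continuous_dgauss.
- move=> x; have a2 : 0 <= 2 * a by rewrite mulr_ge0// ltW.
  rewrite normrM normrN (ger0_norm a2) -{2}(mulr1 (2 * a)) -mulrDr; apply: ler_wpM2l => //.
  apply: le_trans (lerD (lexx 1) (le_sqsum x j)); rewrite -(real_normK (num_real (x ord0 j))).
  by have := sqr_ge0 (`|x ord0 j| - 1); nra.
Qed.

Lemma L2_ddgauss a j : 0 < a -> L2 mu (ddgauss a j).
Proof.
move=> a0; apply: (L2_poly_gauss (p := fun x => 4 * a ^+ 2 * x ord0 j ^+ 2 - 2 * a) (A := 2 * a) (B := 4 * a ^+ 2)) => //.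
- by rewrite mulr_ge0// ltW.
- by rewrite mulr_ge0// sqr_ge0.
- exact: continuous_ddgauss.
- move=> x; rewrite (le_trans (ler_normB _ _))// addrC; apply: lerD.
    by rewrite ger0_norm// mulr_ge0// ltW.
  rewrite ger0_norm; last by rewrite mulr_ge0 ?sqr_ge0// mulr_ge0 ?sqr_ge0.
  apply: ler_wpM2l; [by rewrite mulr_ge0// sqr_ge0|exact: le_sqsum].
Qed.

(* Pairing with a Gaussian moves the Laplacian across. *)
Lemma Rint_laplacian_gauss (f f1 f2 : E -> R) j a : 0 < a -> L2 mu f -> L2 mu f1 -> L2 mu f2 ->
  rwpd j f f1 -> rwpd j f1 f2 ->
  \int[mu]_x (f2 x * gauss a x) = \int[mu]_x (f x * ddgauss a j x).
Proof.
move=> a0 Lf Lf1 Lf2 w1 w2.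
rewrite (rwpd_IBP Lf1 (L2_gauss a0) w2 Lf2 (rwpd_gauss a j) (L2_dgauss j a0)).
by rewrite (rwpd_IBP Lf (L2_dgauss j a0) w1 Lf1 (rwpd_dgauss a j) (L2_ddgauss j a0)) opprK.
Qed.

End gaussian.

(** * The heat kernel and the damped heat evolution *)

Section heat_kernel.
Context {R : realType} {n : nat}.
Local Notation E := 'rV[R]_n.
Local Notation mu := (volume n).
Local Notation leb := (@lebesgue_measure R).
Implicit Types (t : R) (x : E).

Definition heat t x := (4 * pi) `^ (- (n%:R / 2)) * t `^ (- (n%:R / 2)) * gauss (4^-1 * t `^ (- 1)) x.

Lemma heat_ge0 t x : 0 <= heat t x.
Proof. by rewrite !mulr_ge0 ?powR_ge0 ?gauss_ge0. Qed.

Lemma fourpi_gt0 : 0 < 4 * pi :> R.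
Proof. by rewrite mulr_gt0// pi_gt0. Qed.

Lemma heat_rate_gt0 t : 0 < t -> 0 < 4^-1 * t `^ (- 1).
Proof. by move=> t0; rewrite mulr_gt0 ?invr_gt0 ?powR_gt0. Qed.

Lemma igr_heat t : 0 < t -> igr mu (heat t) /\ \int[mu]_x heat t x = 1.
Proof.
move=> t0; have [ig eg] := @igr_gauss R n _ (heat_rate_gt0 t0).
split; first exact: igrZ.
rewrite (RintZ _ ig) eg (powR_inv1 (ltW t0)) invfM !invrK.
rewrite (_ : pi * _ = 4 * pi * t); last by ring.
have T0 : 0 < 4 * pi * t by rewrite mulr_gt0// fourpi_gt0.
rewrite -(powR12_sqrt (ltW T0)) -(powR_mulrn _ (powR_ge0 _ _)) -powRrM.
rewrite -powRM ?(ltW fourpi_gt0) ?(ltW t0)// -powRD; last by rewrite (gt_eqF T0) implybT.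
by rewrite (_ : _ + _ = 0) ?powRr0//; field.
Qed.

Lemma L2_heat t : 0 < t -> L2 mu (heat t).
Proof. by move=> t0; apply: L2Z; exact: L2_gauss (heat_rate_gt0 t0). Qed.

Lemma measurable_sqsum : measurable_fun setT (@sqsum R n).
Proof. exact: continuous_row_measurable continuous_sqsum. Qed.

Lemma measurable_heat : measurable_fun setT (fun z : measurableTypeR R * E => heat z.1 z.2).
Proof.
have mp c : measurable_fun setT (fun z : measurableTypeR R * E => z.1 `^ c).
  exact: (measurableT_comp (measurable_powR c)).
apply: measurable_funM; first exact: measurable_funM.
apply: (measurableT_comp (@measurable_expR R)); apply: measurableT_comp => //.
apply: measurable_funM; first exact: measurable_funM.
exact: (measurableT_comp measurable_sqsum).
Qed.

(** Both the time derivative of the heat kernel ([is_derive_heat]) and its Laplacian, the latter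
    being recognised inside [Rint_helm_heat]. *)
Definition hdot t x := (4^-1 * sqsum x * t `^ (- 2) - n%:R / 2 * t `^ (- 1)) * heat t x.

Lemma is_derive_heat t x : 0 < t -> is_derive t (1 : R) (fun t => heat t x) (hdot t x).
Proof.
move=> t0.
have d1 := is_derive1_powR (- (n%:R / 2)) t0.
have d2 := is_derive1_powR (- 1) t0.
have d3 := is_derive_scale (- (4^-1 * sqsum x)) d2.
have d4 := @is_derive_comp1 R expR (fun y => - (4^-1 * sqsum x) * y `^ (- 1)) t _ _ (is_derive_expR _) d3.
have d5 := is_derive_mul (is_derive_scale ((4 * pi) `^ (- (n%:R / 2))) d1) d4.
have e : (fun t => heat t x) = (fun y => (4 * pi) `^ (- (n%:R / 2)) * y `^ (- (n%:R / 2)) * expR (- (4^-1 * sqsum x) * y `^ (- 1))).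
  by apply/funext => y; rewrite /heat /gauss; congr (_ * expR _); ring.
rewrite e; suff -> : hdot t x = (4 * pi) `^ (- (n%:R / 2)) * t `^ (- (n%:R / 2)) * 
  (- (4^-1 * sqsum x) * (- 1 * t `^ (- 1 - 1)) * expR (- (4^-1 * sqsum x) * t `^ (- 1))) +
  expR (- (4^-1 * sqsum x) * t `^ (- 1)) * ((4 * pi) `^ (- (n%:R / 2)) * (- (n%:R / 2) * t `^ (- (n%:R / 2) - 1))) by exact: d5.
rewrite /hdot /heat /gauss (_ : - (4^-1 * t `^ (- 1) * sqsum x) = - (4^-1 * sqsum x) * t `^ (- 1)); last by ring.
rewrite (_ : - 1 - 1 = - 2 :> R); last by ring.
rewrite (@powRD _ t (- (n%:R / 2)) (- 1)); last by rewrite (gt_eqF t0) implybT.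
ring.
Qed.

Variable lam : R.
Hypothesis lam0 : 0 < lam.

(** e^(-lam t) (lam - Delta) applied to the heat kernel; by the heat equation it is minus the time
    derivative of e^(-lam t) times the kernel. *)
Definition hres t x := expR (- (lam * t)) * (lam * heat t x - hdot t x).

Lemma is_derive_exp_heat t x : 0 < t -> is_derive t (1 : R) (fun t => - (expR (- (lam * t)) * heat t x)) (hres t x).
Proof.
move=> t0.
have d1 := is_derive_comp1 (is_derive_expR (- lam * t)) (is_derive_scale (- lam) (is_derive_idr t)).
have d2 := is_derive_opp (is_derive_mul d1 (is_derive_heat x t0)).
have e : (fun t => - (expR (- (lam * t)) * heat t x)) = (fun y => - (expR (- lam * y) * heat y x)).
  by apply/funext => y; rewrite mulNr.
rewrite e; suff -> : hres t x = - (expR (- lam * t) * hdot t x + heat t x * (- lam * 1 * expR (- lam * t))) by exact: d2.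
by rewrite /hres mulNr; ring.
Qed.

Lemma continuous_hres t x : 0 < t -> {for t, continuous (fun t => hres t x)}.
Proof.
move=> t0.
have ch : {for t, continuous (fun t => heat t x)}.
  by apply: differentiable_continuous; apply/derivable1_diffP; case: (is_derive_heat x t0).
have ce : {for t, continuous (fun t => expR (- (lam * t)))}.
  apply: (@continuous_comp _ _ _ (fun t => - (lam * t)) expR); last exact: continuous_expR.
  by apply: continuousN; apply: continuousM; [exact: cst_continuous|exact: cvg_id].
apply: continuousM => //; apply: continuousB; first by apply: continuousM => //; exact: cst_continuous.
apply: continuousM => //; apply: continuousB; apply: continuousM; try exact: cst_continuous; exact: powR_continuous_at.
Qed.

(** A single Gaussian dominates for all times in [a, b]: negative powers of t are largest at a, the
    Gaussian is widest at b, and halving its rate from 1/(4b) to 1/(8b) absorbs the quadratic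
    factor. *)
Lemma le_hres (a b : R) : 0 < a -> a < b -> exists2 C : R, 0 <= C & forall t x, a <= t -> t <= b ->
  `|hres t x| <= C * gauss (8 * b)^-1 x.
Proof.
move=> a0 ab; have b0 : 0 < b by exact: lt_trans ab.
pose ka := (4 * pi) `^ (- (n%:R / 2)) * a `^ (- (n%:R / 2)) : R.
pose A := lam + n%:R / 2 * a `^ (- 1).
pose B := 4^-1 * a `^ (- 2).
have A0 : 0 <= A by rewrite addr_ge0 ?(ltW lam0)// mulr_ge0 ?powR_ge0// divr_ge0.
have B0 : 0 <= B by rewrite mulr_ge0 ?powR_ge0// invr_ge0.
have ka0 : 0 <= ka by rewrite mulr_ge0 ?powR_ge0.
have b4 : 0 < (4 * b)^-1 by rewrite invr_gt0 mulr_gt0.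
exists (ka * (A + B * (2 / (4 * b)^-1))) => [|t x at_ tb].
  by rewrite mulr_ge0// addr_ge0// mulr_ge0// divr_ge0// ltW.
have t0 : 0 < t by exact: lt_le_trans at_.
have pow_anti c : 0 <= c -> t `^ (- c) <= a `^ (- c).
  by move=> c0; rewrite !powRN lef_pV2 ?posrE ?powR_gt0//; apply: ge0_ler_powR; rewrite ?nnegrE// ltW.
pose p := lam - (4^-1 * sqsum x * t `^ (- 2) - n%:R / 2 * t `^ (- 1)).
have pAB : `|p| <= A + B * sqsum x.
  have h1 : n%:R / 2 * t `^ (- 1) <= n%:R / 2 * a `^ (- 1).
    by apply: ler_wpM2l; [exact: divr_ge0|exact: pow_anti].
  have h2 : 4^-1 * sqsum x * t `^ (- 2) <= B * sqsum x.
    rewrite /B mulrAC; apply: ler_wpM2r; first exact: sqsum_ge0.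
    by apply: ler_wpM2l; [rewrite invr_ge0|exact: pow_anti].
  have h3 : 0 <= n%:R / 2 * t `^ (- 1) by rewrite mulr_ge0 ?powR_ge0// divr_ge0.
  have h4 : 0 <= 4^-1 * sqsum x * t `^ (- 2) by rewrite !mulr_ge0 ?powR_ge0 ?sqsum_ge0// invr_ge0.
  by rewrite ler_norml /p /A; apply/andP; split; have := lam0; lra.
have e : hres t x = expR (- (lam * t)) * ((4 * pi) `^ (- (n%:R / 2)) * t `^ (- (n%:R / 2))) * (p * gauss (4^-1 * t `^ (- 1)) x).
  by rewrite /hres /hdot /heat /p; ring.
rewrite e normrM -mulrA; apply: ler_pM => //.
  rewrite normrM !ger0_norm ?expR_ge0 ?mulr_ge0 ?powR_ge0//.
  rewrite -[leRHS]mul1r; apply: ler_pM; rewrite ?expR_ge0 ?mulr_ge0 ?powR_ge0//.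
    by rewrite -expR0 ler_expR oppr_le0 mulr_ge0// ltW.
  by apply: ler_wpM2l; [exact: powR_ge0|apply: pow_anti; exact: divr_ge0].
apply: (@le_trans _ _ `|p * gauss (4 * b)^-1 x|).
  rewrite !normrM; apply: ler_wpM2l => //; rewrite !ger0_norm ?gauss_ge0//.
  apply: le_gauss; rewrite (powR_inv1 (ltW t0)) -invfM lef_pV2 ?posrE ?mulr_gt0//.
  by rewrite ler_pM2l.
have := le_poly_gauss b4 A0 B0 pAB; rewrite (_ : (4 * b)^-1 / 2 = (8 * b)^-1)//.
by rewrite -invfM; congr (_^-1); ring.
Qed.

Lemma measurable_hres : measurable_fun setT (fun z : measurableTypeR R * E => hres z.1 z.2).
Proof.
have mp c : measurable_fun setT (fun z : measurableTypeR R * E => z.1 `^ c).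
  exact: (measurableT_comp (measurable_powR c)).
apply: measurable_funM.
  apply: (measurableT_comp (@measurable_expR R)); apply: measurableT_comp => //.
  exact: measurable_funM.
apply: measurable_funB; first by apply: measurable_funM => //; exact: measurable_heat.
apply: measurable_funM; last exact: measurable_heat.
apply: measurable_funB; last exact: measurable_funM.
apply: measurable_funM => //; apply: measurable_funM => //.
exact: (measurableT_comp measurable_sqsum).
Qed.

Variables (f : E -> R) (f1 f2 : 'I_n -> E -> R).
Hypotheses (Lf : L2 mu f) (Lf1 : forall j, L2 mu (f1 j)) (Lf2 : forall j, L2 mu (f2 j)).
Hypotheses (w1 : forall j, rwpd j f (f1 j)) (w2 : forall j, rwpd j (f1 j) (f2 j)).

Definition helm x := lam * f x - \sum_j f2 j x.

Lemma L2_helm : L2 mu helm.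
Proof. by apply: L2B; [exact: L2Z|exact: L2_sum]. Qed.

(** Two integrations by parts in each coordinate put the Laplacian on the kernel, where the second
    derivatives add up to [hdot]. *)
Lemma Rint_helm_heat t : 0 < t ->
  expR (- (lam * t)) * \int[mu]_x (helm x * heat t x) = \int[mu]_x (f x * hres t x).
Proof.
move=> t0; set a := 4^-1 * t `^ (- 1); have a0 : 0 < a by exact: heat_rate_gt0.
set k := (4 * pi) `^ (- (n%:R / 2)) * t `^ (- (n%:R / 2)) : R.
have Lg := @L2_gauss R n a a0.
have e1 x : helm x * heat t x = k * (lam * (f x * gauss a x) - \sum_j (f2 j x * gauss a x)).
  by rewrite /helm /heat -/a -/k mulrBl -mulr_suml; ring.
have i1 : igr mu (fun x => lam * (f x * gauss a x)) by apply: igrZ; exact: L2M.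
have i2 j : igr mu (fun x => f2 j x * gauss a x) by exact: L2M.
have i3 j : igr mu (fun x => f x * ddgauss a j x) by apply: L2M => //; exact: L2_ddgauss.
have i4 := igr_sum (index_enum 'I_n) xpredT i2.
have i5 := igr_sum (index_enum 'I_n) xpredT i3.
under eq_Rint do rewrite e1.
rewrite (RintZ _ (igrB i1 i4)) (RintB i1 i4) (Rint_sum _ _ i2).
under eq_bigr do rewrite (Rint_laplacian_gauss a0 Lf (Lf1 _) (Lf2 _) (w1 _) (w2 _)).
rewrite -(Rint_sum _ _ i3) -(RintB i1 i5) -(RintZ _ (igrB i1 i5)) -(RintZ _ (igrZ k (igrB i1 i5))).
apply: eq_Rint => x; rewrite /hres /hdot /heat -/a -/k -mulr_sumr /ddgauss -mulr_suml.
have -> : \sum_(i < n) (4 * a ^+ 2 * x ord0 i ^+ 2 - 2 * a) = 4^-1 * sqsum x * t `^ (- 2) - n%:R / 2 * t `^ (- 1).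
  rewrite sumrB -mulr_sumr -/(sqsum x) sumr_const card_ord -mulr_natl /a.
  have -> : t `^ (- 2) = (t `^ (- 1)) ^+ 2 by rewrite -(powR_mulrn 2 (powR_ge0 _ _)) -powRrM; congr (_ `^ _); ring.
  by field.
ring.
Qed.

(** Fundamental theorem of calculus in time, for almost every x under the space integral. Staying
    away from t = 0 gives the domination of [le_hres], hence Fubini. *)
Lemma heat_evolution (a b : R) : 0 < a -> a < b ->
  \int[leb]_t (\1_(`[a, b]%classic : set R) t * (expR (- (lam * t)) * \int[mu]_x (helm x * heat t x))) =
  expR (- (lam * a)) * \int[mu]_x (f x * heat a x) - expR (- (lam * b)) * \int[mu]_x (f x * heat b x).
Proof.
move=> a0 ab; have b0 : 0 < b by exact: lt_trans ab.
have [C C0 HC] := le_hres a0 ab.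
have g8 : 0 < (8 * b)^-1 by rewrite invr_gt0 mulr_gt0.
pose chi : R -> R := \1_(`[a, b]%classic : set R).
have ichi : igr leb chi by exact: igr_indic_itv.
have chiE t : chi t = (a <= t <= b)%R%:R by rewrite /chi indicE mem_setE in_itv.
have mf : measurable_fun setT f by case: Lf.
pose Q (z : measurableTypeR R * E) := chi z.1 * (f z.2 * hres z.1 z.2).
have iQ : igr2 leb mu Q.
  have ig : igr mu (fun x => C * (`|f x| * gauss (8 * b)^-1 x)).
    by apply: igrZ; apply: L2M; [exact: L2_norm|exact: L2_gauss].
  apply: (igr2_prod _ _ ichi ig).
    apply: measurable_funM; first exact: (measurableT_comp (igr_measurable ichi)).
    by apply: measurable_funM; [exact: (measurableT_comp mf)|exact: measurable_hres].
  move=> t x; rewrite /Q /= normrM [`|chi t|]ger0_norm// chiE.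
  case: (boolP (a <= t <= b)) => [/andP[at_ tb]|_]; last by rewrite !mul0r.
  by rewrite !mul1r normrM mulrCA; apply: ler_wpM2l => //; exact: HC.
transitivity (\int[leb]_t \int[mu]_x Q (t, x)).
  apply: eq_Rint => t; rewrite /Q /= -/(chi t) chiE; case: (boolP (a <= t <= b)) => [/andP[at_ tb]|_].
    rewrite mul1r (Rint_helm_heat (lt_le_trans a0 at_)); apply: eq_Rint => x; by rewrite mul1r.
  by rewrite mul0r; under eq_Rint do rewrite mul0r; rewrite Rint0.
rewrite (Rint_Fubini iQ).
have H x : \int[leb]_t Q (t, x) = f x * (expR (- (lam * a)) * heat a x - expR (- (lam * b)) * heat b x).
  have [i1 e1] := @FTC_itv R (fun t => - (expR (- (lam * t)) * heat t x)) (fun t => hres t x) a b ab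
    (fun t at_ _ => @continuous_hres t x (lt_le_trans a0 at_)) (fun t at_ _ => @is_derive_exp_heat t x (lt_le_trans a0 at_)).
  rewrite opprK addrC in e1; rewrite -e1 -(RintZ _ i1); apply: eq_Rint => t.
  by rewrite /Q /= mulrCA.
under eq_Rint do rewrite H.
have ia := L2M Lf (L2_heat a0); have ib := L2M Lf (L2_heat b0).
rewrite -(RintZ _ ia) -(RintZ _ ib) -(RintB (igrZ _ ia) (igrZ _ ib)).
by apply: eq_Rint => x; ring.
Qed.

End heat_kernel.

(** * The heat kernel at small and large times *)

Section heat_limits.
Context {R : realType} {n : nat}.
Local Notation E := 'rV[R]_n.
Local Notation mu := (volume n).
Local Notation leb := (@lebesgue_measure R).

Lemma expRN_le_inv (k : nat) (y : R) : 0 < y -> expR (- y) <= k`!%:R / y ^+ k.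
Proof.
move=> y0; rewrite ler_pdivlMr ?exprn_gt0// expRN mulrC ler_pdivrMr ?expR_gt0//.
by apply: exprn_le_expR; exact: ltW.
Qed.

Lemma continuous0_box (f : E -> R) (e : R) : {for 0, continuous f} -> 0 < e ->
  exists2 d : R, 0 < d & forall x : E, (forall i, `|x ord0 i| < d) -> `|f x - f 0| < e.
Proof.
move=> cf e0; have /nbhs_ballP[d /= d0 Hd] : \forall x \near (0 : E), `|f 0 - f x| < e.
  by move/cvgrPdist_lt : cf; apply.
exists d => // x xd; rewrite distrC; apply: Hd; split => // i j.
by rewrite !ord1 !mxE /ball/= sub0r normrN.
Qed.

(** Half of the exponent beats the powers of a: it supplies a^(n+1) against a^(-n/2) <= a^(-n),
    leaving one factor a. The other half is kept as a fixed Gaussian. *)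
Lemma heat_far (a d : R) (x : E) : 0 < a -> a <= 2^-1 -> 0 < d -> d ^+ 2 <= sqsum x ->
  heat a x <= (4 * pi) `^ (- (n%:R / 2)) * (n.+1`!%:R * (8 / d ^+ 2) ^+ n.+1) * a * gauss 8^-1 x.
Proof.
move=> a0 a1 d0 dx; rewrite /heat -!mulrA ler_wpM2l ?powR_ge0// !mulrA.
have a1' : a <= 1 by apply: le_trans a1 _; rewrite invf_le1// ler1n.
have d20 : 0 < d ^+ 2 by rewrite exprn_gt0.
have g : gauss (4^-1 * a `^ (- 1)) x <= expR (- (d ^+ 2 / (8 * a))) * gauss 8^-1 x.
  rewrite /gauss -expRD ler_expR -opprD lerN2 (powR_inv1 (ltW a0)).
  have h1 : d ^+ 2 / (8 * a) <= sqsum x / (8 * a) by rewrite ler_pM2r// invr_gt0 mulr_gt0.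
  have h2 : 8^-1 * sqsum x <= sqsum x / (8 * a).
    rewrite mulrC; apply: ler_wpM2l; first exact: sqsum_ge0.
    by rewrite lef_pV2 ?posrE ?mulr_gt0// ler_piMr.
  rewrite (_ : 4^-1 / a * sqsum x = sqsum x / (8 * a) + sqsum x / (8 * a)); first exact: lerD.
  by field; rewrite gt_eqF.
apply: (@le_trans _ _ (a `^ (- (n%:R / 2)) * (expR (- (d ^+ 2 / (8 * a))) * gauss 8^-1 x))).
  by apply: ler_wpM2l => //; exact: powR_ge0.
rewrite mulrA; apply: ler_wpM2r; first exact: gauss_ge0.
have y0 : 0 < d ^+ 2 / (8 * a) by rewrite divr_gt0// mulr_gt0.
apply: (@le_trans _ _ (a ^- n * (n.+1`!%:R / (d ^+ 2 / (8 * a)) ^+ n.+1))).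
  apply: ler_pM; rewrite ?powR_ge0 ?expR_ge0//; last exact: expRN_le_inv.
  rewrite -(powR_invn n (ltW a0)); apply: ger_powR; first by rewrite a0.
  by rewrite lerN2 ler_pdivrMr// ler_peMr// ler1n.
have e1 : ((d ^+ 2 / (8 * a)) ^+ n.+1)^-1 = (8 / d ^+ 2) ^+ n.+1 * (a ^+ n * a).
  by rewrite -exprVn invf_div -exprSr -exprMn; congr (_ ^+ _); ring.
have an0 : a ^+ n != 0 by rewrite expf_neq0// gt_eqF.
rewrite e1 le_eqVlt; apply/orP; left; apply/eqP.
generalize ((8 / d ^+ 2) ^+ n.+1) (n.+1`!%:R : R) => y z.
by field.
Qed.

(** The shift by 2 keeps these times at most 1/2, as [heat_far] asks, and strictly below their
    reciprocals k + 2, the final times used with them. *)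
Definition shrink (k : nat) : R := k.+2%:R^-1.

Lemma shrink_gt0 k : 0 < shrink k.
Proof. by rewrite invr_gt0. Qed.

Lemma shrink_le k : shrink k <= 2^-1.
Proof. by rewrite lef_pV2 ?posrE// ler_nat. Qed.

Lemma cvg_shrink : shrink k @[k --> \oo] --> (0 : R).
Proof. by have := @cvg_harmonic R; rewrite -(cvg_shiftS (@harmonic R)). Qed.

(** Near 0 continuity controls f - f(0); far away the Gaussian left by [heat_far] makes int |f -
    f(0)| finite against it although f is only in L^2. *)
Lemma heat_dirac (f : E -> R) : L2 mu f -> {for 0, continuous f} ->
  \int[mu]_x (f x * heat (shrink k) x) @[k --> \oo] --> f 0.
Proof.
move=> Lf cf; apply/cvgrPdist_le => e e0.
have e20 : 0 < e / 2 by rewrite divr_gt0.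
have [d d0 Hd] := continuous0_box cf e20.
pose D := (4 * pi) `^ (- (n%:R / 2)) * (n.+1`!%:R * (8 / d ^+ 2) ^+ n.+1) : R.
have D0 : 0 <= D by rewrite !mulr_ge0 ?powR_ge0 ?exprn_ge0 ?divr_ge0 ?exprn_ge0// ltW.
have g8 : 0 < 8^-1 :> R by rewrite invr_gt0.
have [ig8 _] := @igr_gauss R n _ g8.
have iK : igr mu (fun x => `|f x - f 0| * gauss 8^-1 x).
  apply: (@eq_igr _ _ _ _ (fun x => `|f x * gauss 8^-1 x - f 0 * gauss 8^-1 x|)).
    by move=> x; rewrite -mulrBl normrM (ger0_norm (gauss_ge0 _ _)).
  by apply/igr_norm/igrB; [apply: L2M => //; exact: L2_gauss|exact: igrZ].
set K := \int[mu]_x (`|f x - f 0| * gauss 8^-1 x) in iK.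
have bound k : `|f 0 - \int[mu]_x (f x * heat (shrink k) x)| <= e / 2 + D * shrink k * K.
  have a0 := shrink_gt0 k; have [ih eh] := @igr_heat R n _ a0.
  have i1 := L2M Lf (L2_heat a0); have i2 := igrZ (f 0) ih.
  have i3 := igrZ (e / 2) ih; have i4 := igrZ (D * shrink k) iK.
  have {1}-> : f 0 = \int[mu]_x (f 0 * heat (shrink k) x) by rewrite (RintZ _ ih) eh mulr1.
  have -> : e / 2 + D * shrink k * K = \int[mu]_x (e / 2 * heat (shrink k) x + D * shrink k * (`|f x - f 0| * gauss 8^-1 x)).
    by rewrite (RintD i3 i4) (RintZ _ ih) (RintZ _ iK) eh mulr1.
  rewrite distrC -(RintB i1 i2); apply: (le_norm_Rint (igrB i1 i2) (igrD i3 i4)) => x.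
  rewrite -mulrBl normrM (ger0_norm (heat_ge0 _ _)).
  have [xd|] := pselect (forall i, `|x ord0 i| < d).
    apply: ler_wpDr.
      by apply: mulr_ge0; [apply: mulr_ge0 => //; exact: ltW|rewrite mulr_ge0 ?gauss_ge0].
    by apply: ler_wpM2r; [exact: heat_ge0|exact/ltW/Hd].
  move=> /existsNP[i /negP]; rewrite -leNgt => di.
  apply: ler_wpDl; first by rewrite mulr_ge0 ?heat_ge0// ltW.
  rewrite [leRHS]mulrCA; apply: ler_wpM2l => //; apply: heat_far => //; first exact: shrink_le.
  apply: le_trans (le_sqsum x i); rewrite -(real_normK (num_real (x ord0 i))).
  by apply: lerXn2r; rewrite ?nnegrE// ltW.
have cv : D * shrink k * K @[k --> \oo] --> (0 : R).
  rewrite -[X in _ --> X](mul0r K) -[X in X * K](mulr0 D); apply: cvgM; last exact: cvg_cst.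
  by apply: cvgM; [exact: cvg_cst|exact: cvg_shrink].
move/cvgrPdist_le : cv => /(_ _ e20); apply: filterS => k; rewrite sub0r normrN => Hk.
apply: (le_trans (bound k)); have := le_trans (ler_norm _) Hk; lra.
Qed.

(** For b >= 1 the kernel is at most 1, so its squared L^2 norm is at most its total mass 1. *)
Lemma norm_Rint_heat_le (f : E -> R) (b : R) : 1 <= b -> L2 mu f ->
  `|\int[mu]_x (f x * heat b x)| <= Num.sqrt (sqn mu f).
Proof.
move=> b1 Lf; have b0 : 0 < b by exact: lt_le_trans b1.
apply: (le_trans (norm_Rint_mul Lf (L2_heat b0))); rewrite ler_piMr ?sqrtr_ge0//.
rewrite -[leRHS]sqrtr1; apply: ler_wsqrtr.
have [ih eh] := @igr_heat R n _ b0; rewrite -eh.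
apply: (le_Rint (L2_igr (L2_heat b0)) ih) => x.
rewrite expr2 ler_piMr ?heat_ge0//.
have p c (y : R) : 0 <= c -> 1 <= y -> y `^ (- c) <= 1.
  by move=> c0 y1; rewrite -[leRHS](powRr0 y); apply: ler_powR => //; rewrite oppr_le0.
have n0 : 0 <= n%:R / 2 :> R by rewrite divr_ge0.
have p1 : 1 <= 4 * pi :> R by have := @pi_ge2 R; lra.
have q1 := p _ _ n0 p1; have q2 := p _ _ n0 b1.
have q3 : gauss (4^-1 * b `^ (- 1)) x <= 1.
  by rewrite -expR0 ler_expR oppr_le0 !mulr_ge0 ?sqsum_ge0 ?powR_ge0// invr_ge0.
rewrite /heat -[leRHS]mulr1 -[X in _ <= X * _]mulr1.
by apply: ler_pM; rewrite ?mulr_ge0 ?powR_ge0 ?gauss_ge0//; apply: ler_pM; rewrite ?powR_ge0.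
Qed.

(** The early time gives the Dirac limit; at the late time e^(-lam t) multiplies a bounded
    quantity. *)
Lemma heat_evolution_limit (lam : R) (f : E -> R) : 0 < lam -> L2 mu f -> {for 0, continuous f} ->
  (expR (- (lam * shrink k)) * \int[mu]_x (f x * heat (shrink k) x) -
   expR (- (lam * k.+2%:R)) * \int[mu]_x (f x * heat k.+2%:R x)) @[k --> \oo] --> f 0.
Proof.
move=> lam0 Lf cf; rewrite -[X in _ --> X]subr0; apply: cvgB.
  rewrite -[X in _ --> X]mul1r; apply: cvgM; last exact: heat_dirac.
  rewrite -expR0; apply: (@cvg_comp _ _ _ (fun k => - (lam * shrink k)) expR _ (nbhs (0 : R))); last exact: continuous_expR.
  by rewrite -oppr0; apply: cvgN; rewrite -[X in _ --> X](mulr0 lam); apply: cvgM; [exact: cvg_cst|exact: cvg_shrink].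
apply/norm_cvg0P.
pose S := Num.sqrt (sqn mu f).
apply: (@squeeze_cvgr _ _ _ _ (fun=> 0) (fun k => lam^-1 * S * shrink k)); last 2 first.
- exact: cvg_cst.
- by rewrite -[X in _ --> X](mulr0 (lam^-1 * S)); apply: cvgM; [exact: cvg_cst|exact: cvg_shrink].
apply: nearW => k; rewrite normr_ge0/= normrM (ger0_norm (expR_ge0 _)).
have h1 : expR (- (lam * k.+2%:R)) <= lam^-1 * shrink k.
  have := @expRN_le_inv 1 (lam * k.+2%:R); rewrite expr1 div1r invfM; apply.
  exact: mulr_gt0.
rewrite [leRHS]mulrAC; apply: ler_pM => //.
by apply: norm_Rint_heat_le => //; rewrite ler1n.
Qed.

End heat_limits.

(** * Separation of time and space in the heat kernel *)

Section heat_bounds.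
Context {R : realType}.
Local Notation leb := (@lebesgue_measure R).

Lemma expRN_le_powR (z th : R) : 0 < z -> 0 <= th -> th <= 1 -> expR (- z) <= z `^ (- th).
Proof.
move=> z0 t0 t1; rewrite expRN powRN lef_pV2 ?posrE ?expR_gt0 ?powR_gt0//.
have [z1|z1] := leP z 1.
  apply: (@le_trans _ _ 1); first by rewrite -(powRr0 z); apply: ger_powR; rewrite ?z0.
  by rewrite -expR0 ler_expR ltW.
apply: (@le_trans _ _ z); last by apply: le_trans (expR_ge1Dx z); rewrite lerDr.
by apply: ler1_powR => //; exact: ltW.
Qed.

(** Each coordinate gains t^th in time and pays with a singularity |y|^(-2 th) in space. *)
Lemma gauss_factor_le (t y th : R) : 0 < t -> y != 0 -> 0 <= th -> th <= 1 ->
  expR (- (4^-1 * t `^ (- 1) * y ^+ 2)) <= 4 * t `^ th * `|y| `^ (- (2 * th)).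
Proof.
move=> t0 y0 th0 th1; have ay : 0 < `|y| by rewrite normr_gt0.
have z0 : 0 < 4^-1 * t `^ (- 1) * y ^+ 2.
  by rewrite mulr_gt0 ?heat_rate_gt0// -(real_normK (num_real y)) exprn_gt0.
apply: (le_trans (expRN_le_powR z0 th0 th1)).
have e2 : y ^+ 2 = `|y| `^ 2 by rewrite -[2]/(2%:R) powR_mulrn// real_normK// num_real.
rewrite e2 !powRM ?mulr_ge0 ?powR_ge0 ?invr_ge0// -!powRrM mulrN mulN1r opprK.
rewrite mulrN; apply: ler_wpM2r; first exact: powR_ge0.
apply: ler_wpM2r; first exact: powR_ge0.
rewrite -(powR_inv1 (ler0n R 4)) -powRrM mulN1r opprK.
by apply: ler1_powR => //; rewrite ler1n.
Qed.

(** The exponent th is used for |y| <= 1 and the exponent 1 for |y| > 1; the sum t^th + t covers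
    both. *)
Lemma gauss_factor_le_decay (t y th : R) : 0 < t -> y != 0 -> 0 <= th -> th <= 1 ->
  expR (- (4^-1 * t `^ (- 1) * y ^+ 2)) <= 4 * (t `^ th + t) * decay (2 * th) `|y|.
Proof.
move=> t0 y0 th0 th1; rewrite /decay; case: ifP => _.
  apply: (le_trans (gauss_factor_le t0 y0 th0 th1)).
  apply: ler_wpM2r; first exact: powR_ge0.
  by apply: ler_wpM2l => //; rewrite lerDl ltW.
have := gauss_factor_le t0 y0 ler01 (lexx 1); rewrite mulr1 powRr1 ?(ltW t0)// => /le_trans; apply.
apply: ler_wpM2r; first exact: powR_ge0.
by apply: ler_wpM2l => //; rewrite lerDr powR_ge0.
Qed.

(** For t <= 1 the powers combine to -n/2 + n th; for t > 1 the exponential supplies t^(-n-2)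
    against a growth of order t^n. *)
Lemma time_factor_le (n : nat) (lam th : R) : 0 < lam -> 0 < th -> th < 1 ->
  exists2 C : R, 0 <= C & forall t, 0 < t ->
    expR (- (lam * t)) * t `^ (- (n%:R / 2)) * (t `^ th + t) ^+ n <= C * decay (n%:R * (2^-1 - th)) t.
Proof.
move=> lam0 th0 th1; pose C2 := n.+2`!%:R / lam ^+ n.+2 : R.
have C20 : 0 <= C2 by rewrite divr_ge0// exprn_ge0// ltW.
exists (2 ^+ n * (1 + C2)) => [|t t0]; first by rewrite mulr_ge0 ?exprn_ge0// addr_ge0.
have pd r s : t `^ (r + s) = t `^ r * t `^ s by rewrite powRD// (gt_eqF t0) implybT.
have tp := powR_ge0 t; have sumpos := addr_ge0 (tp th) (ltW t0).
have n2 : 0 <= n%:R / 2 :> R by rewrite divr_ge0.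
rewrite /decay; have [t1|t1] := leP t 1.
  have h : (t `^ th + t) ^+ n <= 2 ^+ n * t `^ (n%:R * th).
    rewrite [n%:R * th]mulrC powRrM (powR_mulrn _ (powR_ge0 _ _)) -exprMn; apply: lerXn2r; rewrite ?nnegrE// ?mulr_ge0//.
    by rewrite mulr_natl mulr2n lerD2l; apply: ger1_powR; rewrite ?t0// ltW.
  have he : expR (- (lam * t)) <= 1 by rewrite -expR0 ler_expR oppr_le0 mulr_ge0// ltW.
  apply: (@le_trans _ _ (1 * t `^ (- (n%:R / 2)) * (2 ^+ n * t `^ (n%:R * th)))).
    apply: ler_pM => //; [by rewrite mulr_ge0 ?expR_ge0|exact: exprn_ge0|exact: ler_wpM2r].
  rewrite mul1r mulrCA -pd -mulrA; apply: ler_wpM2l; first exact: exprn_ge0.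
  rewrite (_ : - (n%:R / 2) + n%:R * th = - (n%:R * (2^-1 - th))); last by ring.
  by rewrite ler_peMl// lerDl.
have h : (t `^ th + t) ^+ n <= 2 ^+ n * t ^+ n.
  rewrite -exprMn; apply: lerXn2r; rewrite ?nnegrE ?mulr_ge0 ?(ltW t0)//.
  by rewrite mulr_natl mulr2n lerD2r; apply: ler1_powR; exact: ltW.
have h2 : t `^ (- (n%:R / 2)) <= 1.
  by rewrite -[leRHS](powRr0 t); apply: ler_powR; [exact: ltW|rewrite oppr_le0].
have h3 : expR (- (lam * t)) <= C2 / t ^+ n.+2.
  have := @expRN_le_inv R n.+2 (lam * t) (mulr_gt0 lam0 t0); by rewrite exprMn invfM mulrA.
apply: (@le_trans _ _ (C2 / t ^+ n.+2 * 1 * (2 ^+ n * t ^+ n))).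
  by apply: ler_pM; rewrite ?mulr_ge0 ?expR_ge0 ?exprn_ge0//; apply: ler_pM; rewrite ?expR_ge0.
have tn : t ^+ n != 0 by rewrite expf_neq0// gt_eqF.
rewrite (_ : C2 / t ^+ n.+2 * 1 * (2 ^+ n * t ^+ n) = 2 ^+ n * C2 / t ^+ 2); last first.
  by rewrite !exprS; move: (t ^+ n) tn (2 ^+ n : R) => u u0 v; field; rewrite u0 gt_eqF.
rewrite -(powR_invn 2 (ltW t0)); apply: ler_wpM2r; first exact: powR_ge0.
by apply: ler_wpM2l; [exact: exprn_ge0|rewrite lerDr].
Qed.

Context {n : nat}.
Local Notation E := 'rV[R]_n.
Local Notation mu := (volume n).

Definition decay_prod (b : R) (x : E) := \prod_i decay b `|x ord0 i|.

Lemma decay_prod_ge0 b x : 0 <= decay_prod b x.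
Proof. by apply: prodr_ge0 => i _; exact: decay_ge0. Qed.

Lemma igr_decay_prod b : 0 < b -> b < 1 -> igr mu (decay_prod b).
Proof.
move=> b0 b1; have := @igr_tensor R n (fun _ y => decay b `|y|) (fun _ _ => decay_ge0 _ _) (fun=> igr_decay b0 b1).
by case.
Qed.

(** A power s >= 1 multiplies the exponent near 0 and only improves the decay at infinity, so the
    profile is kept. *)
Lemma powR_decay_le (b s t : R) : 0 <= t -> 1 <= s -> decay b t `^ s <= decay (b * s) t.
Proof.
move=> t0 s1; rewrite /decay; have [t1|t1] := leP t 1; rewrite -powRrM.
  by rewrite mulNr.
by apply: ler_powR; [exact: ltW|rewrite mulNr lerN2 ler_peMr].
Qed.

Lemma powR_decay_prod_le (b s : R) x : 1 <= s -> decay_prod b x `^ s <= decay_prod (b * s) x.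
Proof.
move=> s1; rewrite /decay_prod; elim: (index_enum 'I_n) => [|i r IH].
  by rewrite !big_nil powR1.
rewrite !big_cons powRM ?decay_ge0//; last by apply: prodr_ge0 => k _; exact: decay_ge0.
by apply: ler_pM; rewrite ?powR_ge0//; exact: powR_decay_le.
Qed.

(** Points with a vanishing coordinate are excluded because [decay] takes the value 0 there instead
    of being infinite. *)
Lemma heat_decay_le (lam th : R) : 0 < lam -> 0 < th -> th < 1 ->
  exists2 C : R, 0 <= C & forall t (x : E), 0 < t -> (forall i, x ord0 i != 0) ->
    expR (- (lam * t)) * heat t x <= C * decay (n%:R * (2^-1 - th)) t * decay_prod (2 * th) x.
Proof.
move=> lam0 th0 th1; have [C C0 HC] := time_factor_le n lam0 th0 th1.
pose kap := (4 * pi) `^ (- (n%:R / 2)) : R.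
exists (kap * 4 ^+ n * C) => [|t x t0 x0]; first by rewrite !mulr_ge0 ?powR_ge0 ?exprn_ge0.
have g : gauss (4^-1 * t `^ (- 1)) x <= 4 ^+ n * (t `^ th + t) ^+ n * decay_prod (2 * th) x.
  rewrite gauss_tensor -exprMn -[X in _ ^+ X]card_ord -prodr_const -big_split/=.
  apply: ler_prod => i _; rewrite expR_ge0/=.
  by apply: gauss_factor_le_decay => //; exact: ltW.
apply: (@le_trans _ _ (kap * 4 ^+ n * (expR (- (lam * t)) * t `^ (- (n%:R / 2)) * (t `^ th + t) ^+ n) * decay_prod (2 * th) x)).
  rewrite /heat -/kap (_ : _ * _ * decay_prod _ _ =
    expR (- (lam * t)) * (kap * t `^ (- (n%:R / 2)) * (4 ^+ n * (t `^ th + t) ^+ n * decay_prod (2 * th) x))); last by ring.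
  by apply: ler_wpM2l; [exact: expR_ge0|apply: ler_wpM2l => //; rewrite mulr_ge0 ?powR_ge0].
apply: ler_wpM2r; first exact: decay_prod_ge0.
rewrite -[leRHS]mulrA; apply: ler_wpM2l; first by rewrite mulr_ge0 ?powR_ge0 ?exprn_ge0.
exact: HC.
Qed.

(** The indicator of a coordinate hyperplane is a product function, with one factor of integral
    0. *)
Lemma ae_coord_neq0 : {ae mu, forall x : E, forall i, x ord0 i != 0}.
Proof.
have H i : {ae mu, forall x : E, x ord0 i != 0}.
  pose m (k : 'I_n) : R -> R := if k == i then \1_[set 0 : R] else fun=> 1.
  have mm k : measurable_fun setT (m k : measurableTypeR R -> R).
    rewrite /m; case: ifP => _ //; apply: measurable_indic; exact: measurable_set1.
  have m0 k x : 0 <= m k x by rewrite /m; case: ifP.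
  have e : (fun x : E => \prod_k m k (x ord0 k)) = \1_[set x : E | x ord0 i = 0].
    apply/funext => x; rewrite (bigD1 i)//= /m eqxx big1 ?mulr1; last by move=> k /negbTE ->.
    by rewrite !indicE; congr (nat_of_bool _)%:R; apply/idP/idP; rewrite !inE.
  have mS : measurable [set x : E | x ord0 i = 0].
    have := @measurable_row_coord R n i measurableT [set 0] (measurable_set1 _).
    by rewrite setTI.
  exists [set x : E | x ord0 i = 0]; split => //; last first.
    by move=> x /= /negP; rewrite negbK => /eqP.
  have T := ge0_integral_tensor mm m0.
  rewrite -[LHS]/(volume n _) -(setIT [set x : E | _]) -(integral_indic _ measurableT mS) -e T.
  rewrite (bigD1 i)//= {1}/m eqxx integral_indic ?setIT//.
  (* The remaining factors may be infinite; in the extended reals 0 times infinity is 0. *)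
  by apply: etrans (congr1 (fun z => z * _)%E (lebesgue_measure_set1 (0 : R))) _; rewrite mul0e.
suff : {ae mu, forall x : E, forall k (kn : (k < n)%N), x ord0 (Ordinal kn) != 0}.
  by apply: filterS => x Hx i; have := Hx i (ltn_ord i); congr (x _ _ != 0); exact: val_inj.
apply: ae_foralln => k; have [kn|nk] : (k < n)%N \/ (n <= k)%N by case: ltnP; [left|right].
  have := H (Ordinal kn); apply: filterS => x Hx kn'; rewrite (bool_irrelevance kn' kn); exact: Hx.
by apply: filterE => x kn'; exfalso; move: kn'; rewrite ltnNge nk.
Qed.

End heat_bounds.

(** * The Green function as the Laplace transform of the heat kernel *)

Section green_kernel.
Context {R : realType} {n : nat}.
Local Notation E := 'rV[R]_n.
Local Notation mu := (volume n).
Local Notation leb := (@lebesgue_measure R).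
Variables (lam th C : R).
Hypotheses (n0 : (0 < n)%N) (lam0 : 0 < lam) (th0 : 0 < th) (th4 : 4 * th < 1).
Hypothesis nth : n%:R * (2^-1 - th) < 1.
Hypothesis C0 : 0 <= C.
Local Notation b := (n%:R * (2^-1 - th)).
Hypothesis HC : forall t (x : E), 0 < t -> (forall i, x ord0 i != 0) ->
  expR (- (lam * t)) * heat t x <= C * decay b t * decay_prod (2 * th) x.

Let pos (t : R) : R := \1_(`]0, +oo[%classic : set R) t.

Let posE t : pos t = (0 < t)%R%:R.
Proof. by rewrite /pos indicE mem_setE in_itv/= andbT. Qed.

(* The truncation only matters on the null set where a coordinate vanishes. *)
Definition green_integrand (t : R) (x : E) :=
  Num.min (\1_(`]0, +oo[%classic : set R) t * (expR (- (lam * t)) * heat t x)) (C * decay b `|t| * decay_prod (2 * th) x).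

Definition green (x : E) := \int[leb]_t green_integrand t x.

Let b_gt0 : 0 < b.
Proof. by rewrite mulr_gt0 ?ltr0n// subr_gt0; have := th4; lra. Qed.

Let igr_time : igr leb (fun t => decay b `|t|).
Proof. exact: igr_decay. Qed.

Lemma green_integrand_ge0 t x : 0 <= green_integrand t x.
Proof.
rewrite le_min; apply/andP; split.
  by apply: mulr_ge0 => //; apply: mulr_ge0; [exact: expR_ge0|exact: heat_ge0].
apply: mulr_ge0; last exact: decay_prod_ge0.
by apply: mulr_ge0 => //; exact: decay_ge0.
Qed.

Lemma green_integrand_le t x : green_integrand t x <= C * decay b `|t| * decay_prod (2 * th) x.
Proof. by rewrite /green_integrand ge_min lexx orbT. Qed.

Lemma green_integrandE t (x : E) : (forall i, x ord0 i != 0) ->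
  green_integrand t x = pos t * (expR (- (lam * t)) * heat t x).
Proof.
move=> x0; apply/min_idPl; rewrite -/(pos t) posE; case: ltP => t0.
  by rewrite mul1r (gtr0_norm t0); exact: HC.
rewrite mul0r; apply: mulr_ge0; last exact: decay_prod_ge0.
by apply: mulr_ge0 => //; exact: decay_ge0.
Qed.

Lemma measurable_decay_prod c : measurable_fun setT (@decay_prod R n c).
Proof.
apply: (@measurable_tensor R n (fun _ y => decay c `|y|)) => i.
by apply: (measurableT_comp (measurable_decay c)); exact: normr_measurable.
Qed.

Lemma measurable_green_integrand : measurable_fun setT (fun z : measurableTypeR R * E => green_integrand z.1 z.2).
Proof.
apply: measurable_minr.
  apply: measurable_funM.
    by apply: (measurableT_comp (f := pos)) => //; apply: measurable_indic; exact: measurable_itv.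
  apply: measurable_funM; last exact: measurable_heat.
  apply: (measurableT_comp (@measurable_expR R)); apply: measurableT_comp => //.
  exact: measurable_funM.
apply: measurable_funM; last exact: (measurableT_comp (measurable_decay_prod _)).
apply: measurable_funM => //.
exact: (measurableT_comp (igr_measurable igr_time)).
Qed.

Lemma igr_green_integrand x : igr leb (fun t => green_integrand t x).
Proof.
apply: (le_igr _ _ (igrZ (C * decay_prod (2 * th) x) igr_time)).
  exact: (measurableT_comp measurable_green_integrand (measurable_pair2 x)).
by move=> t; rewrite (ger0_norm (green_integrand_ge0 _ _)) mulrAC; exact: green_integrand_le.
Qed.

Lemma measurable_green : measurable_fun setT green.
Proof.
apply: (@measurable_Rint12 _ _ _ _ R leb (fun z : E * measurableTypeR R => green_integrand z.2 z.1)).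
have m : measurable_fun setT (fun z : E * measurableTypeR R => (z.2, z.1)) by exact: measurable_fun_pair.
exact: (measurableT_comp measurable_green_integrand m).
Qed.

Lemma green_ge0 x : 0 <= green x.
Proof. by apply: Rint_ge0 => t; exact: green_integrand_ge0. Qed.

Lemma green_le x : green x <= C * (\int[leb]_t decay b `|t|) * decay_prod (2 * th) x.
Proof.
rewrite mulrAC -(RintZ _ igr_time); apply: le_Rint; [exact: igr_green_integrand|exact: igrZ|].
by move=> t; rewrite mulrAC; exact: green_integrand_le.
Qed.

Lemma green_moment s : 1 <= s -> 2 * th * s < 1 -> igr mu (fun x => `|green x| `^ s).
Proof.
move=> s1 ths; set K := C * \int[leb]_t decay b `|t|.
have K0 : 0 <= K by rewrite mulr_ge0// Rint_ge0// => t; exact: decay_ge0.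
have s0 : 0 < s by exact: lt_le_trans s1.
have ths0 : 0 < 2 * th * s by rewrite !mulr_gt0.
apply: (le_igr _ _ (igrZ (K `^ s) (igr_decay_prod ths0 ths))).
  by apply: (measurableT_comp (measurable_powR _)); apply: measurableT_comp => //; exact: measurable_green.
move=> x; rewrite (ger0_norm (powR_ge0 _ _)) (ger0_norm (green_ge0 x)).
apply: (@le_trans _ _ ((K * decay_prod (2 * th) x) `^ s)).
  by apply: ge0_ler_powR; [exact: ltW|rewrite nnegrE green_ge0|rewrite nnegrE mulr_ge0 ?decay_prod_ge0|exact: green_le].
rewrite powRM ?decay_prod_ge0//; apply: ler_wpM2l; [exact: powR_ge0|exact: powR_decay_prod_le].
Qed.

Lemma L2_decay_prod : L2 mu (@decay_prod R n (2 * th)).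
Proof.
apply: L2P; first exact: measurable_decay_prod.
have c0 : 0 < 2 * th * 2 by rewrite !mulr_gt0.
have c1 : 2 * th * 2 < 1 by have := th4; lra.
apply: (le_igr _ _ (igr_decay_prod c0 c1)); first by apply: measurable_funX; exact: measurable_decay_prod.
move=> x; rewrite ger0_norm ?sqr_ge0// -(powR_mulrn _ (decay_prod_ge0 _ _)).
by apply: powR_decay_prod_le; rewrite ler1n.
Qed.

Lemma L2_green : L2 mu green.
Proof.
apply: (le_L2 measurable_green _ (L2Z (C * (\int[leb]_t decay b `|t|)) L2_decay_prod)) => x.
by rewrite (ger0_norm (green_ge0 x)); exact: green_le.
Qed.

Lemma green_Fubini w : L2 mu w ->
  igr leb (fun t => pos t * (expR (- (lam * t)) * \int[mu]_x (w x * heat t x))) /\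
  \int[mu]_x (w x * green x) = \int[leb]_t (pos t * (expR (- (lam * t)) * \int[mu]_x (w x * heat t x))).
Proof.
move=> Lw; have [mw _] := Lw.
pose Q (z : measurableTypeR R * E) := w z.2 * green_integrand z.1 z.2.
have iQ : igr2 leb mu Q.
  have ig : igr mu (fun x => C * (`|w x| * decay_prod (2 * th) x)).
    by apply: igrZ; apply: L2M; [exact: L2_norm|exact: L2_decay_prod].
  apply: (igr2_prod _ _ igr_time ig).
    by apply: measurable_funM; [exact: (measurableT_comp mw)|exact: measurable_green_integrand].
  move=> t x; rewrite /Q /= normrM (ger0_norm (green_integrand_ge0 _ _)).
  rewrite (_ : _ * (C * _) = `|w x| * (C * decay b `|t| * decay_prod (2 * th) x)); last by ring.
  by apply: ler_wpM2l => //; exact: green_integrand_le.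
have e t : \int[mu]_x Q (t, x) = pos t * (expR (- (lam * t)) * \int[mu]_x (w x * heat t x)).
  have [t0|t0] := ltP 0 t; last first.
    rewrite posE ltNge t0 mul0r -[RHS](@Rint0 _ _ R mu); apply: Rint_ae => //.
      by apply: measurable_funM => //; exact: (measurableT_comp measurable_green_integrand (measurable_pair1 t)).
    apply: filterS (@ae_coord_neq0 R n) => x x0.
    by rewrite /Q /= green_integrandE// posE ltNge t0 mul0r mulr0.
  have iwh : igr mu (fun x => w x * heat t x) by apply: L2M => //; exact: L2_heat.
  have iewh := igrZ (expR (- (lam * t))) iwh.
  rewrite -(RintZ _ iwh) -(RintZ _ iewh); apply: Rint_ae.
  - by apply: measurable_funM => //; exact: (measurableT_comp measurable_green_integrand (measurable_pair1 t)).
  - exact: igr_measurable (igrZ (pos t) iewh).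
  - apply: filterS (@ae_coord_neq0 R n) => x x0.
    by rewrite /Q /= green_integrandE//; ring.
split; first by apply: (eq_igr e); exact: igr_Rint12 iQ.
transitivity (\int[mu]_x \int[leb]_t Q (t, x)).
  by apply: eq_Rint => x; rewrite /Q /= (RintZ _ (igr_green_integrand x)).
by rewrite -(Rint_Fubini iQ); apply: eq_Rint.
Qed.

(** The time integral is the limit of its restrictions to [1/(k+2), k+2], each of which
    [heat_evolution] evaluates as a boundary term. *)
Lemma green_fundamental (f : E -> R) (f1 f2 : 'I_n -> E -> R) : L2 mu f ->
  (forall j, L2 mu (f1 j)) -> (forall j, L2 mu (f2 j)) ->
  (forall j, rwpd j f (f1 j)) -> (forall j, rwpd j (f1 j) (f2 j)) -> {for 0, continuous f} ->
  \int[mu]_x (helm lam f f2 x * green x) = f 0.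
Proof.
move=> Lf Lf1 Lf2 w1 w2 cf; have Lh := L2_helm lam Lf Lf2.
have [iJ ->] := green_Fubini Lh; set J := (X in \int[leb]_t X t) in iJ *.
pose D k : set R := `[shrink k, k.+2%:R]%classic.
have mJ := igr_measurable iJ.
have [] := @Rint_dominated _ _ R leb (fun k t => \1_(D k) t * J t) J (fun t => `|J t|) _ mJ _ (igr_norm iJ).
- by move=> k; apply: measurable_funM => //; apply: measurable_indic; exact: measurable_itv.
- move=> t; have [t0|t0] := ltP 0 t; last first.
    by rewrite /J posE ltNge t0 mul0r; under eq_cvg do rewrite mulr0; exact: cvg_cst.
  apply: cvg_near_cst; near=> k.
  have kk : k%:R <= k.+2%:R :> R by rewrite ler_nat (leq_trans (leqnSn _) (leqnSn _)).
  have Dk : D k t.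
    rewrite /D /= in_itv/=; apply/andP; split.
      rewrite -[leRHS]invrK lef_pV2 ?posrE ?invr_gt0//; apply: le_trans kk.
      by near: k; exact: nbhs_infty_ger.
    by apply: le_trans kk; near: k; exact: nbhs_infty_ger.
  by rewrite indicE mem_set// mul1r.
- by move=> k t; rewrite normrM ler_piMl// indicE; case: (_ \in _); rewrite ?normr1 ?normr0.
move=> _ cv; have := heat_evolution_limit lam0 Lf cf.
apply: (cvg_unique _ _) => //.
apply: cvg_trans cv; apply: near_eq_cvg; near=> k.
have sk : shrink k < k.+2%:R :> R by apply: (le_lt_trans (@shrink_le R k)); rewrite (@lt_trans _ _ 1) ?ltr1n// invf_lt1// ltr1n.
rewrite -(heat_evolution lam0 Lf Lf1 Lf2 w1 w2 (shrink_gt0 k) sk).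
apply: eq_Rint => t; rewrite /J indicE mem_setE in_itv/=.
case: (boolP (shrink k <= t <= k.+2%:R)) => [/andP[kt _]|_]; last by rewrite !mul0r.
by rewrite posE (lt_le_trans (@shrink_gt0 R k) kt) !mul1r.
Unshelve. all: by end_near. Qed.

End green_kernel.

(** Seals the construction: later arguments use these three properties and not the formula of the
    kernel. *)
Lemma green_kernel_exists {R : realType} {n : nat} (lam th : R) : (0 < n)%N -> 0 < lam -> 0 < th -> 4 * th < 1 ->
  n%:R * (2^-1 - th) < 1 ->
  exists g : 'rV[R]_n -> R, [/\ L2 (volume n) g,
    (forall s, 1 <= s -> 2 * th * s < 1 -> igr (volume n) (fun x => `|g x| `^ s))
    & forall (f : 'rV[R]_n -> R) (f1 f2 : 'I_n -> 'rV[R]_n -> R), L2 (volume n) f ->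
      (forall j, L2 (volume n) (f1 j)) -> (forall j, L2 (volume n) (f2 j)) ->
      (forall j, rwpd j f (f1 j)) -> (forall j, rwpd j (f1 j) (f2 j)) -> {for 0, continuous f} ->
      \int[volume n]_x (helm lam f f2 x * g x) = f 0].
Proof.
move=> n0 lam0 th0 th4 nth; have th1 : th < 1 by lra.
have [C C0 HC] := @heat_decay_le R n lam th lam0 th0 th1.
exists (green lam th C); split; [exact: L2_green|exact: green_moment|exact: green_fundamental].
Qed.

(** * Uniqueness and singularity of the fundamental solution *)

Section helmholtz_uniqueness.
Context {R : realType} {n : nat}.
Local Notation E := 'rV[R]_n.
Local Notation mu := (volume n).
Implicit Types (f g h W : E -> R) (j : 'I_n).

Lemma continuous_affine (V : normedModType R) (F : V -> R) (s : R) (z : V) : continuous F ->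
  continuous (fun y : V => F (z + s *: y)).
Proof.
move=> cF y; apply: (@continuous_comp V V R (fun y => z + s *: y) F); last exact: cF.
by apply: cvgD; [exact: cvg_cst|exact: scaler_continuous].
Qed.

(** The factor c makes the family c f(z + s y) stable under partial derivatives, as [smooth_coind]
    asks. *)
Lemma pderiv_affine f (s c : R) (z : E) j : smooth f ->
  forall y, is_derive y (base_vec j) (fun y => c * f (z + s *: y)) (c * s * pderiv j f (z + s *: y)).
Proof.
move=> sf y; rewrite -mulrA; apply: is_derive_scale.
have cf := smooth_is_derive (z + s *: y) j sf.
apply: (@is_derive_line _ _ _ (fun t => f ((s * t) *: base_vec j + (z + s *: y))) _ _ 0).
  by move=> t; rewrite addr0 scalerDr scalerA addrCA.
have d1 : is_derive (0 : R) (1 : R) (fun t => f (t *: base_vec j + (z + s *: y))) (pderiv j f (z + s *: y)).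
  by apply: is_derive_along; rewrite scale0r add0r.
have d2 := is_derive_scale s (is_derive_idr (0 : R)); rewrite mulr1 in d2.
have := @is_derive_comp1 R (fun t => f (t *: base_vec j + (z + s *: y))) (fun t => s * t) 0 (pderiv j f (z + s *: y)) s.
by rewrite mulr0; apply.
Qed.

Lemma rtest_affine f (s : R) (z : E) : s != 0 -> rtest f ->
  rtest (fun y => f (z + s *: y)) /\
  forall j, pderiv j (fun y => f (z + s *: y)) = fun y => s * pderiv j f (z + s *: y).
Proof.
move=> s0 tf; have [sf _] := tf.
have P j g (c : R) : smooth g -> pderiv j (fun y => c * g (z + s *: y)) = fun y => c * s * pderiv j g (z + s *: y).
  by move=> sg; apply/funext => y; apply: pderiv_is_derive; exact: pderiv_affine.
have e1 : (fun y => f (z + s *: y)) = fun y => 1 * f (z + s *: y) by apply/funext => y; rewrite mul1r.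
split; last by move=> j; rewrite e1 P//; apply/funext => y; rewrite mul1r.
split.
  rewrite e1; apply: (@smooth_coind _ _ [set g | exists f c, smooth f /\ g = fun y => c * f (z + s *: y)]).
    by exists f, 1.
  move=> _ [g [c [sg ->]]]; split.
    apply: continuous_mulr; first exact: cst_continuous.
    exact: (@continuous_affine _ g s z (smooth_continuous sg)).
  move=> j; split; last by move=> y; case: (pderiv_affine s c z j sg y).
  by exists (pderiv j g), (c * s); split; [exact: smooth_pderiv|exact: P].
have [M HM] := rtest_bounded_support tf.
apply: (@compact_support _ _ _ ((M + \sum_i `|z ord0 i|) / `|s|)) => y i.
rewrite ler_pdivrMr ?normr_gt0// => My; apply: (HM _ i); rewrite !mxE.
have zi : `|z ord0 i| <= \sum_i `|z ord0 i| by rewrite (bigD1 i)//= lerDl sumr_ge0.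
have := ler_normB (z ord0 i + s * y ord0 i) (z ord0 i).
rewrite addrAC subrr add0r normrM mulrC; lra.
Qed.

Lemma rtest_shift f (x : E) : rtest f -> rtest (fun y => f (y - x)) /\
  forall j, pderiv j (fun y => f (y - x)) = fun y => pderiv j f (y - x).
Proof.
move=> tf; have [t1 d1] := @rtest_affine f 1 (- x) (oner_neq0 _) tf.
have e (g : E -> R) : (fun y => g (- x + 1 *: y)) = fun y => g (y - x).
  by apply/funext => y; rewrite scale1r addrC.
rewrite -(e f); split=> // j; rewrite d1 -(e (pderiv j f)).
by apply/funext => y; rewrite mul1r.
Qed.

Lemma rtest_reflect f (z : E) : rtest f -> rtest (fun y => f (z - y)) /\
  forall j, pderiv j (fun y => f (z - y)) = fun y => - pderiv j f (z - y).
Proof.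
move=> tf; have m1 : -1 != 0 :> R by rewrite oppr_eq0 oner_eq0.
have [t1 d1] := rtest_affine z m1 tf.
have e (g : E -> R) : (fun y => g (z + -1 *: y)) = fun y => g (z - y).
  by apply/funext => y; rewrite scaleN1r.
rewrite -(e f); split=> // j; rewrite d1.
by apply/funext => y; rewrite mulN1r scaleN1r.
Qed.

(** A correlation, int rho(y) W(x + y) dy, rather than a convolution: derivatives in x fall on rho
    with a minus sign. *)
Definition mollify (rho : E -> R) W : E -> R := avg mu (fun y : E => y) rho W.

Lemma rowmx_id_measurable : measurable_fun setT (fun y : E => y).
Proof. exact: measurable_id. Qed.

Lemma L2_mollify rho W : rtest rho -> L2 mu W -> L2 mu (mollify rho W).
Proof.
by move=> tr LW; case: (L2_avg rowmx_id_measurable (bsupp_igr (bsupp_rtest tr)) LW).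
Qed.

Lemma mollify_translate rho W x : rtest rho -> L2 mu W ->
  mollify rho W x = \int[mu]_z (rho (z - x) * W z).
Proof.
move=> tr LW; have br := bsupp_rtest tr.
rewrite -(Rint_translate x); first by apply: eq_Rint => y; rewrite addrK addrC.
by apply: L2M => //; exact: L2_translate (bsupp_L2 br).
Qed.

Lemma mollify_dual rho W g : rtest rho -> L2 mu W -> L2 mu g ->
  \int[mu]_x (g x * mollify rho W x) = \int[mu]_z (W z * \int[mu]_y (rho y * g (z - y))).
Proof.
move=> tr LW Lg; have ir := bsupp_igr (bsupp_rtest tr).
have mopp : measurable_fun setT (fun y : E => - y).
  rewrite (_ : (fun y => _) = fun y : E => (-1 : R) *: y); last by apply/funext => y; rewrite scaleN1r.
  exact: (measurableT_comp (@measurable_fun_rowZ R n) (measurable_pair1 (-1 : measurableTypeR R))).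
rewrite (Rint_mul_avg rowmx_id_measurable ir Lg LW) (Rint_mul_avg mopp ir LW Lg).
apply: eq_Rint => y; congr (_ * _).
rewrite -(Rint_translate (- y) (L2M Lg (L2_translate y LW))).
by apply: eq_Rint => x; rewrite subrK mulrC.
Qed.

Lemma rwpdN f h j : rwpd j f h -> rwpd j (fun x => - f x) (fun x => - h x).
Proof.
move=> [lf lh fh]; have e (k : E -> R) : (fun x => - k x) = fun x => -1 * k x by apply/funext => x; rewrite mulN1r.
split; [by rewrite e; exact: rlocZ|by rewrite e; exact: rlocZ|] => phi tp.
under eq_Rint do rewrite mulNr; under [in RHS]eq_Rint do rewrite mulNr.
rewrite !RintN ?fh//; first exact: rlocM lh (bsupp_rtest tp).
exact: rlocM lf (bsupp_rtest (rtest_pderiv j tp)).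
Qed.

(** By duality the derivative of the test function meets rho inside an inner integral, where rho is
    smooth and the classical integration by parts applies. *)
Lemma rwpd_mollify rho W j : rtest rho -> L2 mu W ->
  rwpd j (mollify rho W) (fun x => - mollify (pderiv j rho) W x).
Proof.
move=> tr LW; have tdr := rtest_pderiv j tr.
split; [by apply: L2_rloc; exact: L2_mollify|by apply: L2_rloc; apply: L2N; exact: L2_mollify|].
move=> phi tp; have tdp := rtest_pderiv j tp.
under [in RHS]eq_Rint do rewrite mulNr.
rewrite [in RHS]RintN; last by apply: L2M; [exact: L2_mollify|exact: bsupp_L2 (bsupp_rtest tp)].
rewrite opprK; under eq_Rint do rewrite mulrC; under [in RHS]eq_Rint do rewrite mulrC.
rewrite (mollify_dual tr LW (bsupp_L2 (bsupp_rtest tdp))) (mollify_dual tdr LW (bsupp_L2 (bsupp_rtest tp))).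
apply: eq_Rint => z; congr (_ * _).
have [tz dz] := rtest_reflect z tp; have [tdz _] := rtest_reflect z tdp.
have [_ _ /(_ _ tz)] := smooth_rwpd j tr.1.
have i1 := L2M (bsupp_L2 (bsupp_rtest tr)) (bsupp_L2 (bsupp_rtest tdz)).
by rewrite dz; under eq_Rint do rewrite mulrN; rewrite (RintN i1) => /oppr_inj.
Qed.

Lemma sqn_eq0 f : L2 mu f -> sqn mu f = 0 -> {ae mu, forall x, f x = 0}.
Proof.
move=> Lf f0; have := EFin_Rint (L2_igr Lf); rewrite -/(sqn mu f) f0 => /esym e.
have mf : measurable_fun setT (fun x : E => (f x ^+ 2)%:E).
  by apply/measurable_EFinP; apply: measurable_funX; case: Lf.
have := (ae_eq_integral_abs mu measurableT mf).1.
under eq_integral do rewrite gee0_abs ?lee_fin ?sqr_ge0//.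
move=> /(_ e); apply: filterS => x /(_ I) [] /eqP; rewrite sqrf_eq0 => /eqP //.
Qed.

(** A cube around the origin has positive volume, so it is not contained in the exceptional null
    set. *)
Lemma ae_zero_near0 f (e : R) : 0 < e -> {ae mu, forall x, f x = 0} ->
  exists2 x : E, (forall i, `|x ord0 i| < e) & f x = 0.
Proof.
move=> e0 [A [mA A0 HA]]; apply/not_exists2P => H.
have sub : cubeM e `<=` A.
  by move=> x /cubeP xe; apply: HA => /= fx; have := H x; case.
have : (volume n (cubeM e) <= 0)%E.
  by rewrite -A0; apply: le_measure; rewrite ?inE//; exact: measurable_box.
rewrite leNgt => /negP; apply.
have ee : - e <= e by rewrite ge0_cp// ltW.
have -> : volume n (cubeM e) = (\prod_(i < n) (e - - e))%:E by exact: (@volume_box _ _ (fun=> - e) (fun=> e) (fun=> ee)).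
by rewrite lte_fin prodr_gt0// => i _; rewrite opprK addr_gt0.
Qed.

Lemma helmholtz_unique (lam : R) W : 0 < lam -> L2 mu W ->
  (forall phi : E -> R, rtest phi -> \int[mu]_x (W x * (lam * phi x - \sum_j pderiv j (pderiv j phi) x)) = 0) ->
  {ae mu, forall x, W x = 0}.
Proof.
move=> lam0 LW HW; apply: du_Bois_Reymond; first exact: L2_rloc.
move=> psi tpsi; have tr := rtest_tens tpsi; set rho := tens psi in tr *.
pose F := mollify rho W.
pose F1 j x := - mollify (pderiv j rho) W x.
pose F2 j := mollify (pderiv j (pderiv j rho)) W.
have LF : L2 mu F by exact: L2_mollify.
have td j := rtest_pderiv j tr; have tdd j := rtest_pderiv j (td j).
have LF1 j : L2 mu (F1 j) by apply: L2N; exact: L2_mollify.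
have LF2 j : L2 mu (F2 j) by exact: L2_mollify.
have w1 j : rwpd j F (F1 j) by exact: rwpd_mollify.
have w2 j : rwpd j (F1 j) (F2 j).
  have := rwpdN (rwpd_mollify j (td j) LW).
  by rewrite (_ : (fun x => - - _) = F2 j)//; apply/funext => x; rewrite opprK.
(* Valid at every x: it is the equation for W tested with the translate of rho by x. *)
have eq0 x : lam * F x = \sum_j F2 j x.
  apply/eqP; rewrite -subr_eq0; apply/eqP.
  have [tx dx] := rtest_shift x tr.
  have iF := L2M LW (bsupp_L2 (bsupp_rtest tx)).
  have [tdx ddx] : (forall j, rtest (fun y => pderiv j (pderiv j rho) (y - x))) /\
      (forall j, pderiv j (pderiv j (fun y => rho (y - x))) = fun y => pderiv j (pderiv j rho) (y - x)).
    by split=> j; [case: (rtest_shift x (tdd j))|rewrite dx; case: (rtest_shift x (td j))].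
  have iD j := L2M LW (bsupp_L2 (bsupp_rtest (tdx j))).
  have iS := igr_sum (index_enum 'I_n) xpredT iD.
  rewrite -[RHS](HW _ tx).
  have -> : lam * F x = \int[mu]_z (lam * (W z * rho (z - x))).
    by rewrite (RintZ _ iF) /F mollify_translate//; congr (_ * _); apply: eq_Rint => z; rewrite mulrC.
  have -> : \sum_j F2 j x = \int[mu]_z \sum_j (W z * pderiv j (pderiv j rho) (z - x)).
    rewrite (Rint_sum _ _ iD); apply: eq_bigr => j _; rewrite /F2 mollify_translate//.
    by apply: eq_Rint => z; rewrite mulrC.
  rewrite -(RintB (igrZ lam iF) iS); apply: eq_Rint => z.
  under [in RHS]eq_bigr do rewrite ddx.
  by rewrite -mulr_sumr; ring.
have F0 : {ae mu, forall x, F x = 0}.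
  apply: sqn_eq0 => //; apply/eqP; rewrite eq_le sqn_ge0 andbT -(ler_pM2l lam0) mulr0.
  rewrite -(RintZ lam (L2_igr LF)).
  have -> : \int[mu]_x (lam * F x ^+ 2) = \sum_j \int[mu]_x (F2 j x * F x).
    have iFF j : igr mu (fun x => F2 j x * F x) by exact: L2M.
    rewrite -(Rint_sum _ _ iFF).
    by apply: eq_Rint => x; rewrite -mulr_suml -eq0 mulrA.
  apply: sumr_le0 => j _; rewrite (rwpd_IBP (LF1 j) LF (w2 j) (LF2 j) (w1 j) (LF1 j)).
  by rewrite oppr_le0; apply: Rint_ge0 => x; rewrite -expr2 sqr_ge0.
(* The integral to be shown zero is the mollification at the origin, but F vanishes only almost
   everywhere. Hence zeros of F tending to the origin are chosen, and the limit is taken under the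
   integral. *)
have /choice[x Hx] : forall k : nat, exists x : E, (forall i, `|x ord0 i| < k.+1%:R^-1) /\ F x = 0.
  by move=> k; have [|x] := ae_zero_near0 (_ : 0 < k.+1%:R^-1 :> R) F0 => //; exists x.
have [M HM] := rtest_bounded_support tr; have [C HC] := rtest_bounded tr.
have [mW lW] := L2_rloc LW.
have xk k i : `|x k ord0 i| < k.+1%:R^-1 by case: (Hx k).
have mrho k : measurable_fun setT (fun z : E => rho (z - x k)).
  by case: (bsupp_rtest (rtest_shift (x k) tr).1).
(* The shifts have coordinates at most 1, so all translated supports stay in the cube of half-side M
   + 1. *)
have [] := @Rint_dominated _ _ R mu (fun k z => W z * rho (z - x k)) (fun z => W z * rho z)
  (fun z => C * `|\1_(cubeM (M + 1)) z * W z|).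
- by move=> k; exact: measurable_funM.
- by apply: measurable_funM => //; case: (bsupp_rtest tr).
- move=> z; apply: cvgM; first exact: cvg_cst.
  apply/cvgrPdist_lt => e e0.
  have [tz _] := rtest_reflect z tr.
  have cz : {for 0, continuous (fun y : E => rho (z - y))} by apply: smooth_continuous; case: tz.
  have [d d0 Hd] := continuous0_box cz e0.
  near=> k; have := Hd (x k); rewrite subr0 distrC; apply => i.
  apply: lt_trans (xk k i) _; near: k; exact: (near_infty_natSinv_lt (PosNum d0)).
- exact: igrZ (igr_norm (lW _)).
- move=> k z; have [zM|/existsNP[i /negP]] := pselect (forall i, `|z ord0 i| < M + 1).
    have -> : \1_(cubeM (M + 1)) z = 1 :> R by rewrite indicE mem_set//; apply/cubeP.
    by rewrite mul1r normrM mulrC; apply: ler_wpM2r => //; exact: HC.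
  rewrite -leNgt => zM; rewrite (HM _ i) ?mulr0 ?normr0 ?mulr_ge0//.
    exact: le_trans (HC 0).
  rewrite !mxE; have k1 : k.+1%:R^-1 <= 1 :> R by rewrite invf_le1// ler1n.
  have := ler_normB (z ord0 i - x k ord0 i) (- x k ord0 i); rewrite opprK subrK normrN => H.
  rewrite -(lerD2r 1); apply: le_trans zM _; apply: le_trans H _; rewrite lerD2l.
  by apply: ltW; exact: lt_le_trans (xk k i) k1.
move=> _; have e k : \int[mu]_z (W z * rho (z - x k)) = 0.
  have [_ <-] := Hx k; rewrite /F mollify_translate//.
  by apply: eq_Rint => z; rewrite mulrC.
under eq_cvg do rewrite e.
by move=> /(cvg_unique _ (cvg_cst _)) <-.
Unshelve. all: by end_near. Qed.

End helmholtz_uniqueness.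

(** * Concentration at the origin *)

Section capacity.
Context {R : realType} {n : nat}.
Local Notation E := 'rV[R]_n.
Local Notation mu := (volume n).

Lemma Rint_indic_cube (M : R) : 0 <= M ->
  igr mu (\1_(cubeM M) : E -> R) /\ \int[mu]_x (\1_(cubeM M) : E -> R) x = (2 * M) ^+ n.
Proof.
move=> M0; have MM : - M <= M by rewrite ge0_cp.
split; first exact: igr_indic_box.
rewrite /Rintegral integral_indic ?setIT//; last exact: measurable_box.
apply: etrans (congr1 fine (@volume_box _ _ (fun=> - M) (fun=> M) (fun=> MM))) _.
by rewrite /= prodr_const card_ord opprK -mulr2n mulr_natl.
Qed.

(* The rescaled functions are bounded in L^2 for n >= 2 and their supports shrink
   to the origin. *)
Lemma concentrating_test_cvg0 (h phi : E -> R) : (1 < n)%N -> L2 mu h -> rtest phi ->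
  \int[mu]_x (h x * (k.+1%:R * phi (k.+1%:R *: x))) @[k --> \oo] --> (0 : R).
Proof.
move=> n1 Lh tp; have n0 : (0 < n)%N by exact: ltnW.
have [mh _] := Lh.
pose i0 := Ordinal n0.
have [M0 HM0] := rtest_bounded_support tp; have [C HC] := rtest_bounded tp.
have C0 : 0 <= C by apply: le_trans (HC 0).
pose M := `|M0| + 1.
have M_gt0 : 0 < M by rewrite ltr_wpDl.
have HM x : ~ cubeM M x -> phi x = 0.
  move=> /existsNP[i /negP]; rewrite -ltr_norml -leNgt => Mx; apply: (HM0 _ i).
  by apply: le_trans Mx; rewrite (le_trans (ler_norm _))// lerDl.
pose Q k : set E := cubeM (M / k.+1%:R).
have mQ k : measurable (Q k) by exact: measurable_box.
have kk k : 0 < k.+1%:R :> R by [].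
have QE k x : cubeM M (k.+1%:R *: x) -> Q k x.
  move=> /cubeP xM; apply/cubeP => i; rewrite ltr_pdivlMr//.
  by have := xM i; rewrite mxE normrM (gtr0_norm (kk k)) mulrC.
pose pk k x := k.+1%:R * phi (k.+1%:R *: x).
have le_pk k x : `|pk k x| <= k.+1%:R * C * \1_(Q k) x.
  rewrite /pk normrM (gtr0_norm (kk k)) -mulrA; apply: ler_wpM2l; first exact: ltW.
  have [xQ|xQ] := pselect (Q k x); first by rewrite indicE mem_set// mulr1.
  by rewrite HM ?normr0 ?mulr_ge0// => /QE.
have tpk k : rtest (fun x => phi (k.+1%:R *: x)).
  have s0 : k.+1%:R != 0 :> R by rewrite gt_eqF.
  have [t1 _] := rtest_affine (0 : E) s0 tp.
  by rewrite (_ : (fun x => _) = fun y => phi (0 + k.+1%:R *: y))//; apply/funext => y; rewrite add0r.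
have Lpk k : L2 mu (pk k) by apply: L2Z; exact: bsupp_L2 (bsupp_rtest (tpk k)).
pose K := C ^+ 2 * (2 * M) ^+ n.
have K0 : 0 <= K by rewrite mulr_ge0 ?sqr_ge0 ?exprn_ge0 ?mulr_ge0 ?(ltW M_gt0).
(* The amplitude contributes (k+1)^2 and the volume of the cube (k+1)^(-n); the product is bounded
   because n >= 2. *)
have sqpk k : sqn mu (pk k) <= K.
  have [iQ eQ] := @Rint_indic_cube (M / k.+1%:R) (divr_ge0 (ltW M_gt0) (ltW (kk k))).
  apply: (@le_trans _ _ (\int[mu]_x ((k.+1%:R * C) ^+ 2 * \1_(Q k) x))).
    apply: (le_Rint (L2_igr (Lpk k)) (igrZ _ iQ)) => x.
    have -> : \1_(Q k) x = (\1_(Q k) x) ^+ 2 :> R by rewrite indicE; case: (_ \in _); rewrite ?expr1n ?expr0n.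
    rewrite -exprMn -(real_normK (num_real (pk k x))); apply: lerXn2r; rewrite ?nnegrE ?mulr_ge0//.
  rewrite (RintZ _ iQ) eQ mulrA expr_div_n exprMn /K.
  rewrite (_ : _ * _ = C ^+ 2 * (2 * M) ^+ n * (k.+1%:R ^+ 2 / k.+1%:R ^+ n)); last by ring.
  rewrite ler_piMr// ler_pdivrMr ?exprn_gt0// mul1r.
  by apply: ler_weXn2l => //; rewrite ler1n.
(* The cubes Q k shrink to the origin, which lies in the null hyperplane Z. With h set to 0 on Z,
   the truncations converge to 0 at every point. *)
pose Z : set E := [set x | x ord0 i0 = 0].
have mZ : measurable Z.
  have := @measurable_row_coord R n i0 measurableT [set 0] (measurable_set1 _).
  by rewrite setTI.
pose h1 x := \1_(~` Z) x * h x.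
have mh1 : measurable_fun setT h1.
  by apply: measurable_funM => //; apply: measurable_indic; exact: measurableC.
have h1h : {ae mu, forall x, h x = h1 x}.
  apply: filterS (@ae_coord_neq0 R n) => x x0; rewrite /h1 indicE mem_set ?mul1r//= => Zx.
  by have := x0 i0; rewrite Zx eqxx.
have Lh1 : L2 mu h1 by exact: L2_ae mh1 h1h Lh.
have LQ k : L2 mu (fun x => \1_(Q k) x * h1 x).
  apply: (le_L2 _ _ (L2_norm Lh1)) => [|x]; first by apply: measurable_funM => //; exact: measurable_indic.
  by rewrite normrM ler_piMl// indicE; case: (_ \in _); rewrite ?normr1 ?normr0.
have [_ cv] : igr mu (fun=> 0 : R) /\ \int[mu]_x (\1_(Q k) x * h1 x) ^+ 2 @[k --> \oo] --> \int[mu]_x (0 : R).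
  apply: (Rint_dominated _ _ _ (L2_igr Lh1)) => //.
  - by move=> k; apply: measurable_funX; case: (LQ k).
  - move=> x; have [Zx|Zx] := pselect (Z x).
      rewrite /h1; under eq_cvg do rewrite [\1_(~` Z) x]indicE memNset ?mul0r ?mulr0 ?expr0n//.
      exact: cvg_cst.
    apply: cvg_near_cst.
    have x0 : 0 < `|x ord0 i0| / M by rewrite divr_gt0// normr_gt0; apply/eqP.
    have := near_infty_natSinv_lt (PosNum x0); apply: filterS => k /= Hk.
    rewrite indicE memNset ?mul0r ?expr0n// => /cubeP/(_ i0).
    by move: Hk; rewrite ltr_pdivlMr// mulrC => Hk; rewrite ltNge (ltW Hk).
  - move=> k x; rewrite ger0_norm ?sqr_ge0// exprMn ler_piMl ?sqr_ge0//.
rewrite Rint0 in cv.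
apply/norm_cvg0P; apply: (@squeeze_cvgr _ _ _ _ (fun=> 0)
  (fun k => Num.sqrt (\int[mu]_x (\1_(Q k) x * h1 x) ^+ 2) * Num.sqrt K)); last 2 first.
- exact: cvg_cst.
- rewrite -[X in _ --> X](mul0r (Num.sqrt K)); apply: cvgM; last exact: cvg_cst.
  rewrite -(sqrtr0 R); apply: (cvg_comp _ _ cv); exact: sqrt_continuous.
apply: nearW => k; rewrite normr_ge0/=.
have -> : \int[mu]_x (h x * (k.+1%:R * phi (k.+1%:R *: x))) = \int[mu]_x (\1_(Q k) x * h1 x * pk k x).
  apply: Rint_ae.
  - by apply: measurable_funM => //; case: (Lpk k).
  - by apply: measurable_funM; [case: (LQ k)|case: (Lpk k)].
  - apply: filterS h1h => x ->; rewrite -/(pk k x).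
    have [xQ|xQ] := pselect (Q k x); first by rewrite [\1_(Q k) x]indicE mem_set// mul1r.
    by rewrite /pk HM ?mulr0// => /QE.
apply: (le_trans (norm_Rint_mul (LQ k) (Lpk k))).
by apply: ler_wpM2l; [exact: sqrtr_ge0|apply: ler_wsqrtr].
Qed.

Lemma fundamental_not_H1 (lam : R) (g : E -> R) (h : 'I_n -> E -> R) : (1 < n)%N -> L2 mu g ->
  (forall phi : E -> R, rtest phi -> \int[mu]_x (g x * (lam * phi x - \sum_j pderiv j (pderiv j phi) x)) = phi 0) ->
  (forall j, rwpd j g (h j)) -> (forall j, L2 mu (h j)) -> False.
Proof.
move=> n1 Lg Hg wg Lh.
pose psi (i : 'I_n) : R -> R := bump1 (-1) 1 1.
have tpsi i : test1 (psi i) by exact: test1_bump.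
have tp := rtest_tens tpsi; set phi := tens psi in tp.
have p0 : 0 < phi 0.
  by apply: prodr_gt0 => i _; rewrite mxE; apply: bump1_gt0; rewrite ?ltrN10 ?ltr01.
(* The equation tested with phi((k+1) x), after moving one derivative onto g. The derivative left on
   the test function has the concentrating form; the factor 1/(k+1) gives the zeroth-order term the
   same form. *)
pose T k := lam * k.+1%:R^-1 * \int[mu]_x (g x * (k.+1%:R * phi (k.+1%:R *: x))) +
  \sum_j \int[mu]_x (h j x * (k.+1%:R * pderiv j phi (k.+1%:R *: x))).
have TE k : T k = phi 0.
  have s0 : k.+1%:R != 0 :> R by rewrite gt_eqF.
  have [t1 d1] := rtest_affine (0 : E) s0 tp.
  have e (u : E -> R) : (fun y => u (0 + k.+1%:R *: y)) = fun y => u (k.+1%:R *: y).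
    by apply/funext => y; rewrite add0r.
  rewrite e in t1; pose pk x := phi (k.+1%:R *: x); rewrite -/pk in t1.
  have dk j : pderiv j pk = fun y => k.+1%:R * pderiv j phi (k.+1%:R *: y).
    by rewrite -[pk]e d1; apply/funext => y; rewrite add0r.
  have <- : pk 0 = phi 0 by rewrite /pk scaler0.
  rewrite -(Hg _ t1) /T.
  have i1 : igr mu (fun x => lam * (g x * pk x)) by apply: igrZ; apply: L2M => //; exact: bsupp_L2 (bsupp_rtest t1).
  have i2 j : igr mu (fun x => g x * pderiv j (pderiv j pk) x).
    by apply: L2M => //; apply: bsupp_L2; apply: bsupp_rtest; do 2!apply: rtest_pderiv.
  have i3 := igr_sum (index_enum 'I_n) xpredT i2.
  transitivity (\int[mu]_x (lam * (g x * pk x) - \sum_j (g x * pderiv j (pderiv j pk) x))); last first.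
    by apply: eq_Rint => x; rewrite -mulr_sumr; ring.
  rewrite (RintB i1 i3) (Rint_sum _ _ i2) -sumrN; congr (_ + _).
    have i4 : igr mu (fun x => g x * (k.+1%:R * pk x)).
      by apply: L2M => //; apply: L2Z; exact: bsupp_L2 (bsupp_rtest t1).
    by rewrite -(RintZ _ i4); apply: eq_Rint => x; field.
  apply: eq_bigr => j _; have [_ _ /(_ _ (rtest_pderiv j t1)) ->] := wg j.
  by rewrite opprK dk.
have cv : T k @[k --> \oo] --> (0 : R).
  rewrite -[X in _ --> X]addr0; apply: cvgD.
    rewrite -[X in _ --> X](mulr0 (lam * 0)); apply: cvgM; last exact: concentrating_test_cvg0.
    by apply: cvgM; [exact: cvg_cst|exact: cvg_harmonic].
  elim: (index_enum 'I_n) => [|j s IH].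
    by under eq_cvg do rewrite big_nil; exact: cvg_cst.
  rewrite -[X in _ --> X]addr0; under eq_cvg do rewrite big_cons.
  apply: cvgD => //.
  by apply: concentrating_test_cvg0 => //; exact: rtest_pderiv.
have c2 : T k @[k --> \oo] --> phi 0 by under eq_cvg do rewrite TE; exact: cvg_cst.
by move: p0; rewrite (cvg_unique _ c2 cv)// ltxx.
Qed.

End capacity.

(** * Complex-valued functions *)

Section complex_parts.
Context {R : realType}.
Implicit Types x y : R[i].
Local Notation normc := ComplexField.Normc.normc.

Lemma cReM x y : complex.Re (x * y) = complex.Re x * complex.Re y - complex.Im x * complex.Im y.
Proof. by case: x y => [a b] [c d]. Qed.

Lemma cImM x y : complex.Im (x * y) = complex.Re x * complex.Im y + complex.Im x * complex.Re y.
Proof. by case: x y => [a b] [c d]; rewrite /= addrC [b * c]mulrC addrC. Qed.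

Lemma cReD x y : complex.Re (x + y) = complex.Re x + complex.Re y.
Proof. by case: x y => [a b] [c d]. Qed.

Lemma cImD x y : complex.Im (x + y) = complex.Im x + complex.Im y.
Proof. by case: x y => [a b] [c d]. Qed.

Lemma cReN x : complex.Re (- x) = - complex.Re x.
Proof. by case: x. Qed.

Lemma cImN x : complex.Im (- x) = - complex.Im x.
Proof. by case: x. Qed.

Lemma cReJ x : complex.Re (x^*) = complex.Re x.
Proof. by case: x. Qed.

Lemma cImJ x : complex.Im (x^*) = - complex.Im x.
Proof. by case: x. Qed.

Lemma cReC (a : R) : complex.Re a%:C = a. Proof. by []. Qed.

Lemma cImC (a : R) : complex.Im a%:C = 0. Proof. by []. Qed.

Definition partsE := (cReM, cImM, cReD, cImD, cReN, cImN, cReJ, cImJ, cReC, cImC).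

Lemma complex_parts_eq x y : complex.Re x = complex.Re y -> complex.Im x = complex.Im y -> x = y.
Proof. by case: x y => [a b] [c d] /= -> ->. Qed.

Lemma normc_ge0 x : 0 <= normc x.
Proof. by case: x => a b; exact: sqrtr_ge0. Qed.

Lemma normc_sqr x : normc x ^+ 2 = complex.Re x ^+ 2 + complex.Im x ^+ 2.
Proof. by case: x => a b; rewrite sqr_sqrtr// addr_ge0// sqr_ge0. Qed.

Lemma Re_le_normc x : `|complex.Re x| <= normc x.
Proof.
by case: x => a b; rewrite -sqrtr_sqr; apply: ler_wsqrtr; rewrite lerDl sqr_ge0.
Qed.

Lemma Im_le_normc x : `|complex.Im x| <= normc x.
Proof.
by case: x => a b; rewrite -sqrtr_sqr; apply: ler_wsqrtr; rewrite lerDr sqr_ge0.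
Qed.

Lemma normc_le x : normc x <= `|complex.Re x| + `|complex.Im x|.
Proof.
rewrite -(ler_pXn2r (ltn0Sn 1)) ?nnegrE ?normc_ge0 ?addr_ge0// normc_sqr.
rewrite -(real_normK (num_real (complex.Re x))) -(real_normK (num_real (complex.Im x))).
by have := mulr_ge0 (normr_ge0 (complex.Re x)) (normr_ge0 (complex.Im x)); nra.
Qed.

Lemma normc_triangle x y : normc (x + y) <= normc x + normc y.
Proof. exact: le_normcD. Qed.

Lemma normc_mul x y : normc (x * y) = normc x * normc y.
Proof. exact: ComplexField.Normc.normcM. Qed.

Lemma normc_opp x : normc (- x) = normc x.
Proof. exact: normcN. Qed.

Lemma normc_conj x : normc (x^*) = normc x.
Proof. by case: x => a b; rewrite /= sqrrN. Qed.

End complex_parts.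

Section complex_integral.
Context {R : realType} {n : nat}.
Local Notation E := 'rV[R]_n.
Local Notation mu := (volume n).
Local Notation normc := ComplexField.Normc.normc.
Implicit Types f g h : E -> R[i].

Definition cigr f := igr mu (fun x => complex.Re (f x)) /\ igr mu (fun x => complex.Im (f x)).
Definition cL2 f := L2 mu (fun x => complex.Re (f x)) /\ L2 mu (fun x => complex.Im (f x)).

Lemma cigr_norm f : cmeasurable f -> igr mu (fun x => normc (f x)) -> cigr f.
Proof.
move=> [mr mi] i; split.
  by apply: (le_igr mr _ i) => x; exact: Re_le_normc.
by apply: (le_igr mi _ i) => x; exact: Im_le_normc.
Qed.

Lemma eq_cint f g : f =1 g -> cintegral f = cintegral g.
Proof. by move=> /funext ->. Qed.

Lemma Re_cint f : complex.Re (cintegral f) = \int[mu]_x complex.Re (f x).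
Proof. by []. Qed.

Lemma Im_cint f : complex.Im (cintegral f) = \int[mu]_x complex.Im (f x).
Proof. by []. Qed.

Lemma cigrZ a f : cigr f -> cigr (fun x => a * f x).
Proof.
move=> [fr fi]; split.
  by apply: (eq_igr _ (igrB (igrZ (complex.Re a) fr) (igrZ (complex.Im a) fi))) => x; rewrite cReM.
by apply: (eq_igr _ (igrD (igrZ (complex.Re a) fi) (igrZ (complex.Im a) fr))) => x; rewrite cImM.
Qed.

Lemma cintD f g : cigr f -> cigr g -> cintegral (fun x => f x + g x) = cintegral f + cintegral g.
Proof.
move=> [fr fi] [gr gi]; apply: complex_parts_eq.
  by rewrite cReD !Re_cint -(RintD fr gr); apply: eq_Rint => x; rewrite cReD.
by rewrite cImD !Im_cint -(RintD fi gi); apply: eq_Rint => x; rewrite cImD.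
Qed.

Lemma cintZ a f : cigr f -> cintegral (fun x => a * f x) = a * cintegral f.
Proof.
move=> [fr fi]; apply: complex_parts_eq.
  rewrite cReM !(Re_cint, Im_cint) -(RintZ _ fr) -(RintZ _ fi) -(RintB (igrZ _ fr) (igrZ _ fi)).
  by apply: eq_Rint => x; rewrite cReM.
rewrite cImM !(Re_cint, Im_cint) -(RintZ _ fr) -(RintZ _ fi) -(RintD (igrZ _ fi) (igrZ _ fr)).
by apply: eq_Rint => x; rewrite cImM.
Qed.

Lemma cintJ f : cigr f -> cintegral (fun x => (f x)^*) = (cintegral f)^*.
Proof.
move=> [fr fi]; apply: complex_parts_eq; rewrite partsE !(Re_cint, Im_cint).
  by apply: eq_Rint => x; rewrite cReJ.
by rewrite -(RintN fi); apply: eq_Rint => x; rewrite cImJ.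
Qed.

Lemma cint_ae f g : cmeasurable f -> cmeasurable g -> {ae mu, forall x, f x = g x} -> cintegral f = cintegral g.
Proof.
move=> [fr fi] [gr gi] fg; apply: complex_parts_eq; rewrite !(Re_cint, Im_cint); apply: Rint_ae => //;
  by apply: filterS fg => x ->.
Qed.

(** The factor 2 comes from estimating real and imaginary parts separately; continuity of the
    functionals tolerates it. *)
Lemma normc_cint f : cmeasurable f -> igr mu (fun x => normc (f x)) ->
  normc (cintegral f) <= 2 * \int[mu]_x normc (f x).
Proof.
move=> mf i; have [fr fi] := cigr_norm mf i.
apply: (le_trans (normc_le _)); rewrite Re_cint Im_cint mulr_natl mulr2n; apply: lerD; apply: le_norm_Rint => // x.
- exact: Re_le_normc.
- exact: Im_le_normc.
Qed.

Lemma cmeasurableD f g : cmeasurable f -> cmeasurable g -> cmeasurable (fun x => f x + g x).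
Proof.
move=> [fr fi] [gr gi]; split.
  by under eq_fun do rewrite cReD; exact: measurable_funD.
by under eq_fun do rewrite cImD; exact: measurable_funD.
Qed.

Lemma cmeasurableM f g : cmeasurable f -> cmeasurable g -> cmeasurable (fun x => f x * g x).
Proof.
move=> [fr fi] [gr gi]; split.
  by under eq_fun do rewrite cReM; apply: measurable_funB; exact: measurable_funM.
by under eq_fun do rewrite cImM; apply: measurable_funD; exact: measurable_funM.
Qed.

Lemma cmeasurable_cst (a : R[i]) : cmeasurable (fun _ : E => a).
Proof. by split; exact: measurable_cst. Qed.

Lemma cmeasurableZ a f : cmeasurable f -> cmeasurable (fun x => a * f x).
Proof. by move=> mf; apply: cmeasurableM => //; exact: cmeasurable_cst. Qed.

Lemma cmeasurableJ f : cmeasurable f -> cmeasurable (fun x => (f x)^*).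
Proof.
move=> [fr fi]; split; first by under eq_fun do rewrite cReJ.
by under eq_fun do rewrite cImJ; exact: measurableT_comp.
Qed.

Lemma measurable_normc f : cmeasurable f -> measurable_fun setT (fun x => normc (f x)).
Proof.
move=> [fr fi].
have e : (fun x => normc (f x)) = fun x => (complex.Re (f x) ^+ 2 + complex.Im (f x) ^+ 2) `^ 2^-1.
  by apply/funext => x; rewrite powR12_sqrt ?addr_ge0 ?sqr_ge0//; case: (f x).
rewrite e; apply: (measurableT_comp (measurable_powR _)).
by apply: measurable_funD; exact: measurable_funX.
Qed.

Lemma L2_normc f : cL2 f -> L2 mu (fun x => normc (f x)).
Proof.
move=> [fr fi]; apply: L2P; first by apply: measurable_normc; split; [case: fr|case: fi].
by apply: (eq_igr _ (igrD (L2_igr fr) (L2_igr fi))) => x; rewrite normc_sqr.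
Qed.

Lemma cL2_normc f : cmeasurable f -> L2 mu (fun x => normc (f x)) -> cL2 f.
Proof.
move=> [mr mi] L; split.
  by apply: (le_L2 mr _ L) => x; exact: Re_le_normc.
by apply: (le_L2 mi _ L) => x; exact: Im_le_normc.
Qed.

Lemma cL2_measurable f : cL2 f -> cmeasurable f.
Proof. by move=> [[fr _] [fi _]]. Qed.

Lemma cL2D f g : cL2 f -> cL2 g -> cL2 (fun x => f x + g x).
Proof.
move=> [fr fi] [gr gi]; split.
  by under eq_fun do rewrite cReD; exact: L2D.
by under eq_fun do rewrite cImD; exact: L2D.
Qed.

Lemma cL2Z a f : cL2 f -> cL2 (fun x => a * f x).
Proof.
move=> [fr fi]; split.
  by under eq_fun do rewrite cReM; apply: L2B; exact: L2Z.
by under eq_fun do rewrite cImM; apply: L2D; exact: L2Z.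
Qed.

Lemma cigr_inner_norm f g : cmeasurable f -> cmeasurable g -> igr mu (fun x => normc (f x) * normc (g x)) ->
  cigr (fun x => f x * (g x)^*).
Proof.
move=> mf mg i; apply: cigr_norm; first by apply: cmeasurableM => //; exact: cmeasurableJ.
by apply: (eq_igr _ i) => x; rewrite normc_mul normc_conj.
Qed.

Lemma normc_inner f g : cmeasurable f -> cmeasurable g -> igr mu (fun x => normc (f x) * normc (g x)) ->
  normc (inner f g) <= 2 * \int[mu]_x (normc (f x) * normc (g x)).
Proof.
move=> mf mg i; have e x : normc (f x * (g x)^*) = normc (f x) * normc (g x) by rewrite normc_mul normc_conj.
rewrite /inner -(eq_Rint _ e); apply: normc_cint; last by apply: (eq_igr _ i) => x; rewrite e.
by apply: cmeasurableM => //; exact: cmeasurableJ.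
Qed.

Lemma cigr_inner f g : cL2 f -> cL2 g -> cigr (fun x => f x * (g x)^*).
Proof.
move=> Lf Lg; apply: cigr_inner_norm; try exact: cL2_measurable.
by apply: L2M; exact: L2_normc.
Qed.

Lemma innerJ f g : cigr (fun x => f x * (g x)^*) -> inner g f = (inner f g)^*.
Proof.
move=> i; rewrite /inner -cintJ//; apply: eq_cint => x.
by apply: complex_parts_eq; rewrite !partsE; ring.
Qed.

Lemma inner_linear_l a f f' g : cigr (fun x => f x * (g x)^*) -> cigr (fun x => f' x * (g x)^*) ->
  inner (fun x => a * f x + f' x) g = a * inner f g + inner f' g.
Proof.
move=> i i'; rewrite /inner -(cintZ a i) -(cintD (cigrZ a i) i').
by apply: eq_cint => x; rewrite mulrDl mulrA.
Qed.

Lemma inner_linear_r a f g g' : cigr (fun x => f x * (g x)^*) -> cigr (fun x => f x * (g' x)^*) ->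
  inner f (fun x => a * g x + g' x) = a^* * inner f g + inner f g'.
Proof.
move=> i i'; rewrite /inner -(cintZ (a^*) i) -(cintD (cigrZ (a^*) i) i').
by apply: eq_cint => x; rewrite rmorphD rmorphM mulrDr mulrCA.
Qed.

Lemma inner_ae f f' g g' : cmeasurable f -> cmeasurable f' -> cmeasurable g -> cmeasurable g' ->
  {ae mu, forall x, f x = f' x} -> {ae mu, forall x, g x = g' x} -> inner f g = inner f' g'.
Proof.
move=> mf mf' mg mg' ff' gg'; apply: cint_ae.
- by apply: cmeasurableM => //; exact: cmeasurableJ.
- by apply: cmeasurableM => //; exact: cmeasurableJ.
- by apply: filterS2 ff' gg' => x -> ->.
Qed.

Lemma in_LpP (q : R) f : 0 < q -> in_Lp q f <-> cmeasurable f /\ igr mu (fun x => normc (f x) `^ q).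
Proof.
move=> q0; have q1 : q != 0 by rewrite gt_eqF.
have iff1 : cmeasurable f -> igr mu (fun x => normc (f x) `^ q) <-> (\int[mu]_x (normc (f x) `^ q)%:E < +oo)%E.
  move=> mf; have mp : measurable_fun setT (fun x => normc (f x) `^ q).
    by apply: (measurableT_comp (measurable_powR _)); exact: measurable_normc.
  split; last by apply: ge0_igr => // x; exact: powR_ge0.
  by move=> /EFin_Rint <-; exact: ltry.
have e : (cLnorm q f `^ q = \int[mu]_x (normc (f x) `^ q)%:E)%E.
  rewrite /cLnorm (powR_Lnorm _ _ q1); apply: eq_integral => x _.
  by rewrite /= (ger0_norm (normc_ge0 _)).
split=> -[mf]; first by move=> fq; split=> //; apply/iff1 => //; rewrite -e; exact: poweR_lty.
move=> /iff1 => /(_ mf); rewrite -e => fq; split => //; exact: lty_poweRy q1 fq.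
Qed.

Lemma in_L2P f : in_Lp 2 f <-> cL2 f.
Proof.
split=> [/in_LpP[]// mf i|Lf].
  apply: cL2_normc => //; apply: L2P; first exact: measurable_normc.
  by apply: (eq_igr _ i) => x; rewrite -powR_mulrn// normc_ge0.
apply/in_LpP => //; split; first exact: cL2_measurable.
by apply: (eq_igr _ (L2_igr (L2_normc Lf))) => x; rewrite -powR_mulrn// normc_ge0.
Qed.

Lemma Lp_norm_powR (q : R) f : 0 < q -> in_Lp q f -> Lp_norm q f `^ q = \int[mu]_x normc (f x) `^ q.
Proof.
move=> q0 fq; have [mf i] := (in_LpP f q0).1 fq; have [_ foo] := fq.
have q1 : q != 0 by rewrite gt_eqF.
have f0 : (0 <= cLnorm q f)%E by exact: Lnorm_ge0.
have ff : cLnorm q f \is a fin_num by rewrite ge0_fin_numE.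
suff : ((Lp_norm q f `^ q)%:E = (\int[mu]_x normc (f x) `^ q)%:E)%E by case.
rewrite (EFin_Rint i) -poweR_EFin /Lp_norm (fineK ff) /cLnorm (powR_Lnorm _ _ q1).
by apply: eq_integral => x _; rewrite /= (ger0_norm (normc_ge0 _)).
Qed.

Lemma Lp_norm_ge0 (q : R) f : 0 <= Lp_norm q f.
Proof. by apply: fine_ge0; exact: Lnorm_ge0. Qed.

Lemma Lp_norm2_sqn f : cL2 f -> Lp_norm 2 f ^+ 2 = sqn mu (fun x => normc (f x)).
Proof.
move=> Lf; have := @Lp_norm_powR 2 f (ltr0n R 2) ((in_L2P f).2 Lf).
rewrite powR_mulrn ?Lp_norm_ge0// => ->; apply: eq_Rint => x.
by rewrite powR_mulrn// normc_ge0.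
Qed.

Lemma Lp_norm2E f : cL2 f -> Lp_norm 2 f = Num.sqrt (sqn mu (fun x => normc (f x))).
Proof. by move=> Lf; rewrite -(Lp_norm2_sqn Lf) sqrtr_sqr ger0_norm ?Lp_norm_ge0. Qed.

Lemma normc_inner_L2 f g : cL2 f -> cL2 g -> normc (inner f g) <= 2 * Lp_norm 2 f * Lp_norm 2 g.
Proof.
move=> Lf Lg; have Nf := L2_normc Lf; have Ng := L2_normc Lg.
apply: (le_trans (normc_inner (cL2_measurable Lf) (cL2_measurable Lg) (L2M Nf Ng))).
rewrite -mulrA ler_pM2l// !Lp_norm2E//; apply: le_trans (norm_Rint_mul Nf Ng); exact: ler_norm.
Qed.

Lemma inner_norm2 f : cL2 f -> inner f f = (Lp_norm 2 f ^+ 2)%:C.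
Proof.
move=> Lf; rewrite Lp_norm2_sqn//; apply: complex_parts_eq; rewrite ?cReC ?cImC /inner ?Re_cint ?Im_cint.
  by apply: eq_Rint => x; rewrite normc_sqr !partsE; ring.
by rewrite -[RHS](@Rint0 _ _ R mu); apply: eq_Rint => x; rewrite !partsE; ring.
Qed.

Lemma igr_hoelder (q r : R) f g : 0 < q -> 0 < r -> q^-1 + r^-1 = 1 -> in_Lp q f -> in_Lp r g ->
  igr mu (fun x => normc (f x) * normc (g x)) /\
  \int[mu]_x (normc (f x) * normc (g x)) <= Lp_norm q f * Lp_norm r g.
Proof.
move=> q0 r0 qr fq gr; have [mf fy] := fq; have [mg gy] := gr.
have nf := measurable_normc mf; have ng := measurable_normc mg.
have f0 : (0 <= cLnorm q f)%E by exact: Lnorm_ge0.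
have g0 : (0 <= cLnorm r g)%E by exact: Lnorm_ge0.
have := hoelder mu nf ng q0 r0 qr; rewrite Lnorm1.
have ff : cLnorm q f \is a fin_num by rewrite ge0_fin_numE.
have gg : cLnorm r g \is a fin_num by rewrite ge0_fin_numE.
rewrite -/(cLnorm q f) -/(cLnorm r g) -(fineK ff) -(fineK gg) -EFinM.
have e : (\int[mu]_x `|(EFin \o ((fun x => normc (f x)) \* (fun x => normc (g x)))%R) x| =
    \int[mu]_x (normc (f x) * normc (g x))%:E)%E.
  by apply: eq_integral => x _; rewrite /= ger0_norm// mulr_ge0 ?normc_ge0.
rewrite e => H.
have i : igr mu (fun x => normc (f x) * normc (g x)).
  apply: ge0_igr; [exact: measurable_funM|by move=> x; rewrite mulr_ge0 ?normc_ge0|].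
  exact: le_lt_trans H (ltry _).
by split => //; move: H; rewrite -(EFin_Rint i) lee_fin.
Qed.

End complex_integral.

(** * Weak derivatives of complex-valued functions *)

Section complex_weak_derivatives.
Context {R : realType} {n : nat}.
Local Notation E := 'rV[R]_n.
Local Notation mu := (volume n).
Local Notation normc := ComplexField.Normc.normc.
Implicit Types (f g h : E -> R[i]) (j : 'I_n).

Definition crloc f := rloc (fun x => complex.Re (f x)) /\ rloc (fun x => complex.Im (f x)).

(** Every open cube lies in a compact cube, and every compact set lies in an open cube. *)
Lemma loc_integrableP f : loc_integrable f <-> crloc f.
Proof.
split=> [[mf fK]|[[mr lr] [mi li]]].
  have mn := measurable_normc mf.
  have i M : igr mu (fun x => \1_(cubeM M) x * normc (f x)).
    pose K := [set x : E | forall i, x ord0 i \in `[(- M), M]].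
    have cK : compact K.
      by apply: (@rV_compact _ _ (fun=> `[(- M), M]%classic)) => i; exact: segment_compact.
    apply: ge0_igr; first by apply: measurable_funM => //; apply: measurable_indic; exact: measurable_box.
      by move=> x; rewrite mulr_ge0// normc_ge0.
    apply: le_lt_trans (fK K cK); rewrite [leRHS]integral_mkcond.
    apply: ge0_le_integral => //.
    - by move=> x _; rewrite lee_fin mulr_ge0// normc_ge0.
    - apply/measurable_EFinP; apply: measurable_funM => //.
      by apply: measurable_indic; exact: measurable_box.
    - apply/(measurable_restrictT _ (compact_row_measurable cK))/measurable_EFinP.
      exact: measurable_funS mn.
    - move=> x _; rewrite patchE indicE; case: ifPn => [_|xK].
        by rewrite lee_fin ler_piMl ?normc_ge0//; case: (_ \in _).
      rewrite memNset ?mul0r// => /cubeP xM; move/negP : xK; apply; rewrite inE => k.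
      by rewrite in_itv/= -ler_norml ltW.
  have [mr mi] := mf; split; split=> // M.
    apply: (le_igr _ _ (i M)); first by apply: measurable_funM => //; apply: measurable_indic; exact: measurable_box.
    by move=> x; rewrite normrM ger0_norm// ler_wpM2l// Re_le_normc.
  apply: (le_igr _ _ (i M)); first by apply: measurable_funM => //; apply: measurable_indic; exact: measurable_box.
  by move=> x; rewrite normrM ger0_norm// ler_wpM2l// Im_le_normc.
split=> // K cK; have [M M0 KM] := compact_row_bounded cK.
have iM := igrD (igr_norm (lr M)) (igr_norm (li M)).
have mn := measurable_normc (conj mr mi : cmeasurable f).
apply: (@le_lt_trans _ _ (\int[mu]_x (`|\1_(cubeM M) x * complex.Re (f x)| + `|\1_(cubeM M) x * complex.Im (f x)|)%:E)%E); last first.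
  by rewrite -(EFin_Rint iM) ltry.
rewrite integral_mkcond; apply: ge0_le_integral => //.
- by move=> x _; rewrite patchE; case: ifP => // _; rewrite lee_fin normc_ge0.
- apply/(measurable_restrictT _ (compact_row_measurable cK))/measurable_EFinP.
  exact: measurable_funS mn.
- by apply/measurable_EFinP; exact: igr_measurable iM.
- move=> x _; rewrite patchE; case: ifPn => [|_]; last by rewrite lee_fin addr_ge0.
  rewrite inE => xK; rewrite lee_fin !normrM indicE mem_set ?normr1 ?mul1r; first exact: normc_le.
  by apply/cubeP => i; rewrite ltr_norml; exact: KM.
Qed.

Lemma pderiv_cst0 j : pderiv j (fun _ : E => 0 : R) = fun=> 0.
Proof. by apply/funext => x; apply: pderiv_is_derive; exact: is_derive_constant. Qed.

Lemma smooth_cst0 : smooth (fun _ : E => 0 : R).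
Proof.
apply: (@smooth_coind _ _ [set fun _ : E => 0 : R]) => // _ ->; split; first exact: cst_continuous.
move=> j; split; first exact: pderiv_cst0.
by move=> x; case: (is_derive_constant (0 : R) x (base_vec j : E)).
Qed.

Lemma test_function_real (phi : E -> R) : rtest phi -> test_function (fun x => (phi x)%:C).
Proof.
move=> [sp cp]; split; [exact: sp|exact: smooth_cst0|].
rewrite (_ : [set x | _] = [set x | phi x != 0])//.
by apply/seteqP; split=> x /=; rewrite eq_complex/= eqxx andbT.
Qed.

Lemma cpderiv_real (phi : E -> R) j : cpderiv j (fun x => (phi x)%:C) = fun x => (pderiv j phi x)%:C.
Proof. by apply/funext => x; rewrite /cpderiv /= pderiv_cst0. Qed.

Lemma compact_subset_closure (A B : set E) : A `<=` B -> compact (closure B) -> compact (closure A).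
Proof.
move=> AB cB; apply: subclosed_compact cB (closure_subset AB) => //; exact: closed_closure.
Qed.

Lemma test_function_parts (phi : E -> R[i]) : test_function phi ->
  rtest (fun x => complex.Re (phi x)) /\ rtest (fun x => complex.Im (phi x)).
Proof.
move=> [sr si cp]; split; split=> //; apply: compact_subset_closure cp => x /=; apply: contra => /eqP ->//.
Qed.

(** Real test functions are complex ones, which separates the parts; conversely a complex test
    function splits the pairing into four real ones. *)
Lemma is_wpdP j f h : is_wpd j f h <->
  rwpd j (fun x => complex.Re (f x)) (fun x => complex.Re (h x)) /\
  rwpd j (fun x => complex.Im (f x)) (fun x => complex.Im (h x)).
Proof.
split=> [[/loc_integrableP[lr li] /loc_integrableP[hr hi] H]|[[lr hr Hr] [li hi Hi]]].
  have T phi (tp : rtest phi) := H _ (test_function_real tp).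
  have eR g (k : E -> R) : \int[mu]_x complex.Re (g x * (k x)%:C) = \int[mu]_x (complex.Re (g x) * k x).
    by apply: eq_Rint => x; rewrite cReM cReC cImC mulr0 subr0.
  have eI g (k : E -> R) : \int[mu]_x complex.Im (g x * (k x)%:C) = \int[mu]_x (complex.Im (g x) * k x).
    by apply: eq_Rint => x; rewrite cImM cReC cImC mulr0 add0r.
  split; split=> // phi /T; rewrite cpderiv_real => e.
    by have := f_equal (@complex.Re R) e; rewrite cReN !Re_cint !eR.
  by have := f_equal (@complex.Im R) e; rewrite cImN !Im_cint !eI.
split; [exact/loc_integrableP|exact/loc_integrableP|] => phi /test_function_parts[tr ti].
have dr := rtest_pderiv j tr; have di := rtest_pderiv j ti.
have b := fun k => @bsupp_rtest R n k.
have i1 := rlocM lr (b _ dr); have i2 := rlocM li (b _ di).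
have i3 := rlocM lr (b _ di); have i4 := rlocM li (b _ dr).
have k1 := rlocM hr (b _ tr); have k2 := rlocM hi (b _ ti).
have k3 := rlocM hr (b _ ti); have k4 := rlocM hi (b _ tr).
apply: complex_parts_eq; rewrite ?cReN ?cImN ?Re_cint ?Im_cint.
  under eq_Rint do rewrite cReM; under [in RHS]eq_Rint do rewrite cReM.
  by rewrite (RintB i1 i2) (RintB k1 k2) (Hr _ tr) (Hi _ ti) opprB opprK addrC.
under eq_Rint do rewrite cImM; under [in RHS]eq_Rint do rewrite cImM.
by rewrite (RintD i3 i4) (RintD k3 k4) (Hr _ ti) (Hi _ tr) opprD.
Qed.

Lemma rwpd_unique (f h h' : E -> R) j : rwpd j f h -> rwpd j f h' -> {ae mu, forall x, h x = h' x}.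
Proof.
move=> [_ lh fh] [_ lh' fh'].
have : {ae mu, forall x, h x + -1 * h' x = 0}.
  apply: du_Bois_Reymond; first by apply: rlocD => //; exact: rlocZ.
  move=> psi tpsi; have tp := rtest_tens tpsi; have b := bsupp_rtest tp.
  have i1 := rlocM lh b; have i2 := rlocM lh' b.
  transitivity (\int[mu]_x (h x * tens psi x - h' x * tens psi x)).
    by apply: eq_Rint => x; ring.
  by rewrite (RintB i1 i2); have := etrans (esym (fh _ tp)) (fh' _ tp) => /oppr_inj ->; rewrite subrr.
by apply: filterS => x; rewrite mulN1r => /eqP; rewrite subr_eq0 => /eqP.
Qed.

Lemma rloc_ae (f g : E -> R) : measurable_fun setT g -> {ae mu, forall x, f x = g x} -> rloc f -> rloc g.
Proof.
move=> mg fg [mf lf]; split=> // M; apply: igr_ae (lf M).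
  by apply: measurable_funM => //; apply: measurable_indic; exact: measurable_box.
by apply: filterS fg => x ->.
Qed.

Lemma rwpd_ae (f f' h h' : E -> R) j : measurable_fun setT f' -> measurable_fun setT h' ->
  {ae mu, forall x, f x = f' x} -> {ae mu, forall x, h x = h' x} -> rwpd j f h -> rwpd j f' h'.
Proof.
move=> mf' mh' ff' hh' [lf lh H]; split; [exact: rloc_ae lf|exact: rloc_ae lh|] => phi tp.
have mp : measurable_fun setT phi by case: (bsupp_rtest tp).
have mdp : measurable_fun setT (pderiv j phi) by case: (bsupp_rtest (rtest_pderiv j tp)).
have [mf _] := lf; have [mh _] := lh.
have e1 : \int[mu]_x (f x * pderiv j phi x) = \int[mu]_x (f' x * pderiv j phi x).
  by apply: Rint_ae; [exact: measurable_funM|exact: measurable_funM|apply: filterS ff' => x ->].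
have e2 : \int[mu]_x (h x * phi x) = \int[mu]_x (h' x * phi x).
  by apply: Rint_ae; [exact: measurable_funM|exact: measurable_funM|apply: filterS hh' => x ->].
by rewrite -e1 -e2 H.
Qed.

Lemma rwpd_linear (f f' h h' : E -> R) (a : R) j : rwpd j f h -> rwpd j f' h' ->
  rwpd j (fun x => a * f x + f' x) (fun x => a * h x + h' x).
Proof.
move=> [lf lh H] [lf' lh' H']; split; [by apply: rlocD => //; exact: rlocZ|by apply: rlocD => //; exact: rlocZ|].
move=> phi tp; have b := bsupp_rtest tp; have db := bsupp_rtest (rtest_pderiv j tp).
have i1 := rlocM lf db; have i2 := rlocM lf' db; have k1 := rlocM lh b; have k2 := rlocM lh' b.
transitivity (\int[mu]_x (a * (f x * pderiv j phi x) + f' x * pderiv j phi x)).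
  by apply: eq_Rint => x; ring.
rewrite (RintD (igrZ a i1) i2) (RintZ a i1) H// H'// mulrN -opprD; congr (- _).
by rewrite -(RintZ a k1) -(RintD (igrZ a k1) k2); apply: eq_Rint => x; ring.
Qed.

Lemma is_wpd_linear a f f' h h' j : is_wpd j f h -> is_wpd j f' h' ->
  is_wpd j (fun x => a * f x + f' x) (fun x => a * h x + h' x).
Proof.
move=> /is_wpdP[fr fi] /is_wpdP[fr' fi']; apply/is_wpdP; split.
  have := rwpd_linear (complex.Re a) fr (rwpd_linear (- complex.Im a) fi fr').
  by congr (rwpd j _ _); apply/funext => x; rewrite !partsE; ring.
have := rwpd_linear (complex.Re a) fi (rwpd_linear (complex.Im a) fr fi').
by congr (rwpd j _ _); apply/funext => x; rewrite !partsE; ring.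
Qed.

Lemma is_wpd_unique f h h' j : is_wpd j f h -> is_wpd j f h' -> {ae mu, forall x, h x = h' x}.
Proof.
move=> /is_wpdP[fr fi] /is_wpdP[fr' fi'].
apply: filterS2 (rwpd_unique fr fr') (rwpd_unique fi fi') => x; exact: complex_parts_eq.
Qed.

Lemma is_wpd_ae f f' h h' j : cmeasurable f' -> cmeasurable h' -> {ae mu, forall x, f x = f' x} ->
  {ae mu, forall x, h x = h' x} -> is_wpd j f h -> is_wpd j f' h'.
Proof.
move=> [mr mi] [hr hi] ff' hh' /is_wpdP[wr wi]; apply/is_wpdP; split.
  by apply: rwpd_ae wr => //; [apply: filterS ff'|apply: filterS hh'] => x ->.
by apply: rwpd_ae wi => //; [apply: filterS ff'|apply: filterS hh'] => x ->.
Qed.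

Lemma is_wpd_measurable f h j : is_wpd j f h -> cmeasurable f /\ cmeasurable h.
Proof. by move=> [[mf _] [mh _] _]. Qed.

Lemma wpdP f h j : is_wpd j f h -> is_wpd j f (wpd j f).
Proof. by move=> w; rewrite /wpd; apply: xgetPex; exists h. Qed.

(** Functions equal almost everywhere have the same set of weak derivatives, so [xget] selects the
    same element: the conclusion is an equality of functions. *)
Lemma wpd_ae_eq f f' j : cmeasurable f -> cmeasurable f' -> {ae mu, forall x, f x = f' x} -> wpd j f = wpd j f'.
Proof.
move=> mf mf' ff'; rewrite /wpd; congr (xget _ _); apply/seteqP; split=> h /= w.
  by have [_ mh] := is_wpd_measurable w; apply: is_wpd_ae mf' mh ff' _ w; exact: aeW.
have f'f : {ae mu, forall x, f' x = f x} by apply: filterS ff' => x ->.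
by have [_ mh] := is_wpd_measurable w; apply: is_wpd_ae mf mh f'f _ w; exact: aeW.
Qed.

(** The selected derivative inherits square integrability because any two weak derivatives agree
    almost everywhere. *)
Lemma grad_in_L2P f : grad_in_L2 f <-> forall j, is_wpd j f (wpd j f) /\ cL2 (wpd j f).
Proof.
split=> [gf j|H j]; last by exists (wpd j f); [case: (H j)|apply/in_L2P; case: (H j)].
have [h w /in_L2P [hr hi]] := gf j; have w' := wpdP w; split=> //.
have [_ [mr mi]] := is_wpd_measurable w'; have hw := is_wpd_unique w w'.
by split; [apply: L2_ae mr _ hr|apply: L2_ae mi _ hi]; apply: filterS hw => x ->.
Qed.

Lemma grad_in_L2_linear a f g : grad_in_L2 f -> grad_in_L2 g ->
  grad_in_L2 (fun x => a * f x + g x) /\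
  forall j, {ae mu, forall x, wpd j (fun x => a * f x + g x) x = a * wpd j f x + wpd j g x}.
Proof.
move=> /grad_in_L2P gf /grad_in_L2P gg.
have w j : is_wpd j (fun x => a * f x + g x) (fun x => a * wpd j f x + wpd j g x).
  by apply: is_wpd_linear; [case: (gf j)|case: (gg j)].
split=> j; last by apply: is_wpd_unique (w j); exact: wpdP (w j).
exists (fun x => a * wpd j f x + wpd j g x) => //; apply/in_L2P.
by apply: cL2D; [apply: cL2Z; case: (gf j)|case: (gg j)].
Qed.

Lemma grad_inner_linear_r a f g g' : grad_in_L2 f -> grad_in_L2 g -> grad_in_L2 g' ->
  grad_inner f (fun x => a * g x + g' x) = a^* * grad_inner f g + grad_inner f g'.
Proof.
move=> Lf Lg Lg'; have [Lag e] := grad_in_L2_linear a Lg Lg'.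
rewrite /grad_inner mulr_sumr -big_split/=; apply: eq_bigr => j _.
have [wf cf] := (grad_in_L2P f).1 Lf j; have [wg cg] := (grad_in_L2P g).1 Lg j.
have [wg' cg'] := (grad_in_L2P g').1 Lg' j; have [wa ca] := (grad_in_L2P _).1 Lag j.
rewrite -(inner_linear_r a (cigr_inner cf cg) (cigr_inner cf cg')).
apply: inner_ae; try exact: cL2_measurable; [|exact: aeW|exact: e].
by apply: cL2_measurable; apply: cL2D => //; exact: cL2Z.
Qed.

Lemma grad_innerJ f g : grad_in_L2 f -> grad_in_L2 g -> grad_inner g f = (grad_inner f g)^*.
Proof.
move=> Lf Lg; rewrite /grad_inner rmorph_sum; apply: eq_bigr => j _.
by apply: innerJ; apply: cigr_inner; [case: ((grad_in_L2P f).1 Lf j)|case: ((grad_in_L2P g).1 Lg j)].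
Qed.

Lemma grad_norm_ge j f : Lp_norm 2 (wpd j f) <= grad_norm f.
Proof.
rewrite -[leLHS](ger0_norm (Lp_norm_ge0 _ _)) -sqrtr_sqr; apply: ler_wsqrtr.
by rewrite (bigD1 j)//= lerDl sumr_ge0// => k _; exact: sqr_ge0.
Qed.

(** Shaped for continuity in g: the first factor is a constant depending on f alone. *)
Lemma normc_grad_inner f g : grad_in_L2 f -> grad_in_L2 g ->
  normc (grad_inner f g) <= (\sum_j 2 * Lp_norm 2 (wpd j f)) * grad_norm g.
Proof.
move=> Lf Lg; rewrite /grad_inner mulr_suml.
elim: (index_enum 'I_n) => [|j s IH].
  by rewrite !big_nil ComplexField.Normc.normc0.
rewrite !big_cons; apply: (le_trans (normc_triangle _ _)); apply: lerD => //.
have [_ cf] := (grad_in_L2P f).1 Lf j; have [_ cg] := (grad_in_L2P g).1 Lg j.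
apply: (le_trans (normc_inner_L2 cf cg)); apply: ler_wpM2l; last exact: grad_norm_ge.
by rewrite mulr_ge0// Lp_norm_ge0.
Qed.

End complex_weak_derivatives.

Section Lp_classes.
Context {R : realType} {n : nat}.
Local Notation E := 'rV[R]_n.
Local Notation mu := (volume n).
Local Notation normc := ComplexField.Normc.normc.
Implicit Types (f g h : E -> R[i]) (j : 'I_n).

Lemma powR_add_le (a b q : R) : 0 <= a -> 0 <= b -> 0 <= q -> (a + b) `^ q <= 2 `^ q * (a `^ q + b `^ q).
Proof.
move=> a0 b0 q0; wlog ab : a b a0 b0 / a <= b.
  by move=> H; have [ab|/ltW ba] := leP a b; [exact: H|rewrite addrC [a `^ q + _]addrC; exact: H].
apply: (@le_trans _ _ ((2 * b) `^ q)).
  by apply: ge0_ler_powR; rewrite ?nnegrE ?addr_ge0 ?mulr_ge0//; lra.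
by rewrite powRM//; apply: ler_wpM2l; [exact: powR_ge0|rewrite lerDr powR_ge0].
Qed.

Lemma in_Lp_linear (q : R) a f g : 0 < q -> in_Lp q f -> in_Lp q g -> in_Lp q (fun x => a * f x + g x).
Proof.
move=> q0 /(in_LpP _ q0)[mf fi] /(in_LpP _ q0)[mg gi]; apply/(in_LpP _ q0).
have m : cmeasurable (fun x => a * f x + g x) by apply: cmeasurableD => //; exact: cmeasurableZ.
split=> //; apply: (le_igr _ _ (igrZ (2 `^ q) (igrD (igrZ (normc a `^ q) fi) gi))).
  by apply: (measurableT_comp (measurable_powR _)); exact: measurable_normc.
move=> x; rewrite (ger0_norm (powR_ge0 _ _)) -powRM ?normc_ge0// -normc_mul.
apply: le_trans (powR_add_le (normc_ge0 _) (normc_ge0 _) (ltW q0)).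
by apply: ge0_ler_powR; rewrite ?nnegrE ?addr_ge0 ?normc_ge0 ?(ltW q0)//; exact: normc_triangle.
Qed.

Lemma in_Lp_ae (q : R) f g : 0 < q -> cmeasurable g -> {ae mu, forall x, f x = g x} -> in_Lp q f -> in_Lp q g.
Proof.
move=> q0 mg fg /(in_LpP _ q0)[mf fi]; apply/(in_LpP _ q0); split => //; apply: igr_ae fi.
  by apply: (measurableT_comp (measurable_powR _)); exact: measurable_normc.
by apply: filterS fg => x ->.
Qed.

Lemma cL2_ae f g : cmeasurable g -> {ae mu, forall x, f x = g x} -> cL2 f -> cL2 g.
Proof.
move=> [mr mi] fg [fr fi]; split; [apply: L2_ae mr _ fr|apply: L2_ae mi _ fi]; by apply: filterS fg => x ->.
Qed.

Lemma complex_IBP f f' g g' j : cL2 f -> cL2 f' -> cL2 g -> cL2 g' -> is_wpd j f f' -> is_wpd j g g' ->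
  inner f' g = - inner f g'.
Proof.
move=> [fr fi] [fr' fi'] [gr gi] [gr' gi'] /is_wpdP[wr wi] /is_wpdP[vr vi].
apply: complex_parts_eq; rewrite ?cReN ?cImN /inner ?Re_cint ?Im_cint.
  have e (h k : E -> R[i]) : (fun x => complex.Re (h x * (k x)^*)) =
      fun x => complex.Re (h x) * complex.Re (k x) + complex.Im (h x) * complex.Im (k x).
    by apply/funext => x; rewrite !partsE; ring.
  rewrite !e (RintD (L2M fr' gr) (L2M fi' gi)) (RintD (L2M fr gr') (L2M fi gi')) opprD.
  by rewrite (rwpd_IBP fr gr wr fr' vr gr') (rwpd_IBP fi gi wi fi' vi gi').
have e (h k : E -> R[i]) : (fun x => complex.Im (h x * (k x)^*)) =
    fun x => complex.Im (h x) * complex.Re (k x) - complex.Re (h x) * complex.Im (k x).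
  by apply/funext => x; rewrite !partsE; ring.
rewrite !e (RintB (L2M fi' gr) (L2M fr' gi)) (RintB (L2M fi gr') (L2M fr gi')) opprB.
by rewrite (rwpd_IBP fi gr wi fi' vr gr') (rwpd_IBP fr gi wr fr' vi gi') opprK addrC.
Qed.

End Lp_classes.

Section sobolev_complex.
Context {R : realType}.
Local Notation normc := ComplexField.Normc.normc.

(** It is enough to have one integer moment of order at least p + 1: an arbitrary one for N = 2, the
    third for N = 3, where p + 1 < 3. *)
Lemma H1_in_Lp (N : nat) (p : R) (f : 'rV[R]_N -> R[i]) : N = 2%N \/ N = 3%N -> 1 < p -> (N = 3%N -> p < 2) ->
  in_H1 f -> in_Lp (p + 1) f.
Proof.
move=> hN p1 p3 [/in_L2P Lf /grad_in_L2P gf]; have q0 : 0 < p + 1 by lra.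
have q2 : 2 <= p + 1 by lra.
have H (u : 'rV[R]_N -> R) (h : 'I_N -> 'rV[R]_N -> R) : L2 (volume N) u -> (forall j, rwpd j u (h j)) ->
    (forall j, L2 (volume N) (h j)) -> igr (volume N) (fun x => `|u x| `^ (p + 1)).
  case: hN p3 f Lf gf u h => -> p3 f Lf gf u h Lu wu Lh.
    have [m _ /(_ m (leqnn m)) /= Hm] := nbhs_infty_ger (p + 1).
    apply: (@igr_powR_interpolation _ _ _ _ _ m.+2) => //; last exact: sobolev_moment2 Lu wu Lh.
    by apply: (le_trans Hm); rewrite ler_nat (leq_trans (leqnSn _) (leqnSn _)).
  apply: (@igr_powR_interpolation _ _ _ _ _ 3) => //; last exact: sobolev_moment3 Lu wu Lh.
  by have := p3 erefl; lra.
have [fr fi] := Lf.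
have ir := H _ (fun j x => complex.Re (wpd j f x)) fr
  (fun j => ((is_wpdP _ _ _).1 (gf j).1).1) (fun j => (gf j).2.1).
have ii := H _ (fun j x => complex.Im (wpd j f x)) fi
  (fun j => ((is_wpdP _ _ _).1 (gf j).1).2) (fun j => (gf j).2.2).
have mf := cL2_measurable Lf.
apply/(in_LpP _ q0); split=> //; apply: (le_igr _ _ (igrZ (2 `^ (p + 1)) (igrD ir ii))).
  by apply: (measurableT_comp (measurable_powR _)); exact: measurable_normc.
move=> x; rewrite (ger0_norm (powR_ge0 _ _)).
apply: le_trans (powR_add_le (normr_ge0 _) (normr_ge0 _) (ltW q0)).
by apply: ge0_ler_powR; [exact: ltW|rewrite nnegrE normc_ge0|rewrite nnegrE addr_ge0|exact: normc_le].
Qed.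

End sobolev_complex.

(** * Properties of the Green function *)

Section green_function.
Context {R : realType} {N : nat}.
Local Notation E := 'rV[R]_N.
Local Notation mu := (volume N).
Local Notation normc := ComplexField.Normc.normc.

(** The constraints amount to 1/2 - 1/N < th < 1/(2(p+1)); the upper bound is below 1/4 since p > 1.
    For N = 2 half of it is taken; for N = 3 the midpoint between it and 1/6, which is below it
    because p < 2. *)
Lemma green_exponent (p : R) : N = 2%N \/ N = 3%N -> 1 < p -> (N = 3%N -> p < 2) ->
  exists th : R, [/\ 0 < th, 4 * th < 1, N%:R * (2^-1 - th) < 1 & 2 * th * (p + 1) < 1].
Proof.
move=> hN p1 p3; have p0 : 0 < p + 1 by lra.
pose q : R := (2 * (p + 1))^-1.
have q1 : q * (p + 1) = 2^-1 by rewrite /q; field; rewrite gt_eqF.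
have q0 : 0 < q by rewrite invr_gt0 mulr_gt0.
have q4 : q < 4^-1 by rewrite ltf_pV2 ?posrE ?mulr_gt0//; lra.
case: hN => hN.
  exists (q / 2); rewrite hN; split; [by rewrite divr_gt0|lra|lra|].
  by rewrite (_ : _ * _ = q * (p + 1)); [rewrite q1; lra|field].
have q6 : 6^-1 < q by rewrite ltf_pV2 ?posrE ?mulr_gt0//; have := p3 hN; lra.
exists ((6^-1 + q) / 2); rewrite hN; split; [by rewrite divr_gt0// addr_gt0|lra|lra|].
have : 6^-1 * (p + 1) < q * (p + 1) by rewrite ltr_pM2r.
rewrite (_ : 2 * _ * _ = 6^-1 * (p + 1) + q * (p + 1)); last by field.
by rewrite q1; lra.
Qed.

Lemma cpderiv2_real (phi : E -> R) j : cpderiv j (cpderiv j (fun x => (phi x)%:C)) = fun x => (pderiv j (pderiv j phi) x)%:C.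
Proof. by rewrite cpderiv_real cpderiv_real. Qed.

Lemma green_pairing (lam : R) (G : E -> R[i]) (phi : E -> R) : is_green lam G -> rtest phi ->
  \int[mu]_x (complex.Re (G x) * (lam * phi x - \sum_j pderiv j (pderiv j phi) x)) = phi 0 /\
  \int[mu]_x (complex.Im (G x) * (lam * phi x - \sum_j pderiv j (pderiv j phi) x)) = 0.
Proof.
move=> [_ H] tp; have := H _ (test_function_real tp).
have -> : (fun x => G x * (lam%:C * (phi x)%:C - \sum_j cpderiv j (cpderiv j (fun x => (phi x)%:C)) x)) =
    fun x => G x * (lam * phi x - \sum_j pderiv j (pderiv j phi) x)%:C.
  apply/funext => x; congr (_ * _); rewrite rmorphB rmorphM rmorph_sum; congr (_ - _).
  by apply: eq_bigr => j _; rewrite cpderiv2_real.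
have eR g (k : E -> R) : \int[mu]_x complex.Re (g x * (k x)%:C) = \int[mu]_x (complex.Re (g x) * k x).
  by apply: eq_Rint => x; rewrite cReM cReC cImC mulr0 subr0.
have eI g (k : E -> R) : \int[mu]_x complex.Im (g x * (k x)%:C) = \int[mu]_x (complex.Im (g x) * k x).
  by apply: eq_Rint => x; rewrite cImM cReC cImC mulr0 add0r.
move=> e; split.
  by have := f_equal (@complex.Re R) e; rewrite !Re_cint eR cReC.
by have := f_equal (@complex.Im R) e; rewrite !Im_cint eI cImC.
Qed.

(** What the form asks of G: the two exponents make the pairings with X_0 continuous, the failure of
    [grad_in_L2] makes decompositions unique, and the reality of G with the evaluation formula
    serves the comparison with the operator. *)
Lemma green_facts (lam p : R) (G : E -> R[i]) : N = 2%N \/ N = 3%N -> 1 < p -> (N = 3%N -> p < 2) -> 0 < lam ->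
  is_green lam G ->
  [/\ cL2 G, in_Lp (p + 1) G /\ in_Lp ((p + 1) / p) G, ~ grad_in_L2 G, {ae mu, forall x, complex.Im (G x) = 0}
    & forall (f : E -> R) (f1 f2 : 'I_N -> E -> R), L2 mu f ->
      (forall j, L2 mu (f1 j)) -> (forall j, L2 mu (f2 j)) ->
      (forall j, rwpd j f (f1 j)) -> (forall j, rwpd j (f1 j) (f2 j)) -> continuous f ->
      \int[mu]_x (helm lam f f2 x * complex.Re (G x)) = f 0].
Proof.
move=> hN p1 p3 lam0 gG; have [th [th0 th4 thN thp]] := green_exponent hN p1 p3.
have N1 : (1 < N)%N by case: hN => ->.
have [g [Lg Mg Hg]] := @green_kernel_exists R N lam th (ltnW N1) lam0 th0 th4 thN.
have LG : cL2 G by apply/in_L2P; case: gG.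
have [LGr LGi] := LG; have mG := cL2_measurable LG; have [mr mi] := mG; have [mg _] := Lg.
have test_green phi : rtest phi ->
    \int[mu]_x (g x * (lam * phi x - \sum_j pderiv j (pderiv j phi) x)) = phi 0.
  move=> tp; rewrite -(Hg phi (fun j => pderiv j phi) (fun j => pderiv j (pderiv j phi))).
  - by apply: eq_Rint => x; rewrite mulrC.
  - exact: bsupp_L2 (bsupp_rtest tp).
  - by move=> j; exact: bsupp_L2 (bsupp_rtest (rtest_pderiv j tp)).
  - by move=> j; exact: bsupp_L2 (bsupp_rtest (rtest_pderiv j (rtest_pderiv j tp))).
  - by move=> j; apply: smooth_rwpd; case: tp.
  - by move=> j; apply: smooth_rwpd; case: (rtest_pderiv j tp).
  - by apply: smooth_continuous; case: tp.
have Lop phi : rtest phi -> L2 mu (fun x => lam * phi x - \sum_j pderiv j (pderiv j phi) x).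
  move=> tp; apply: L2B; first by apply: L2Z; exact: bsupp_L2 (bsupp_rtest tp).
  by apply: L2_sum => j; exact: bsupp_L2 (bsupp_rtest (rtest_pderiv j (rtest_pderiv j tp))).
have Gr : {ae mu, forall x, complex.Re (G x) = g x}.
  have := @helmholtz_unique R N lam _ lam0 (L2B LGr Lg).
  move=> H; have {}H : {ae mu, forall x, complex.Re (G x) - g x = 0}.
    apply: H => phi tp; have [e _] := green_pairing gG tp.
    under eq_Rint do rewrite mulrBl.
    by rewrite (RintB (L2M LGr (Lop _ tp)) (L2M Lg (Lop _ tp))) e test_green// subrr.
  by apply: filterS H => x /eqP; rewrite subr_eq0 => /eqP.
have Gi : {ae mu, forall x, complex.Im (G x) = 0}.
  by apply: (helmholtz_unique lam0 LGi) => phi tp; case: (green_pairing gG tp).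
have q0 : 0 < p + 1 by lra.
have p0 : 0 < p by lra.
have inL s : 1 <= s -> 2 * th * s < 1 -> in_Lp s G.
  move=> s1 ths; apply/in_LpP; first exact: lt_le_trans s1.
  split=> //; apply: igr_ae (Mg s s1 ths).
    by apply: (measurableT_comp (measurable_powR _)); exact: measurable_normc.
  apply: filterS2 Gr Gi => x <-; case: (G x) => a b /= ->.
  by rewrite expr0n addr0 sqrtr_sqr.
split=> //.
- split; apply: inL => //; first lra.
    by rewrite ler_pdivlMr// mul1r; lra.
  apply: le_lt_trans thp; apply: ler_wpM2l; first by rewrite mulr_ge0// ltW.
  by rewrite ler_pdivrMr// ler_peMr// ltW.
- move=> /grad_in_L2P gr.
  apply: (@fundamental_not_H1 R N lam (fun x => complex.Re (G x)) (fun j x => complex.Re (wpd j G x))) => //.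
  + by move=> phi tp; case: (green_pairing gG tp).
  + by move=> j; case: (gr j) => /is_wpdP[].
  + by move=> j; case: (gr j) => _ [].
- move=> f f1 f2 Lf Lf1 Lf2 w1 w2 cf; rewrite -[RHS](Hg f f1 f2)//; last exact: cf.
  have [mh _] := L2_helm lam Lf Lf2.
  apply: Rint_ae; [exact: measurable_funM|exact: measurable_funM|].
  by apply: filterS Gr => x ->.
Qed.

End green_function.

(** * The extended form *)

Section complex_conjugation.
Context {R : realType}.
Implicit Types x y : R[i].
Local Notation conj := (@Num.conj R[i]).

Lemma cconjD x y : conj (x + y) = conj x + conj y.
Proof. by apply: complex_parts_eq; rewrite !partsE// opprD. Qed.

Lemma cconjB x y : conj (x - y) = conj x - conj y.
Proof. by apply: complex_parts_eq; rewrite !partsE// opprD. Qed.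

Lemma cconjM x y : conj (x * y) = conj x * conj y.
Proof. by apply: complex_parts_eq; rewrite !partsE; ring. Qed.

Lemma cconjK x : conj (conj x) = x.
Proof. by apply: complex_parts_eq; rewrite !partsE// opprK. Qed.

Lemma cconjC (a : R) : conj a%:C = a%:C.
Proof. by apply: complex_parts_eq; rewrite !partsE// oppr0. Qed.

Lemma conj_form (A B D k l x y : R[i]) : conj k = k -> conj l = l ->
  conj A + k * y * conj x - l * conj x * D - l * y * conj B
  = conj (A + k * x * conj y - l * conj y * B - l * x * conj D).
Proof.
move=> kE lE; rewrite !cconjB cconjD !cconjM kE lE !cconjK.
set a := conj A; set b := conj B; set x' := conj x.
by move: a b x' => a b x'; ring.
Qed.

End complex_conjugation.

(** * The sesquilinear form on X_0 *)

Section point_interaction_form.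
Context {R : realType} {N : nat}.
Local Notation C := R[i].
Local Notation E := 'rV[R]_N.
Local Notation mu := (volume N).
Local Notation normc := ComplexField.Normc.normc.
Variables (p lam k0 : R) (G : E -> C).
Hypotheses (p1 : 1 < p) (LG : cL2 G) (Gp : in_Lp (p + 1) G) (Gq : in_Lp ((p + 1) / p) G) (nG : ~ grad_in_L2 G).
Local Notation S := (in_Lp_dotH1 (p + 1)).
Implicit Types (u v w f g : E -> C) (c d a : C).

Let p0 : 0 < p. Proof. exact: lt_trans ltr01 p1. Qed.

Let q0 : 0 < p + 1. Proof. exact: addr_gt0. Qed.

Definition ext_form u f c v g d : C := grad_inner f g + k0%:C * c * d^*
  - lam%:C * d^* * inner u G - lam%:C * c * (inner v G)^*.

Lemma grad_in_L2Z a f : grad_in_L2 f -> grad_in_L2 (fun x => a * f x).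
Proof.
move=> gf; have [H _] := grad_in_L2_linear (a - 1) gf gf.
by move: H; congr grad_in_L2; apply/funext => x; ring.
Qed.

Lemma grad_in_L2_ae f g : cmeasurable g -> {ae mu, forall x, f x = g x} -> grad_in_L2 f -> grad_in_L2 g.
Proof.
move=> mg fg gf j; have [h w Lh] := gf j; exists h => //.
have [_ mh] := is_wpd_measurable w; apply: is_wpd_ae mg mh fg _ w; exact: aeW.
Qed.

(** If c and c' differed, G would be (f' - f) / (c - c') almost everywhere, and its gradient would
    be in L^2. *)
Lemma decomp_unique u f c f' c' : decomp S G u f c -> decomp S G u f' c' ->
  c = c' /\ {ae mu, forall x, f x = f' x}.
Proof.
move=> [[_ gf] _ uf] [[_ gf'] _ uf'].
have cc : c = c'.
  apply/eqP; apply: contra_notT nG => cc.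
  have [gd _] := grad_in_L2_linear (-1) gf gf'.
  apply: grad_in_L2_ae (grad_in_L2Z (c - c')^-1 gd); first exact: cL2_measurable.
  apply: filterS2 uf uf' => x -> /eqP; rewrite -subr_eq => /eqP <-.
  by field; rewrite subr_eq0.
split=> //; apply: filterS2 uf uf' => x -> ; rewrite cc; exact: addIr.
Qed.

Lemma S_measurable f : S f -> cmeasurable f.
Proof. by case=> -[]. Qed.

Lemma ext_form_unique u f c f' c' v g d g' d' : decomp S G u f c -> decomp S G u f' c' ->
  decomp S G v g d -> decomp S G v g' d' -> ext_form u f c v g d = ext_form u f' c' v g' d'.
Proof.
move=> uf uf' vg vg'; have [-> ff'] := decomp_unique uf uf'; have [-> gg'] := decomp_unique vg vg'.
have [Sf _ _] := uf; have [Sf' _ _] := uf'; have [Sg _ _] := vg; have [Sg' _ _] := vg'.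
suff e : grad_inner f g = grad_inner f' g' by rewrite /ext_form e.
apply: eq_bigr => j _.
by rewrite (wpd_ae_eq j (S_measurable Sf) (S_measurable Sf') ff') (wpd_ae_eq j (S_measurable Sg) (S_measurable Sg') gg').
Qed.

(* Independent of the decompositions chosen, by [ext_form_unique]. *)
Definition ext_op u v : C := xget 0 [set z | exists f c g d,
  [/\ decomp S G u f c, decomp S G v g d & z = ext_form u f c v g d]].

Lemma ext_opE u f c v g d : decomp S G u f c -> decomp S G v g d -> ext_op u v = ext_form u f c v g d.
Proof.
move=> uf vg; rewrite /ext_op.
set P := [set z | _]; have : P (ext_form u f c v g d) by exists f, c, g, d.
move=> Pz; have [f' [c' [g' [d' [uf' vg' ->]]]]] := xgetPex (0 : C) (ex_intro P _ Pz).
exact: ext_form_unique.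
Qed.

Lemma S_linear a f g : S f -> S g -> S (fun x => a * f x + g x).
Proof.
move=> [Lf gf] [Lg gg]; split; first exact: in_Lp_linear.
by case: (grad_in_L2_linear a gf gg).
Qed.

Lemma decomp_linear a u f c v g d : decomp S G u f c -> decomp S G v g d ->
  decomp S G (fun x => a * u x + v x) (fun x => a * f x + g x) (a * c + d).
Proof.
move=> [Sf mu_ uf] [Sg mv vg]; split; [exact: S_linear|by apply: cmeasurableD => //; exact: cmeasurableZ|].
by apply: filterS2 uf vg => x -> ->; ring.
Qed.

Lemma decomp_in_Lp u f c : decomp S G u f c -> in_Lp (p + 1) u.
Proof.
move=> [[Lf _] mu_ uf]; have := in_Lp_linear c q0 Gp Lf; apply: in_Lp_ae => //.
by apply: filterS uf => x ->; rewrite addrC.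
Qed.

Let conj_exponent : (p + 1)^-1 + ((p + 1) / p)^-1 = 1.
Proof. by field; rewrite !gt_eqF. Qed.

Let r0 : 0 < (p + 1) / p.
Proof. exact: divr_gt0. Qed.

Lemma cigr_pairing u : in_Lp (p + 1) u -> cigr (fun x => u x * (G x)^*).
Proof.
move=> Lu; have [i _] := igr_hoelder q0 r0 conj_exponent Lu Gq.
by apply: cigr_inner_norm => //; [case: Lu|case: Gq].
Qed.

Lemma normc_pairing u : in_Lp (p + 1) u -> normc (inner u G) <= 2 * Lp_norm ((p + 1) / p) G * Lp_norm (p + 1) u.
Proof.
move=> Lu; have [i H] := igr_hoelder q0 r0 conj_exponent Lu Gq.
have [mu_ _] := Lu; have [mG _] := Gq.
apply: (le_trans (normc_inner mu_ mG i)); rewrite -mulrA ler_pM2l//.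
by rewrite [Lp_norm _ G * _]mulrC.
Qed.

Lemma ext_op_linear_r a u v w : in_X0 p G u -> in_X0 p G v -> in_X0 p G w ->
  ext_op u (fun x => a * v x + w x) = a^* * ext_op u v + ext_op u w.
Proof.
move=> [f [c uf]] [g [d vg]] [h [e wh]].
rewrite (ext_opE uf (decomp_linear a vg wh)) (ext_opE uf vg) (ext_opE uf wh) /ext_form.
have [[_ gf] _ _] := uf; have [[_ gg] _ _] := vg; have [[_ gh] _ _] := wh.
rewrite (grad_inner_linear_r a gf gg gh).
rewrite (inner_linear_l a (cigr_pairing (decomp_in_Lp vg)) (cigr_pairing (decomp_in_Lp wh))).
rewrite !cconjD !cconjM.
generalize (grad_inner f g) (grad_inner f h) (inner u G) (inner v G)^* (inner w G)^* (k0%:C : C) (lam%:C : C) (a^*) (d^*) (e^*).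
by move=> *; ring.
Qed.

(** Hermitian symmetry reduces linearity in the first argument to conjugate-linearity in the
    second. *)
Lemma ext_opJ u v : in_X0 p G u -> in_X0 p G v -> ext_op v u = Num.conj (ext_op u v : C).
Proof.
move=> [f [c uf]] [g [d vg]]; rewrite (ext_opE uf vg) (ext_opE vg uf) /ext_form.
have [[_ gf] _ _] := uf; have [[_ gg] _ _] := vg.
rewrite (grad_innerJ gf gg).
by apply: conj_form; exact: cconjC.
Qed.

Lemma in_X0_linear a u v : in_X0 p G u -> in_X0 p G v -> in_X0 p G (fun x => a * u x + v x).
Proof.
move=> [f [c uf]] [g [d vg]].
by exists (fun x => a * f x + g x), (a * c + d); exact: decomp_linear.
Qed.

Lemma ext_op_linear_l a u u' v : in_X0 p G u -> in_X0 p G u' -> in_X0 p G v ->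
  ext_op (fun x => a * u x + u' x) v = a * ext_op u v + ext_op u' v.
Proof.
move=> Xu Xu' Xv; rewrite (ext_opJ Xv (in_X0_linear a Xu Xu')) (ext_op_linear_r a Xv Xu Xu').
by rewrite (ext_opJ Xu Xv) (ext_opJ Xu' Xv) cconjD cconjM !cconjK.
Qed.

Lemma ext_op_dual u : in_X0 p G u -> in_X0_dual p G (ext_op u).
Proof.
move=> Xu; split; first by move=> a v w Xv Xw; exact: ext_op_linear_r.
have [f [c uf]] := Xu; have [[_ gf] _ _] := uf.
(* A, B and D are the constants in front of the gradient norm of g, the modulus of d and the L^(p+1)
   norm of v; their sum serves for all three at once. *)
pose A := \sum_j 2 * Lp_norm 2 (wpd j f).
pose B := normc (k0%:C * c) + normc (lam%:C * inner u G).
pose D := normc (lam%:C * c) * (2 * Lp_norm ((p + 1) / p) G).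
have A0 : 0 <= A by apply: sumr_ge0 => j _; rewrite mulr_ge0// Lp_norm_ge0.
have B0 : 0 <= B by rewrite addr_ge0// normc_ge0.
have D0 : 0 <= D by rewrite mulr_ge0 ?normc_ge0// mulr_ge0// Lp_norm_ge0.
exists (A + B + D) => v g d vg; rewrite (ext_opE uf vg) /X0_norm.
have [[_ gg] _ _] := vg; have Lv := decomp_in_Lp vg.
have h1 := normc_grad_inner gf gg; rewrite -/A in h1.
have h2 : normc (k0%:C * c * d^*) + normc (lam%:C * d^* * inner u G) = B * normc d.
  by rewrite mulrAC !normc_mul normc_conj /B !normc_mul; ring.
have h3 : normc (lam%:C * c * (inner v G)^*) <= D * Lp_norm (p + 1) v.
  rewrite normc_mul normc_conj /D -mulrA; apply: ler_wpM2l; first exact: normc_ge0.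
  exact: normc_pairing.
have n1 : 0 <= grad_norm g by exact: sqrtr_ge0.
have n2 := normc_ge0 d; have n3 := Lp_norm_ge0 (p + 1) v.
have t1 := normc_triangle (grad_inner f g + k0%:C * c * d^* - lam%:C * d^* * inner u G) (- (lam%:C * c * (inner v G)^*)).
have t2 := normc_triangle (grad_inner f g + k0%:C * c * d^*) (- (lam%:C * d^* * inner u G)).
have t3 := normc_triangle (grad_inner f g) (k0%:C * c * d^*).
rewrite !normc_opp in t1 t2; rewrite /ext_form.
have m1 := mulr_ge0 A0 n2; have m2 := mulr_ge0 A0 n3; have m3 := mulr_ge0 B0 n1.
have m4 := mulr_ge0 B0 n3; have m5 := mulr_ge0 D0 n1; have m6 := mulr_ge0 D0 n2.
by move: h1 h2 h3 t1 t2 t3; lra.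
Qed.

End point_interaction_form.

(** * Agreement with the form and the operator on the energy space *)

Section energy_space.
Context {R : realType} {N : nat}.
Local Notation C := R[i].
Local Notation E := 'rV[R]_N.
Local Notation mu := (volume N).
Local Notation conj := (@Num.conj C).
Implicit Types (f g h u v w : E -> C) (c d : C).

Lemma cL2_sum (s : seq 'I_N) (F : 'I_N -> E -> C) : (forall j, cL2 (F j)) -> cL2 (fun x => \sum_(j <- s) F j x).
Proof.
move=> LF; split.
  under eq_fun do rewrite (big_morph _ (@cReD R) (erefl : complex.Re (0 : C) = 0)).
  by apply: L2_sum => j; case: (LF j).
under eq_fun do rewrite (big_morph _ (@cImD R) (erefl : complex.Im (0 : C) = 0)).
by apply: L2_sum => j; case: (LF j).
Qed.

Lemma inner_sum_l (s : seq 'I_N) (F : 'I_N -> E -> C) g : (forall j, cL2 (F j)) -> cL2 g ->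
  inner (fun x => \sum_(j <- s) F j x) g = \sum_(j <- s) inner (F j) g.
Proof.
move=> LF Lg; elim: s => [|j s IH].
  rewrite big_nil; under (@eq_fun E C) do rewrite big_nil.
  have -> : (fun _ : E => (0 : C)) = (fun x => 0 * g x) by apply/funext => x; rewrite mul0r.
  (* The zero function is written as -g + g, so that linearity also covers the empty sum. *)
  have H := inner_linear_l (-1) (cigr_inner Lg Lg) (cigr_inner Lg Lg).
  have -> : (fun x => 0 * g x) = (fun x => -1 * g x + g x) by apply/funext => x; ring.
  by rewrite H; ring.
rewrite big_cons -IH.
have -> : (fun x => \sum_(j <- j :: s) F j x) = (fun x => 1 * F j x + \sum_(j <- s) F j x).
  by apply/funext => x; rewrite big_cons mul1r.
by rewrite (inner_linear_l 1 (cigr_inner (LF j) Lg) (cigr_inner (cL2_sum s LF) Lg)) mul1r.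
Qed.

Lemma H2_laplacian_IBP f g : in_H2 f -> in_H1 g -> cL2 (weak_laplacian f) /\
  inner (weak_laplacian f) g = - grad_inner f g.
Proof.
move=> [[_ /grad_in_L2P gf] f2] [/in_L2P Lg /grad_in_L2P gg].
have gf2 j : is_wpd j (wpd j f) (wpd j (wpd j f)) /\ cL2 (wpd j (wpd j f)).
  by have [_ /grad_in_L2P] := f2 j.
have LF j : cL2 (wpd j (wpd j f)) by case: (gf2 j).
split; first exact: cL2_sum.
rewrite /weak_laplacian inner_sum_l// /grad_inner -sumrN; apply: eq_bigr => j _.
by apply: (complex_IBP (j := j)); [case: (gf j)| |exact: Lg|case: (gg j)|case: (gf2 j)|case: (gg j)].
Qed.

Variable G : E -> C.
Hypothesis LG : cL2 G.

Lemma decomp_H1_cL2 u f c : decomp in_H1 G u f c -> [/\ cL2 f, cL2 u & {ae mu, forall x, u x = c * G x + f x}].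
Proof.
move=> [[/in_L2P Lf _] mu_ uf]; have e : {ae mu, forall x, u x = c * G x + f x}.
  by apply: filterS uf => x ->; rewrite addrC.
split=> //; apply: cL2_ae (cL2D (cL2Z c LG) Lf) => //.
by apply: filterS e => x ->.
Qed.

Lemma inner_decomp_l u f c w : decomp in_H1 G u f c -> cL2 w -> inner u w = c * inner G w + inner f w.
Proof.
move=> uf Lw; have [Lf Lu e] := decomp_H1_cL2 uf.
rewrite -(inner_linear_l c (cigr_inner LG Lw) (cigr_inner Lf Lw)).
apply: inner_ae; try (exact: cL2_measurable); last by apply: aeW.
- exact: cL2_measurable (cL2D (cL2Z c LG) Lf).
- exact: e.
Qed.

Lemma inner_decomp_r v g d w : decomp in_H1 G v g d -> cL2 w -> inner w v = conj d * inner w G + inner w g.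
Proof.
move=> vg Lw; have [Lg Lv e] := decomp_H1_cL2 vg.
rewrite -(inner_linear_r d (cigr_inner Lw LG) (cigr_inner Lw Lg)).
apply: inner_ae; try (exact: cL2_measurable); first exact: cL2_measurable (cL2D (cL2Z d LG) Lg).
- by apply: aeW.
- exact: e.
Qed.

(** The two pairings with G each contribute -lam ||G||^2 c conj(d), whereas -lam <u, v> contributes
    it once. The term lam ||G||^2 in the coefficient k makes up the difference. *)
Lemma form_algebra (gr GG Gg fG fg ab l k c d' vG : C) : k = ab + l * GG -> vG = d' * GG + Gg ->
  gr + k * c * d' - l * d' * (c * GG + fG) - l * c * vG =
  gr + l * fg + ab * c * d' - l * (c * (d' * GG + Gg) + (d' * fG + fg)).
Proof. by move=> -> ->; ring. Qed.

Lemma ext_form_H1 (al lam : R) u f c v g d : decomp in_H1 G u f c -> decomp in_H1 G v g d ->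
  ext_form lam (al + beta_pt N lam + lam * Lp_norm 2 G ^+ 2) G u f c v g d = form_alpha al lam u f c v g d.
Proof.
move=> uf vg; have [Lf Lu _] := decomp_H1_cL2 uf; have [Lg Lv _] := decomp_H1_cL2 vg.
rewrite /ext_form /form_alpha (inner_decomp_l uf Lv) (inner_decomp_r vg LG) (inner_decomp_r vg Lf).
rewrite (inner_decomp_l uf LG).
apply: form_algebra; first by rewrite inner_norm2// rmorphD rmorphM.
by rewrite -(inner_decomp_r vg LG) (innerJ (cigr_inner Lv LG)).
Qed.

Lemma inner_green (lam : R) f : {ae mu, forall x, complex.Im (G x) = 0} ->
  (forall (k : E -> R) (k1 k2 : 'I_N -> E -> R), L2 mu k ->
      (forall j, L2 mu (k1 j)) -> (forall j, L2 mu (k2 j)) ->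
      (forall j, rwpd j k (k1 j)) -> (forall j, rwpd j (k1 j) (k2 j)) -> continuous k ->
      \int[mu]_x (helm lam k k2 x * complex.Re (G x)) = k 0) ->
  in_H2 f -> continuous (fun x => complex.Re (f x)) -> continuous (fun x => complex.Im (f x)) ->
  inner (fun x => lam%:C * f x - weak_laplacian f x) G = f 0.
Proof.
move=> Gi HG Hf cr ci; have [[/in_L2P Lf /grad_in_L2P gf] f2] := Hf.
have gf2 j : is_wpd j (wpd j f) (wpd j (wpd j f)) /\ cL2 (wpd j (wpd j f)).
  by have [_ /grad_in_L2P] := f2 j.
have [lr li] := Lf; have [[mr _] [mi _]] := LG.
have Ll : cL2 (weak_laplacian f) by apply: cL2_sum => j; case: (gf2 j).
have Lh : cL2 (fun x => lam%:C * f x - weak_laplacian f x).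
  have := cL2D (cL2Z lam%:C Lf) (cL2Z (-1) Ll); congr cL2.
  by apply/funext => x; rewrite mulN1r.
have mh := cL2_measurable Lh.
have -> : inner (fun x => lam%:C * f x - weak_laplacian f x) G =
    inner (fun x => lam%:C * f x - weak_laplacian f x) (fun x => (complex.Re (G x))%:C).
  apply: (inner_ae mh mh (cL2_measurable LG)); [|by apply: aeW|].
    by split=> //; exact: measurable_cst.
  by apply: filterS Gi => x Gx; apply: complex_parts_eq.
have hR x : complex.Re (lam%:C * f x - weak_laplacian f x) =
    helm lam (fun x => complex.Re (f x)) (fun j x => complex.Re (wpd j (wpd j f) x)) x.
  rewrite /helm /weak_laplacian !partsE mul0r subr0; congr (_ - _).
  exact: (big_morph _ (@cReD R) (erefl : complex.Re (0 : C) = 0)).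
have hI x : complex.Im (lam%:C * f x - weak_laplacian f x) =
    helm lam (fun x => complex.Im (f x)) (fun j x => complex.Im (wpd j (wpd j f) x)) x.
  rewrite /helm /weak_laplacian !partsE mul0r addr0; congr (_ - _).
  exact: (big_morph _ (@cImD R) (erefl : complex.Im (0 : C) = 0)).
apply: complex_parts_eq; rewrite /inner ?Re_cint ?Im_cint.
  rewrite -(HG (fun x => complex.Re (f x)) (fun j x => complex.Re (wpd j f x)) (fun j x => complex.Re (wpd j (wpd j f) x))) => //.
  - by apply: eq_Rint => x; rewrite cReM hR cReJ cImJ cReC cImC oppr0 mulr0 subr0.
  - by move=> j; case: (gf j) => _ [].
  - by move=> j; case: (gf2 j) => _ [].
  - by move=> j; case: (gf j) => /is_wpdP[].
  - by move=> j; case: (gf2 j) => /is_wpdP[].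
rewrite -(HG (fun x => complex.Im (f x)) (fun j x => complex.Im (wpd j f x)) (fun j x => complex.Im (wpd j (wpd j f) x))) => //.
- by apply: eq_Rint => x; rewrite cImM hI cReJ cImJ cReC cImC oppr0 mulr0 add0r.
- by move=> j; case: (gf j) => _ [].
- by move=> j; case: (gf2 j) => _ [].
- by move=> j; case: (gf j) => /is_wpdP[].
- by move=> j; case: (gf2 j) => /is_wpdP[].
Qed.

(** Write w = -lam u + h with h = (lam - Delta) f. Against v = g + d G, integration by parts treats
    the pairing of h with g, and its pairing with G is f(0), which the boundary condition turns into
    (alpha + beta) c. *)
Lemma Lap_alpha_form (al lam : R) u w v g d f c :
  inner (fun x => lam%:C * f x - weak_laplacian f x) G = f 0 ->
  decomp in_H2 G u f c -> (al + beta_pt N lam)%:C * c = f 0 -> cmeasurable w ->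
  {ae mu, forall x, lam%:C * u x + w x = lam%:C * f x - weak_laplacian f x} ->
  decomp in_H1 G v g d -> form_alpha al lam u f c v g d = inner w v.
Proof.
move=> hG [Hf mu_ uf] bc mw uw vg.
have uf1 : decomp in_H1 G u f c by split=> //; case: Hf.
have [Lf Lu _] := decomp_H1_cL2 uf1; have [Lg Lv _] := decomp_H1_cL2 vg.
have [Hg _ _] := vg; have [Ll IBP] := H2_laplacian_IBP Hf Hg.
pose h x : C := lam%:C * f x - weak_laplacian f x.
have hE : h = fun x => (-1) * weak_laplacian f x + lam%:C * f x.
  by apply/funext => x; rewrite /h mulN1r addrC.
have Lh : cL2 h by rewrite hE; exact: cL2D (cL2Z _ Ll) (cL2Z _ Lf).
have -> : inner w v = inner (fun x => - lam%:C * u x + h x) v.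
  apply: inner_ae => //; try exact: cL2_measurable; last by apply: aeW.
    exact: cL2_measurable (cL2D (cL2Z _ Lu) Lh).
  by apply: filterS uw => x e; rewrite /h -e; ring.
rewrite (inner_linear_l _ (cigr_inner Lu Lv) (cigr_inner Lh Lv)) (inner_decomp_r vg Lh) hG -bc.
have -> : inner h g = lam%:C * inner f g + grad_inner f g.
  rewrite hE (inner_linear_l _ (cigr_inner Ll Lg) (cigr_inner (cL2Z _ Lf) Lg)) IBP.
  have -> : (fun x => lam%:C * f x) = (fun x => (lam%:C - 1) * f x + f x) by apply/funext => x; ring.
  rewrite (inner_linear_l _ (cigr_inner Lf Lg) (cigr_inner Lf Lg)).
  by generalize (grad_inner f g) (inner f g) => *; ring.
have alg (a b x y z k k' : C) : a + k * b + k' * x * y - k * z = - k * z + (y * (k' * x) + (k * b + a)) by ring.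
exact: alg.
Qed.

End energy_space.

Theorem proposition1p2 (R : realType) (N : nat) (alpha p lam : R)
    (G : 'rV[R]_N -> R[i])
    (hN : N = 2%N \/ N = 3%N)
    (halpha : N = 3%N -> alpha < 0)
    (hp : 1 < p) (hp3 : N = 3%N -> p < 2)
    (hlam : 0 < lam)
    (hG : is_green lam G) :
  exists T : ('rV[R]_N -> R[i]) -> ('rV[R]_N -> R[i]) -> R[i],
    [/\ (forall u, in_X0 p G u -> in_X0_dual p G (T u)) /\
        (forall a u u' v, in_X0 p G u -> in_X0 p G u' -> in_X0 p G v ->
           T (fun x => a * u x + u' x) v = a * T u v + T u' v),
        (forall u f c v g d,
           decomp (in_Lp_dotH1 (p + 1)) G u f c ->
           decomp (in_Lp_dotH1 (p + 1)) G v g d ->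
           T u v = grad_inner f g
             + (alpha + beta_pt N lam + lam * Lp_norm 2 G ^+ 2)%:C * c * d^*
             - lam%:C * d^* * inner u G
             - lam%:C * c * (inner v G)^*),
        (forall u, in_H1alpha G u -> in_X0 p G u) /\
        (forall u w v, Lap_alpha alpha lam G u w -> in_H1alpha G v ->
           T u v = inner w v)
      & forall u f c v g d,
          decomp in_H1 G u f c -> decomp in_H1 G v g d ->
          T u v = form_alpha alpha lam u f c v g d].
Proof.
have [LG [Gp Gq] nG Gi HG] := green_facts hN hp hp3 hlam hG.
pose k0 := alpha + beta_pt N lam + lam * Lp_norm 2 G ^+ 2.
have H1_X0 u f c : decomp in_H1 G u f c -> decomp (in_Lp_dotH1 (p + 1)) G u f c.
  by move=> [Hf mu_ uf]; split=> //; split; [exact: H1_in_Lp|case: Hf].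
have T_H1 u f c v g d : decomp in_H1 G u f c -> decomp in_H1 G v g d ->
    ext_op p lam k0 G u v = form_alpha alpha lam u f c v g d.
  move=> uf vg; rewrite -(ext_form_H1 LG alpha lam uf vg).
  exact: ext_opE (H1_X0 _ _ _ uf) (H1_X0 _ _ _ vg).
exists (ext_op p lam k0 G); split.
- split; first by move=> u; exact: ext_op_dual.
  by move=> a u u' v; exact: ext_op_linear_l.
- by move=> u f c v g d uf vg; exact: ext_opE.
- split; first by move=> u [f [c uf]]; exists f, c; exact: H1_X0.
  move=> u w v [f [c [uf [cr ci] bc mw uw]]] [g [d vg]].
  have [Hf mu_ e] := uf.
  have uf1 : decomp in_H1 G u f c by split=> //; case: Hf.
  rewrite (T_H1 _ _ _ _ _ _ uf1 vg).
  exact: Lap_alpha_form (inner_green LG Gi HG Hf cr ci) uf bc mw uw vg.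
- exact: T_H1.
Qed.
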